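(* Under the standing assumptions (A1)–(A6) of the abstract setting, let $c\in\mathcal I$. Suppose that $d''(c)<0$ and that the following local existence assumption holds: there exist $\nu_*>0$ and $t_0>0$ such that for all initial data $u_0\in\mathcal U_{\nu_*}^{\mathbb W}$ there exists a unique solution of $\frac{du}{dt}=J(u)DE(u)$, $u(0)=u_0$, on the interval $[0,t_0)$. Then the bound state $U_c$ is orbitally unstable: there exists $\nu_0>0$ such that for every $0<\nu<\nu_0$ there exists initial data in $\mathcal U_\nu^{\mathbb W}$ whose corresponding solution exits $\mathcal U_{\nu_0}^{\mathbb W}$ in finite time.
   Context: Abstract setting. $\mathbb W\hookrightarrow\mathbb V\hookrightarrow\mathbb X$ (continuous embeddings), $\mathbb X$ a real Hilbert space with inner product $(\cdot,\cdot)_{\mathbb X}$, $\mathbb V,\mathbb W$ reflexive Banach spaces; $I:\mathbb X\to\mathbb X^*$, $Iu=(u,\cdot)_{\mathbb X}$; $\langle\cdot,\cdot\rangle$ is the duality pairing (biduals identified); $\mathcal O\subset\mathbb X$ is open. (A1) There are $\theta\in(0,1]$, $C>0$ with $\|u\|_{\mathbb V}^3\le C\|u\|_{\mathbb X}^{2+\theta}\|u\|_{\mathbb W}^{1-\theta}$ for all $u\in\mathbb W$. (A2) $\hat J:\mathcal D(\hat J)\subset\mathbb X^*\to\mathbb X$ is closed linear, densely defined and injective. For $u\in\mathcal O\cap\mathbb V$, $B(u)\in\mathrm{Lin}(\mathbb X)$ is bounded and bijective, and $u\mapsto B(u)$ is in $C^1(\mathcal O\cap\mathbb V;\mathrm{Lin}(\mathbb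 X))\cap C^1(\mathcal O\cap\mathbb W;\mathrm{Lin}(\mathbb W))$. $J(u):=B(u)\hat J$ satisfies $\langle J(u)v,w\rangle=-\langle v,J(u)w\rangle$ for all $v,w\in\mathcal D(\hat J)$. (A3) $E,P\in C^3(\mathcal O\cap\mathbb V;\mathbb R)$ and there are $\nabla E,\nabla P\in C^0(\mathcal O\cap\mathbb V;\mathbb X^* )$ such that $\nabla E(u),\nabla P(u)$ extend $DE(u),DP(u)$. A solution of $\frac{du}{dt}=J(u)DE(u)$, $u(0)=u_0$, on $[0,t_0)$ is $u\in C^0([0,t_0);\mathcal O\cap\mathbb W)$ with $u(0)=u_0$, $\frac d{dt}\langle u(t),w\rangle=-\langle\nabla E(u(t)),J(u(t))w\rangle$ in the distributional sense on $(0,t_0)$ for all $w\in\mathcal D(\hat J)$, and with $E(u(t))$, $P(u(t))$ conserved. (A4) $T(s):\mathbb X\to\mathbb X$, $s\in\mathbb R$, are affine with linear part $dT(s)u=T(s)u-T(s)0$, and: (i) $\mathcal O,\mathbb V,\mathbb W$ are invariant under $T$, and $I^{-1}\mathcal D(\hat J)$ under $dT$. (ii) $T(0)=\mathrm{Id}$, $T(s+r)=T(s)T(r)$. (iii) $dT(s)$ is unitary on $\mathbb X$ and isometric on $\mathbb V$ and $\mathbb W$. (iv) $T$ is strongly continuous on $\mathbb X,\mathbb V,\mathbb W$. (v) $T(\cdot)0\in C^3(\mathbb R;\mathbb W)$ and $\|T(s)0\|_{\mathbb W}\le\omega(\|T(s)0\|_{\mathbb X})$ for an increasing $\omega:[0,\infty)\to[0,\infty)$.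 (vi) $\hat JI\,dT(s)=dT(s)\hat JI$ and $dT(s)B(u)=B(T(s)u)dT(s)$ for $s\in\mathbb R$, $u\in\mathcal O\cap\mathbb V$. (vii) $T'(0)u=\lim_{s\to0}s^{-1}(T(s)u-u)=dT'(0)u+T'(0)0$ is the generator, with dense domain $\mathcal D(T'(0))\subset\mathbb X$ where the limit exists in $\mathbb X$; $\mathcal D(T'(0)|_{\mathbb V})$, $\mathcal D(T'(0)|_{\mathbb W})$ are the dense subspaces of $\mathbb V$, $\mathbb W$ where it exists in $\mathbb V$, $\mathbb W$. For $u\in\mathcal D(T'(0)|_{\mathbb V})\cap\mathcal O$: $\nabla P(u)\in\mathcal D(\hat J)$ and $T'(0)u=J(u)\nabla P(u)$. Moreover $\hat JI\,dT'(0)=dT'(0)\hat JI$. (viii) $\mathcal D(T'(0)|_{\mathbb W})\cap\mathrm{Rng}\,\hat J$ is dense in $\mathbb X$. (ix) $E(T(s)u)=E(u)$ for $u\in\mathcal O\cap\mathbb V$, $s\in\mathbb R$. (A5) $\mathcal I\subset\mathbb R$ is a nonempty open interval and for each $c\in\mathcal I$, $U_c\in\mathcal O\cap\mathbb W$ is a bound state, i.e. $u(t)=T(ct)U_c\in C^1(\mathbb R;\mathcal O\cap\mathbb W)$ is a solution. (i) $c\mapsto U_c\in\mathcal O\cap\mathbb W$ is $C^1$. (ii) $U_c\in\mathcal D(T'''(0))\cap\mathcal D(\hat JIT'(0))$ (with $T^{(k)}(s)U$ denoting the $k$-th derivative of $s\mapsto T(s)U$ in $\mathbb X$), and $U_c,\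 \hat JIT'(0)U_c\in\mathcal D(T'(0)|_{\mathbb W})$. (iii) $T'(0)U_c\ne0$. (iv) Either $s\mapsto T(s)U_c$ is periodic or $\liminf_{|s|\to\infty}\|T(s)U_c-U_c\|_{\mathbb X}>0$. (A6) With $E_c:=E-cP$, the operator $D^2E_c(U_c)\in\mathrm{Lin}(\mathbb V,\mathbb V^* )$ extends uniquely to a bounded $H_c:\mathbb X\to\mathbb X^*$ such that $I^{-1}H_c$ is self-adjoint and $\mathrm{spec}(I^{-1}H_c)=\{-\mu_c^2\}\cup\{0\}\cup\Sigma_c$, where $-\mu_c^2<0$ is a simple eigenvalue with unit eigenvector $\chi_c$, $0$ is a simple eigenvalue with eigenvector $T'(0)U_c$, and $\Sigma_c\subset(0,\infty)$ is bounded away from $0$. Notation: $d(c)=E(U_c)-cP(U_c)$, $c\in\mathcal I$; $\mathcal U_\nu^{\mathbb W}=\{u\in\mathcal O\cap\mathbb W:\inf_s\|u-T(s)U_c\|_{\mathbb W}<\nu\}$. *)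

(* Defs.v *)
From HB Require Import structures.
From mathcomp Require Import all_boot all_order all_algebra.
From mathcomp Require Import all_classical all_reals all_analysis.
From mathcomp Require Import ring.

Set Implicit Arguments.
Unset Strict Implicit.
Unset Printing Implicit Defensive.
Import Order.TTheory GRing.Theory Num.Theory.
Import numFieldNormedType.Exports.
Local Open Scope classical_set_scope.
Local Open Scope ring_scope.

Section Blin.
Context {R : realType} (V W : normedModType R).

Definition is_blin : {pred V -> W} :=
  fun f => `[< linear f /\ continuous f >].

Record blin := Blin { blin_fun :> V -> W ; _ : blin_fun \in is_blin }.

HB.instance Definition _ := [isSub for blin_fun].
HB.instance Definition _ := [Choice of blin by <:].

Lemma blinP (f : blin) : linear f /\ continuous f.
Proof. by case: f => f /= /asboolP. Qed.

HB.instance Definition _ (f : blin) :=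
  @GRing.isLinear.Build R V W *:%R (blin_fun f) (blinP f).1.

Lemma is_blin_submod : submod_closed is_blin.
Proof.
split=> [|a f g /asboolP[lf cf] /asboolP[lg cg]]; apply/asboolP.
  split=> [b x y|x] /=; first by rewrite scaler0 addr0.
  exact: cvg_cst.
split=> [b x y|x] /=.
  rewrite !fctE lf lg !scalerDr !scalerA mulrC -!addrA; congr (_ + _).
  by rewrite addrCA.
by apply: cvgD; [apply: cvgZl_tmp; exact: (cf x)|exact: (cg x)].
Qed.

HB.instance Definition _ :=
  GRing.isSubmodClosed.Build R (V -> W) is_blin is_blin_submod.
HB.instance Definition _ := [SubChoice_isSubLmodule of blin by <:].

Definition opnorm (f : blin) : R :=
  sup [set `|f x| | x in [set x : V | `|x| <= 1]].

Lemma opnorm_has_sup (f : blin) :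
  has_sup [set `|f x| | x in [set x : V | `|x| <= 1]].
Proof.
split; first by exists `|f 0|, 0 => //=; rewrite normr0.
have /linear_bounded_continuous/bounded_funP/(_ 1)[M fM] := (blinP f).2.
by exists M => _ [x /= x1 <-]; exact: fM.
Qed.

Lemma blin_le_opnorm (f : blin) x : `|f x| <= opnorm f * `|x|.
Proof.
have [->|x0] := eqVneq x 0; first by rewrite linear0 !normr0 mulr0.
rewrite -ler_pdivrMr ?normr_gt0//.
apply: sup_upper_bound; first exact: opnorm_has_sup.
exists (`|x|^-1 *: x) => /=.
  by rewrite normrZ normfV normr_id mulVf// normr_eq0.
by rewrite linearZ/= normrZ normfV normr_id mulrC.
Qed.

Lemma opnorm_le (f : blin) (M : R) :
  (forall x, `|x| <= 1 -> `|f x| <= M) -> opnorm f <= M.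
Proof.
move=> fM; apply: ge_sup; first exact: (opnorm_has_sup f).1.
by move=> _ [x /= x1 <-]; exact: fM.
Qed.

Lemma opnorm_ge0 (f : blin) : 0 <= opnorm f.
Proof.
apply: (@le_trans _ _ `|f 0|) => //.
apply: sup_upper_bound; first exact: opnorm_has_sup.
by exists 0 => //=; rewrite normr0.
Qed.

Lemma opnorm_triangle f g : opnorm (f + g) <= opnorm f + opnorm g.
Proof.
apply: opnorm_le => x x1; rewrite (le_trans (ler_normD _ _))// lerD//.
  by rewrite (le_trans (blin_le_opnorm _ _))// ler_piMr// opnorm_ge0.
by rewrite (le_trans (blin_le_opnorm _ _))// ler_piMr// opnorm_ge0.
Qed.

Lemma opnormZ_le (a : R) f : opnorm (a *: f) <= `|a| * opnorm f.
Proof.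
apply: opnorm_le => x x1; rewrite [leLHS]normrZ ler_wpM2l//.
by rewrite (le_trans (blin_le_opnorm _ _))// ler_piMr// opnorm_ge0.
Qed.

Lemma opnormZ (a : R) f : opnorm (a *: f) = `|a| * opnorm f.
Proof.
apply/eqP; rewrite eq_le opnormZ_le/=.
have [->|a0] := eqVneq a 0; first by rewrite normr0 mul0r opnorm_ge0.
rewrite -ler_pdivlMl ?normr_gt0// -normfV.
by have := opnormZ_le a^-1 (a *: f); rewrite scalerA mulVf// scale1r.
Qed.

Lemma opnorm0_eq0 f : opnorm f = 0 -> f = 0.
Proof.
move=> f0; apply/val_inj/funext => x /=.
apply/eqP; rewrite -normr_le0.
by have := blin_le_opnorm f x; rewrite f0 mul0r.
Qed.

HB.instance Definition _ :=
  Lmodule_isNormed.Build R blin opnorm_triangle opnormZ opnorm0_eq0.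

Lemma blin_normE (f : blin) : `|f| = opnorm f.
Proof. by []. Qed.

Lemma blin_le (f : blin) x : `|f x| <= `|f| * `|x|.
Proof. exact: blin_le_opnorm. Qed.

End Blin.

Definition dual {R : realType} (V : normedModType R) := blin V R^o.

Definition reflexive_space {R : realType} (V : normedModType R) :=
  forall Phi : dual (dual V), exists v : V, forall f : dual V, Phi f = f v.

Section Differentiability.
Context {R : realType}.

Definition frechet {V W : normedModType R} (f : V -> W) (x : V) : blin V W :=
  if pselect (differentiable f x) is left h then
    Blin (introT (asboolP _)
      (conj (@linearP _ _ _ _ ('d f x)) (diff_continuous h)))
  else 0.

(* Meant for O open, so that continuity at the points of O is C^0(O). *)
Fixpoint Ck (k : nat) {V W : normedModType R} (O : set V) (f : V -> W) : Prop :=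
  if k is k'.+1 then
    (forall x, O x -> differentiable f x) /\ Ck k' O (frechet f)
  else forall x, O x -> {for x, continuous f}.

(* The derivatives of order < n exist near s, and the n-th one exists at s. *)
Fixpoint nderivable {V : normedModType R} (n : nat) (f : R -> V) (s : R) : Prop :=
  if n is n'.+1 then
    (\forall r \near s, nderivable n' f r) /\ derivable (derive1n n' f) s 1
  else True.

End Differentiability.

(* Only the values of [pfun] on [dom] are meaningful. *)
Record partial_map (X Y : Type) := PartialMap { dom : set X ; pfun :> X -> Y }.

Definition total_map {X Y : Type} (f : X -> Y) : partial_map X Y :=
  PartialMap setT f.

Definition comp_map {X Y Z : Type} (g : partial_map Y Z) (f : partial_map X Y) :
    partial_map X Z :=
  PartialMap [set x | dom f x /\ dom g (f x)] (g \o f).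

Definition eq_map {X Y : Type} (f g : partial_map X Y) : Prop :=
  dom f = dom g /\ forall x, dom f x -> f x = g x.

Section LinearOperators.
Context {R : realType} {X Y : normedModType R}.

Definition linear_op (A : partial_map X Y) : Prop :=
  dom A 0 /\ forall (a : R) x y, dom A x -> dom A y ->
    dom A (a *: x + y) /\ A (a *: x + y) = a *: A x + A y.

Definition closed_op (A : partial_map X Y) : Prop :=
  closed [set p : X * Y | dom A p.1 /\ p.2 = A p.1].

Definition injective_op (A : partial_map X Y) : Prop :=
  forall x y, dom A x -> dom A y -> A x = A y -> x = y.

Definition range_op (A : partial_map X Y) : set Y := A @` dom A.

End LinearOperators.

HB.mixin Record CompleteNormedModule_isHilbert (R : realType) X
    & CompleteNormedModule R X := {
  inner : X -> X -> R ;
  innerC : forall x y, inner x y = inner y x ;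
  inner_linear : forall a x y z,
    inner z (a *: x + y) = a * inner z x + inner z y ;
  inner_norm : forall x, inner x x = `|x| ^+ 2
}.

#[short(type="hilbertType")]
HB.structure Definition Hilbert (R : realType) :=
  {X of CompleteNormedModule R X & CompleteNormedModule_isHilbert R X}.

Section Hilbert.
Context {R : realType} {X : hilbertType R}.

Lemma inner_polar (x y : X) :
  inner x y = ((`|x + y| ^+ 2 - `|x| ^+ 2 - `|y| ^+ 2) / 2 : R).
Proof.
rewrite -!inner_norm.
have D (a b c : X) : inner c (a + b) = inner c a + inner c b.
  by rewrite -[a in LHS]scale1r inner_linear mul1r.
by rewrite D !(innerC (x + y)) !D (innerC y x); field.
Qed.

Fact riesz_subproof (x : X) : (inner x : X -> R^o) \in @is_blin R X R^o.
Proof.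
apply/asboolP; split=> [a y z|y]; first exact: inner_linear.
rewrite /continuous_at.
have -> : inner x = fun y => ((`|x + y| ^+ 2 - `|x| ^+ 2 - `|y| ^+ 2) / 2 : R).
  by apply/funext => z; exact: inner_polar.
apply: cvgMr_tmp; apply: cvgB; last first.
  by rewrite expr2; apply: cvgM; apply: cvg_norm.
apply: cvgB; last exact: cvg_cst.
by rewrite expr2; apply: cvgM; apply: cvg_norm; apply: cvgD => //; exact: cvg_cst.
Qed.

Definition riesz (x : X) : dual X := Blin (riesz_subproof x).

Definition self_adjoint (A : blin X X) : Prop :=
  forall x y, inner (A x) y = inner x (A y).

(* The real spectrum; a self-adjoint operator has no other spectrum. *)
Definition spectrum (A : blin X X) : set R :=
  [set l | ~ exists Q : blin X X,
     (forall x, Q (A x - l *: x) = x) /\ (forall x, A (Q x) - l *: Q x = x)].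

(* For self-adjoint A, algebraic and geometric simplicity coincide. *)
Definition simple_eigenvalue (A : blin X X) (l : R) (x : X) : Prop :=
  [/\ x <> 0, A x = l *: x &
      forall y, A y = l *: y -> exists a : R, y = a *: x].

Definition unitary (Q : X -> X) : Prop :=
  (forall x y, inner (Q x) (Q y) = inner x y) /\ (forall y, exists x, Q x = y).

End Hilbert.

Section AffineGroups.
Context {R : realType} {F : normedModType R}.

Definition linpart (T : R -> F -> F) (s : R) (u : F) : F := T s u - T s 0.

(* T'(0) *)
Definition generator (T : R -> F -> F) : partial_map F F :=
  PartialMap [set u | cvg (s^-1 *: (T s u - u) @[s --> (0 : R)^'])]
       (fun u => lim (s^-1 *: (T s u - u) @[s --> (0 : R)^'])).

Definition strongly_continuous (T : R -> F -> F) : Prop :=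
  forall u, continuous (T ^~ u).

End AffineGroups.

Section Distributions.
Context {R : realType}.

Definition test_function (S : set R) (phi : R -> R) : Prop :=
  (forall n t, derivable (derive1n n phi) t 1) /\
  exists K, [/\ compact K, K `<=` S & forall t, ~ K t -> phi t = 0].

Definition distributional_derivative (S : set R) (f g : R -> R) : Prop :=
  forall phi, test_function S phi ->
    (\int[lebesgue_measure]_(t in S) (f t * derive1 phi t) =
     - \int[lebesgue_measure]_(t in S) (g t * phi t))%R.

End Distributions.

(* The inclusions W -> V -> X are the maps [s_jW], [s_jV].  Functions on the
   intersections of O with V and W are total functions on V and W that only
   matter at the points sent into O.  [s_BW], [s_TV] and [s_TW] are B and T
   acting in W, V and W; the embeddings being injective, they are determined by
   [s_B] and [s_T] through the compatibility clauses in [A2] and [A4]. *)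
Record setting (R : realType) (X : hilbertType R)
    (V W : completeNormedModType R) := Setting {
  s_jV : blin V X ;
  s_jW : blin W V ;
  s_O : set X ;
  s_Jhat : partial_map (dual X) X ;
  s_B : V -> blin X X ;
  s_BW : W -> blin W W ;
  s_E : V -> R^o ;
  s_P : V -> R^o ;
  s_gradE : V -> dual X ;
  s_gradP : V -> dual X ;
  s_T : R -> X -> X ;
  s_TV : R -> V -> V ;
  s_TW : R -> W -> W ;
  s_speeds : set R ;
  s_U : R -> W
}.

Section Assumptions.
Context {R : realType} {X : hilbertType R} {V W : completeNormedModType R}.
Variable M : setting X V W.

Local Notation jV := (s_jV M).
Local Notation jW := (s_jW M).
Local Notation O := (s_O M).
Local Notation Jhat := (s_Jhat M).
Local Notation B := (s_B M).
Local Notation BW := (s_BW M).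
Local Notation E := (s_E M).
Local Notation P := (s_P M).
Local Notation gradE := (s_gradE M).
Local Notation gradP := (s_gradP M).
Local Notation T := (s_T M).
Local Notation TV := (s_TV M).
Local Notation TW := (s_TW M).
Local Notation speeds := (s_speeds M).
Local Notation U := (s_U M).

Definition jWX (u : W) : X := jV (jW u).
Definition OV : set V := jV @^-1` O.
Definition OW : set W := jWX @^-1` O.

Definition spaces : Prop :=
  [/\ injective jV, injective jW, reflexive_space V, reflexive_space W & open O].

Definition A1 : Prop :=
  exists theta C : R, [/\ 0 < theta <= 1, 0 < C &
    forall u : W, `|jW u| ^+ 3 <=
      C * (`|jWX u| `^ (2 + theta)) * (`|u| `^ (1 - theta))].

Definition J (u : V) : partial_map (dual X) X := comp_map (total_map (B u)) Jhat.

Definition A2 : Prop :=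
  [/\ linear_op Jhat /\ closed_op Jhat, dense (dom Jhat) /\ injective_op Jhat,
      forall u, OV u -> bijective (B u),
      [/\ Ck 1 OV B,
          forall u w, OW u -> jWX (BW u w) = B (jW u) (jWX w) &
          Ck 1 OW BW] &
      forall u, OV u -> forall v w : dual X, dom Jhat v -> dom Jhat w ->
        w (J u v) = - v (J u w)].

Definition A3 : Prop :=
  [/\ Ck 3 OV E, Ck 3 OV P, Ck 0 OV gradE, Ck 0 OV gradP &
      forall u, OV u -> forall v,
        gradE u (jV v) = frechet E u v /\ gradP u (jV v) = frechet P u v].

(* Solutions on a set of times D (not the initial condition); the weak
   equation is imposed on the interior of D. *)
Definition solution_on (D : set R) (u : R -> W) : Prop :=
  [/\ {within D, continuous u},
      forall t, D t -> OW (u t),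
      forall w : dual X, dom Jhat w ->
        distributional_derivative D°
          (fun t => w (jWX (u t)))
          (fun t => - gradE (jW (u t)) (J (jW (u t)) w)),
      forall s t, D s -> D t -> E (jW (u s)) = E (jW (u t)) &
      forall s t, D s -> D t -> P (jW (u s)) = P (jW (u t))].

Definition solution (t0 : R) (u0 : W) (u : R -> W) : Prop :=
  solution_on `[0, t0[ u /\ u 0 = u0.

Definition dT : R -> X -> X := linpart T.

Definition JhatI : partial_map X X := comp_map Jhat (total_map riesz).

Record A4 : Prop := {
  A4_linpart : forall s, linear (dT s) ;
  A4_i_O : forall s u, O u -> O (T s u) ;
  A4_i_V : forall s v, jV (TV s v) = T s (jV v) ;
  A4_i_W : forall s w, jWX (TW s w) = T s (jWX w) ;
  A4_i_dom : forall s u, dom Jhat (riesz u) -> dom Jhat (riesz (dT s u)) ;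
  A4_ii_0 : forall u, T 0 u = u ;
  A4_ii_D : forall s r u, T (s + r) u = T s (T r u) ;
  A4_iii_X : forall s, unitary (dT s) ;
  A4_iii_V : forall s v, `|linpart TV s v| = `|v| ;
  A4_iii_W : forall s w, `|linpart TW s w| = `|w| ;
  A4_iv_X : strongly_continuous T ;
  A4_iv_V : strongly_continuous TV ;
  A4_iv_W : strongly_continuous TW ;
  A4_v_C3 : Ck 3 setT (fun s : R^o => TW s 0) ;
  A4_v_bound : exists omega : R -> R,
    [/\ forall x, 0 <= x -> 0 <= omega x,
        forall x y, 0 <= x -> x <= y -> omega x <= omega y &
        forall s, `|TW s 0| <= omega `|T s 0|] ;
  A4_vi_J : forall s,
    eq_map (comp_map JhatI (total_map (dT s)))
           (comp_map (total_map (dT s)) JhatI) ;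
  A4_vi_B : forall s u x, OV u -> dT s (B u x) = B (TV s u) (dT s x) ;
  A4_vii_dense_X : dense (dom (generator T)) ;
  A4_vii_dense_V : dense (dom (generator TV)) ;
  A4_vii_dense_W : dense (dom (generator TW)) ;
  A4_vii_affine : forall u, dom (generator T) u ->
    [/\ dom (generator dT) u, dom (generator T) 0 &
        generator T u = generator dT u + generator T 0] ;
  A4_vii_P : forall u, dom (generator TV) u -> OV u ->
    dom Jhat (gradP u) /\ generator T (jV u) = J u (gradP u) ;
  A4_vii_comm :
    eq_map (comp_map JhatI (generator dT)) (comp_map (generator dT) JhatI) ;
  A4_viii : dense ((jWX @` dom (generator TW)) `&` range_op Jhat) ;
  A4_ix : forall s u, OV u -> E (TV s u) = E u
}.

Definition A5 : Prop :=
  [/\ speeds !=set0, open speeds, is_interval speeds,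
      Ck 1 speeds (U : R^o -> W) &
      forall c, speeds c ->
      [/\ OW (U c),
          Ck 1 setT (fun t : R^o => TW (c * t) (U c)) /\
            solution_on setT (fun t => TW (c * t) (U c)),
          nderivable 3 (fun s => T s (jWX (U c))) 0 /\
            dom (comp_map JhatI (generator T)) (jWX (U c)),
          dom (generator TW) (U c) /\
            (exists2 w, dom (generator TW) w &
               jWX w = comp_map JhatI (generator T) (jWX (U c))) &
          generator T (jWX (U c)) <> 0 /\
            ((exists2 p, 0 < p & periodic (fun s => T s (jWX (U c))) p) \/
             (0 < limf_einf (fun s => `|T s (jWX (U c)) - jWX (U c)|%:E)
                    (pinfty_nbhs R `&` ninfty_nbhs R))%E)]].

Definition augE (c : R) (u : V) : R^o := E u - c * P u.

Definition extends_hessian (c : R) (H : blin X (dual X)) : Prop :=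
  forall v w : V,
    H (jV v) (jV w) = frechet (frechet (augE c)) (jW (U c)) v w.

(* [A] is I^{-1} H_c. *)
Definition A6 : Prop :=
  forall c, speeds c ->
  exists (H : blin X (dual X)) (A : blin X X) (mu : R) (chi : X) (Sigma : set R),
    [/\ extends_hessian c H /\ (forall H', extends_hessian c H' -> H' = H),
        (forall x, riesz (A x) = H x) /\ self_adjoint A,
        spectrum A = [set - mu ^+ 2] `|` [set 0] `|` Sigma,
        [/\ - mu ^+ 2 < 0, simple_eigenvalue A (- mu ^+ 2) chi, `|chi| = 1 &
            simple_eigenvalue A 0 (generator T (jWX (U c)))] &
        exists2 delta, 0 < delta & forall l, Sigma l -> delta <= l].

Definition moment (c : R) : R := E (jW (U c)) - c * P (jW (U c)).

Definition tube (c nu : R) : set W :=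
  [set u | OW u /\ inf (range (fun s => `|u - TW s (U c)|)) < nu].

Definition local_existence (c : R) : Prop :=
  exists nu t0 : R, [/\ 0 < nu, 0 < t0 &
    forall u0, tube c nu u0 ->
    exists2 u, solution t0 u0 u &
      forall v, solution t0 u0 v -> forall t, t \in `[0, t0[ -> v t = u t].

(* "The corresponding solution exits": there is a solution on some [0, t1)
   with these data, and every such solution leaves the tube before t1. *)
Definition orbitally_unstable (c : R) : Prop :=
  exists2 nu0, 0 < nu0 & forall nu, 0 < nu < nu0 ->
  exists2 u0, tube c nu u0 &
  exists t1 : R, [/\ 0 < t1, exists u, solution t1 u0 u &
    forall u, solution t1 u0 u ->
      exists2 t, t \in `[0, t1[ & ~ tube c nu0 (u t)].

End Assumptions.

(* Main.v *)
Require Import Defs.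
From mathcomp Require Import all_boot all_order all_algebra.
From mathcomp Require Import all_classical all_reals all_analysis.
From mathcomp Require Import ring lra.
Set Implicit Arguments.
Unset Strict Implicit.
Unset Printing Implicit Defensive.
Import Order.TTheory GRing.Theory Num.Theory.
Import numFieldNormedType.Exports.
Local Open Scope classical_set_scope.
Local Open Scope ring_scope.

(** Let [x0 = T'(0) Uc] be the tangent to the orbit of the bound state and
    [A = I^{-1} H_c] the Hessian of [E - c P] at [Uc].  A perturbation
    that lowers this energy makes a linear functional of the solution grow until the
    solution leaves the tube.

    A negative direction tangent to the momentum.  Differentiating the equation of
    the bound states in the speed gives [A psi = gradP(Uc)] with [psi = dU_c/dc],
    and [(A psi, psi) = <gradP(Uc), psi> = - d''(c) > 0].  As [A] has a negative
    eigenvector [chi], the combination of [chi] and [psi] annihilated by [gradP(Uc)]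
    is negative for the form of [A].  By density one may take instead a vector
    [z = J(Uc) I y] lying in [W], for which the pairing [(y, .)] can be
    differentiated along solutions ([negative_direction]).  Since [A] has only one
    negative eigenvalue and its kernel is spanned by [x0], the form of [A] is
    coercive on the orthogonal complement of [x0] up to the square of [(A v, z)]
    ([index_one_coercive], by purely quadratic-form arguments).

    Energy.  For [u0 = Uc + eps z] with [eps] small the energy [E - c P] lies strictly
    below its value at [Uc] ([unstable_data]); it is conserved and invariant under the
    group.  Write a later state, translated by the group, as [Uc + v] with [v]
    orthogonal to [x0].  The second-order expansion of the energy, valid with a
    remainder [o(|v|_X^2)] thanks to the interpolation inequality, then gives
    [|(A v, z)| >= c1 |v|_X] ([negative_cone]) and bounds [|v|_X] from below
    ([energy_gap]).

    Growth.  If the frame follows the orbit, with a speed kept within [O(|v|)] of that of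
    the bound state by the condition that [v] be orthogonal to [x0] ([speed_bound]),
    then [d/dt (y, v) = - (A v, z) + o(|v|)], because [z] is tangent to the level sets
    of the momentum ([growth_rate]).  So [(A v, z)] keeps its sign and [(y, v)] grows
    at least linearly, which is impossible as long as [v] stays small ([escape]).

    The orthogonality condition cannot be imposed by a globally smooth choice of
    translation, as the stabilizer of [Uc] may be nontrivial.  Admissible translations are
    instead chosen at the times of a fine mesh, close to one another ([slice], which
    rests on the alternative for the returns of the orbit), and interpolated linearly
    ([growth_step]).

    Finally, solutions satisfy the weak equation in the classical sense
    ([du_bois_reymond]), and can be glued ([strict_solution_glue]): either a solution
    lives until the escape time given by [escape], or a maximal continuation by the
    local existence assumption must leave the tube. *)

(** * Inner products *)

Section InnerProduct.
Context {R : realType} {X : hilbertType R}.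
Implicit Types (x y z : X) (a : R).

Lemma innerDr x y z : inner z (x + y) = inner z x + inner z y.
Proof. by rewrite -[x in LHS]scale1r inner_linear mul1r. Qed.

Lemma innerZr a x z : inner z (a *: x) = a * inner z x.
Proof.
by have := inner_linear a x 0 z; have := inner_linear 1 0 0 z;
  rewrite scaler0 !addr0 mul1r; lra.
Qed.

Lemma innerDl x y z : inner (x + y) z = inner x z + inner y z.
Proof. by rewrite innerC innerDr !(innerC z). Qed.

Lemma innerZl a x z : inner (a *: x) z = a * inner x z.
Proof. by rewrite innerC innerZr (innerC z). Qed.

Lemma innerNr x z : inner z (- x) = - inner z x.
Proof. by rewrite -scaleN1r innerZr mulN1r. Qed.

Lemma innerNl x z : inner (- x) z = - inner x z.
Proof. by rewrite -scaleN1r innerZl mulN1r. Qed.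

Lemma innerBr x y z : inner z (x - y) = inner z x - inner z y.
Proof. by rewrite innerDr innerNr. Qed.

Lemma innerBl x y z : inner (x - y) z = inner x z - inner y z.
Proof. by rewrite innerDl innerNl. Qed.

Lemma inner0r z : inner z 0 = 0 :> R.
Proof. by rewrite -(scale0r (0 : X)) innerZr mul0r. Qed.

Lemma inner0l z : inner 0 z = 0 :> R.
Proof. by rewrite innerC inner0r. Qed.

Definition innerE := (innerDl, innerDr, innerBl, innerBr, innerNl, innerNr,
  innerZl, innerZr, inner0l, inner0r).

Lemma inner_ge0 x : 0 <= inner x x.
Proof. by rewrite inner_norm sqr_ge0. Qed.

Lemma inner_eq0 x : inner x x = 0 -> x = 0.
Proof. by rewrite inner_norm => /eqP; rewrite sqrf_eq0 normr_eq0 => /eqP. Qed.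

(** By the discriminant of [t |-> (A (x + t y), x + t y)].  Only the orthogonal
    complement of [e] is assumed nonnegative: this is the situation of an operator
    whose negative eigenvector is [e]. *)
Lemma form_cauchy_schwarz (A : blin X X) (e : X) : self_adjoint A ->
  (forall x, inner x e = 0 -> 0 <= inner (A x) x) ->
  forall x y, inner x e = 0 -> inner y e = 0 ->
  inner (A x) y ^+ 2 <= inner (A x) x * inner (A y) y.
Proof.
move=> sA A0 x y xe ye.
have form t : 0 <= inner (A x) x + 2 * t * inner (A x) y + t ^+ 2 * inner (A y) y.
  have /A0 : inner (x + t *: y) e = 0 by rewrite !innerE xe ye mulr0 addr0.
  rewrite linearD linearZ/= !innerE (innerC (A y) x) -sA.
  by set a := inner _ _; set b := inner _ _; set d := inner _ _; lra.
have := form; set b := inner (A x) y; set a := inner (A x) x.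
set d := inner (A y) y => fm.
have d0 : 0 <= d by exact: A0.
have [d00|dn0] := eqVneq d 0.
  have [->|b0] := eqVneq b 0; first by rewrite expr0n/= d00 mulr0.
  have := fm (- (a + 1) / (2 * b)); rewrite d00 mulr0 addr0.
  have -> : 2 * (- (a + 1) / (2 * b)) * b = - (a + 1) by field.
  lra.
have dp : 0 < d by rewrite lt_def dn0.
have := fm (- b / d).
have -> : a + 2 * (- b / d) * b + (- b / d) ^+ 2 * d = (a * d - b ^+ 2) / d by field.
by rewrite pmulr_lge0 ?invr_gt0// subr_ge0.
Qed.

Lemma cauchy_schwarz x y : `|inner x y| <= `|x| * `|y|.
Proof.
have form t : 0 <= inner x x + 2 * t * inner x y + t ^+ 2 * inner y y.
  have := inner_ge0 (x + t *: y); rewrite !innerE (innerC y x).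
  by set a := inner _ _; set b := inner _ _; set d := inner _ _; lra.
rewrite -ler_sqr ?nnegrE ?mulr_ge0//.
rewrite exprMn -!inner_norm real_normK ?num_real//.
have := form; set b := inner x y; set a := inner x x.
set d := inner y y => fm.
have [d00|dn0] := eqVneq d 0.
  suff -> : b = 0 by rewrite expr0n/= d00 mulr0.
  by rewrite /b (inner_eq0 d00) inner0r.
have dp : 0 < d by rewrite lt_def dn0 inner_ge0.
have := fm (- b / d).
have -> : a + 2 * (- b / d) * b + (- b / d) ^+ 2 * d = (a * d - b ^+ 2) / d by field.
by rewrite pmulr_lge0 ?invr_gt0// subr_ge0.
Qed.

End InnerProduct.

(** * Self-adjoint operators with a spectral gap *)

Section BoundedOperators.
Context {R : realType}.
Implicit Types (V W Y : normedModType R).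

Lemma blin_comp_subproof V W Y (f : blin V W) (g : blin W Y) :
  (g \o f : V -> Y) \in @is_blin R V Y.
Proof.
apply/asboolP; split=> [a x y|x] /=; first by rewrite !linearP.
by apply: continuous_comp; [exact: (blinP f).2|exact: (blinP g).2].
Qed.

Definition blin_comp V W Y (g : blin W Y) (f : blin V W) : blin V Y :=
  Blin (blin_comp_subproof f g).

Lemma blin_id_subproof V : (id : V -> V) \in @is_blin R V V.
Proof. by apply/asboolP; split=> [a x y|x] //=; exact: cvg_id. Qed.

Definition blin_id V : blin V V := Blin (blin_id_subproof V).

End BoundedOperators.

Section SelfAdjoint.
Context {R : realType} {X : hilbertType R}.
Implicit Types (A N Q : blin X X) (x y z : X).

Definition shift_op A (a : R) : blin X X := A - a *: blin_id X.

Lemma shift_opE A a x : shift_op A a x = A x - a *: x.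
Proof. by []. Qed.

Lemma shift_self_adjoint A a : self_adjoint A -> self_adjoint (shift_op A a).
Proof. by move=> sA x y; rewrite !shift_opE !innerE sA. Qed.

Lemma spectrum_shift A a l : spectrum (shift_op A a) l = spectrum A (l + a).
Proof.
congr (~ _); apply/propext.
have e x : shift_op A a x - l *: x = A x - (l + a) *: x.
  by rewrite shift_opE scalerDl opprD addrA addrAC.
by split=> -[Q [Q1 Q2]]; exists Q; split=> x; have := Q1 x; have := Q2 x; rewrite !e.
Qed.

Lemma spectrumN_bdd_below A l : ~ spectrum A l ->
  exists2 k, 0 < k & forall x, k * `|x| <= `|A x - l *: x|.
Proof.
move=> /contrapT[Q [QA _]]; exists (`|Q| + 1)^-1; first by rewrite invr_gt0 ltr_wpDl.
move=> x; rewrite -{1}(QA x) ler_pdivrMl ?ltr_wpDl//.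
by rewrite (le_trans (blin_le _ _))// ler_wpM2r// lerDl.
Qed.

Lemma quadratic_factor A p q y :
  A (A y) - (p + q) *: A y + (p * q) *: y = A (A y - p *: y) - q *: (A y - p *: y).
Proof.
have -> : A (A y - p *: y) = A (A y) - p *: A y by rewrite linearB linearZ.
by rewrite scalerBr scalerA scalerDl !opprD opprK (mulrC p) !addrA.
Qed.

(** Cauchy-Schwarz for the form of [N], applied to [x] and [N x]. *)
Lemma nonneg_form_bound N : self_adjoint N -> (forall x, 0 <= inner (N x) x) ->
  forall x, `|N x| ^+ 2 <= `|N| * inner (N x) x.
Proof.
move=> sN N0 x.
have [->|Nx0] := eqVneq (N x) 0; first by rewrite normr0 expr0n/= inner0l mulr0.
have Np : 0 < `|N x| ^+ 2 by rewrite exprn_gt0// normr_gt0.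
rewrite -(ler_pM2r Np).
have := @form_cauchy_schwarz _ _ N 0 sN (fun y _ => N0 y) x (N x) (inner0r _) (inner0r _).
rewrite inner_norm expr2 => /le_trans; apply.
rewrite -mulrA mulrCA ler_wpM2l//.
rewrite (le_trans (ler_norm _))// (le_trans (cauchy_schwarz _ _))//.
by rewrite expr2 mulrA ler_wpM2r// blin_le.
Qed.

(** A minimizing sequence of the quadratic form of [Q] on the unit sphere is a
    sequence of approximate eigenvectors: hence no [m] with [Q - m] bounded
    below can be the infimum. *)
Lemma form_lower_bound_open Q m k : self_adjoint Q -> 0 < k ->
  (forall x, m * `|x| ^+ 2 <= inner (Q x) x) ->
  (forall x, k * `|x| <= `|Q x - m *: x|) ->
  exists2 m', m < m' & forall x, m' * `|x| ^+ 2 <= inner (Q x) x.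
Proof.
move=> sQ k0 Qm Qk; pose N := shift_op Q m.
have Nform x : inner (N x) x = inner (Q x) x - m * `|x| ^+ 2.
  by rewrite shift_opE !innerE inner_norm.
have N0 x : 0 <= inner (N x) x by rewrite Nform subr_ge0.
have := nonneg_form_bound (shift_self_adjoint m sQ) N0 => Nb.
exists (m + k ^+ 2 / (`|N| + 1)).
  by rewrite ltrDl divr_gt0 ?exprn_gt0// ltr_wpDl.
move=> x; rewrite mulrDl -lerBrDl -Nform mulrAC ler_pdivrMr ?ltr_wpDl//.
rewrite -exprMn (@le_trans _ _ (`|N x| ^+ 2))//.
  by rewrite lerXn2r ?nnegrE ?mulr_ge0 ?(ltW k0)//; exact: Qk.
by rewrite (le_trans (Nb x))// mulrC mulrDr mulr1 lerDl.
Qed.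

Lemma form_infimum Q : (exists x : X, x != 0) -> exists2 m,
  (forall x, m * `|x| ^+ 2 <= inner (Q x) x) &
  forall m', (forall x, m' * `|x| ^+ 2 <= inner (Q x) x) -> m' <= m.
Proof.
move=> [e e0]; pose S := [set inner (Q x) x | x in [set x : X | `|x| = 1]].
have Sn : S !=set0.
  exists (inner (Q (`|e|^-1 *: e)) (`|e|^-1 *: e)), (`|e|^-1 *: e) => //=.
  by rewrite normrZ normfV normr_id mulVf// normr_eq0.
have lbS : has_lbound S.
  exists (- `|Q|) => _ [x /= x1 <-]; rewrite lerNl.
  rewrite (le_trans (ler_norm _))// normrN (le_trans (cauchy_schwarz _ _))//.
  by rewrite x1 mulr1 (le_trans (blin_le _ _))// x1 mulr1.
exists (inf S) => [x|m' Hm'].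
  have [->|x0] := eqVneq x 0; first by rewrite normr0 expr0n/= mulr0 inner0r.
  have xp : 0 < `|x| by rewrite normr_gt0.
  rewrite -ler_pdivlMr ?exprn_gt0//; apply: ge_inf => //.
  exists (`|x|^-1 *: x) => /=.
    by rewrite normrZ normfV normr_id mulVf// normr_eq0.
  by rewrite linearZ/= !innerE; field; rewrite gt_eqF.
apply: lb_le_inf => // _ [x /= x1 <-].
by have := Hm' x; rewrite x1 expr1n mulr1.
Qed.

(** A substitute for the functional calculus:
    [(l - a) (l - b) >= 0] on the spectrum, so the same holds for [A].  If the
    infimum [m] of the form of [(A - a) (A - b)] were negative,
    [(A - a) (A - b) - m] would be either [(A - c)^2] plus a positive constant
    or a product [(A - r1) (A - r2)] with [r1], [r2] in the gap. *)
Lemma spectral_gap_form A a b : self_adjoint A -> a <= b ->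
  (forall l, a < l < b -> ~ spectrum A l) ->
  forall x, 0 <= inner (A x - a *: x) (A x - b *: x).
Proof.
move=> sA ab gap x; rewrite leNgt; apply/negP => neg.
have x0 : x != 0.
  by apply/eqP => x0; move: neg; rewrite x0 linear0 !scaler0 subr0 inner0r ltxx.
pose Q : blin X X := blin_comp (shift_op A b) (shift_op A a).
have QE y : Q y = A (A y) - (a + b) *: A y + (a * b) *: y.
  by rewrite quadratic_factor.
have Qf y : inner (Q y) y = inner (A y - a *: y) (A y - b *: y).
  by rewrite QE !innerE sA (innerC y); ring.
have sQ : self_adjoint Q.
  move=> y z; rewrite !QE !innerE !sA; ring.
have [m Qm minf] := form_infimum Q (ex_intro _ x x0).
have m0 : m < 0.
  rewrite ltNge; apply/negP => m0; move: neg; rewrite -Qf; apply/negP.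
  by rewrite -leNgt (le_trans _ (Qm x))// mulr_ge0// exprn_ge0.
suff [k k0 Qk] : exists2 k, 0 < k & forall y, k * `|y| <= `|Q y - m *: y|.
  have [m' mm' /minf] := form_lower_bound_open sQ k0 Qm Qk.
  by rewrite leNgt mm'.
pose c := (a + b) / 2; pose D := ((b - a) / 2) ^+ 2 + m.
have [D0|D0] := ltP D 0.
  exists (- D); first by rewrite oppr_gt0.
  move=> y; have [->|y0] := eqVneq y 0; first by rewrite normr0 mulr0.
  have yp : 0 < `|y| by rewrite normr_gt0.
  rewrite -(ler_pM2r yp).
  apply: le_trans (cauchy_schwarz _ _); apply: le_trans (ler_norm _).
  rewrite -mulrA -expr2 -inner_norm.
  have -> : inner (Q y - m *: y) y = inner (A y - c *: y) (A y - c *: y)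
      - D * inner y y.
    rewrite QE /D /c !innerE sA (innerC y); by field.
  have := inner_ge0 (A y - c *: y).
  set u := inner _ _; set w := inner y y; lra.
pose r := Num.sqrt D.
have r2 : r ^+ 2 = D by exact: sqr_sqrtr.
have r0 : 0 <= r by exact: sqrtr_ge0.
have rlt : r < (b - a) / 2.
  have ba : 0 <= (b - a) / 2 by rewrite divr_ge0// subr_ge0.
  by rewrite -(@ltr_pXn2r _ 2%N)// r2 /D gtrDl.
have [k1 k10 b1] : exists2 k, 0 < k & forall y, k * `|y| <= `|A y - (c - r) *: y|.
  by apply: spectrumN_bdd_below; apply: gap; rewrite /c; lra.
have [k2 k20 b2] : exists2 k, 0 < k & forall y, k * `|y| <= `|A y - (c + r) *: y|.
  by apply: spectrumN_bdd_below; apply: gap; rewrite /c; lra.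
exists (k1 * k2); first exact: mulr_gt0.
move=> y.
have -> : Q y - m *: y =
    A (A y - (c + r) *: y) - (c - r) *: (A y - (c + r) *: y).
  rewrite -quadratic_factor QE -addrA -scalerBl; congr (_ - _ *: _ + _ *: _).
    by rewrite /c; field.
  by rewrite -[RHS]mulrC -subr_sqr r2 /D /c; field.
by rewrite (le_trans _ (b1 _))// -mulrA ler_wpM2l// ltW.
Qed.

(** The infimum of the form over the unit sphere belongs to the spectrum. *)
Lemma spectrum_form_lower_bound A a : self_adjoint A ->
  (forall l, l < a -> ~ spectrum A l) ->
  forall x, a * `|x| ^+ 2 <= inner (A x) x.
Proof.
move=> sA gap x; have [->|x0] := eqVneq x 0.
  by rewrite normr0 expr0n/= mulr0 inner0r.
have [m Qm minf] := form_infimum A (ex_intro _ x x0).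
have [/le_trans am|ma] := leP a m.
  by apply: le_trans (Qm x); rewrite ler_wpM2r ?exprn_ge0// am.
have [k k0 Qk] := spectrumN_bdd_below (gap _ ma).
have [m' mm' /minf] := form_lower_bound_open sA k0 Qm Qk.
by rewrite leNgt mm'.
Qed.

End SelfAdjoint.

(** * Coercivity in the presence of one negative direction *)

Section Limits.
Context {R : realType}.

Lemma cvg_inner {X : hilbertType R} {I : Type} {F : set_system I} {FF : Filter F}
    (f g : I -> X) (a b : X) :
  f @ F --> a -> g @ F --> b -> (inner (f i) (g i) : R) @[i --> F] --> (inner a b : R).
Proof.
move=> fa gb; rewrite inner_polar.
under eq_fun do rewrite inner_polar.
apply: cvgMr_tmp; apply: cvgB; first apply: cvgB.
- by rewrite expr2; apply: cvgM; apply: cvg_norm; apply: cvgD.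
- by rewrite expr2; apply: cvgM; apply: cvg_norm.
- by rewrite expr2; apply: cvgM; apply: cvg_norm.
Qed.

Lemma cvg_constant (f : nat -> R) (a b : R) :
  f n @[n --> \oo] --> a -> (forall n, f n = b) -> a = b.
Proof.
move=> fa fb; rewrite -(cvg_lim (@Rhausdorff R) fa).
have -> : f = fun=> b by exact/funext.
exact: lim_cst.
Qed.

Lemma cauchy_modulus_cvg {X : completeNormedModType R} (u : nat -> X) (d : nat -> R) :
  d @ \oo --> (0 : R) -> (forall n m, (n <= m)%N -> `|u n - u m| <= d n) ->
  cvg (u @ \oo).
Proof.
move=> d0 ud; apply/cauchy_cvgP; apply: cauchy_exP => e e0.
have /cvgr_dist_lt/(_ e e0)[n _ dn] := d0.
exists (u n); exists n => // m /= nm; rewrite -ball_normE /=.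
apply: le_lt_trans (ud _ _ nm) _.
by have := dn n (leqnn n); rewrite /= sub0r normrN => /(le_lt_trans (ler_norm _)).
Qed.

End Limits.

Section Coercivity.
Context {R : realType} {X : hilbertType R}.
Implicit Types (A N : blin X X) (x y z : X).

(** On the range of [N] the gap gives [t |u|^2 <= (N u, u)], through
    Cauchy-Schwarz for the form of [N].  Every [x] orthogonal to the kernel is a
    limit of elements of the range: it is the limit of [N (N - eps)^-1 x] as
    [eps] tends to [0] in the resolvent set, and these elements form a Cauchy
    family since [N] is bounded below on its range. *)
Lemma gap_coercive N (e : X) (lam t : R) : self_adjoint N ->
  N e = lam *: e -> lam <= 0 ->
  (forall x, inner x e = 0 -> 0 <= inner (N x) x) ->
  0 < t -> (forall l, 0 < l < t -> ~ spectrum N l) ->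
  forall x, inner x e = 0 ->
  (forall k, N k = 0 -> inner k e = 0 -> inner x k = 0) ->
  t * `|x| ^+ 2 <= inner (N x) x.
Proof.
move=> sN Ne lam0 N0 t0 gap x xe xk.
have Nperp v : inner v e = 0 -> inner (N v) e = 0.
  by move=> ve; rewrite sN Ne innerE ve mulr0.
have range v : inner v e = 0 -> t * `|N v| ^+ 2 <= inner (N (N v)) (N v).
  move=> ve; have := spectral_gap_form sN (ltW t0) gap v.
  rewrite scale0r subr0 !innerE inner_norm subr_ge0 => gv.
  have [Nv0|Nv0] := eqVneq (N v) 0.
    by rewrite Nv0 normr0 expr0n/= mulr0 inner0r.
  have Np : 0 < `|N v| ^+ 2 by rewrite exprn_gt0// normr_gt0.
  rewrite -(ler_pM2r Np) -mulrA -expr2.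
  have cs := form_cauchy_schwarz sN N0 ve (Nperp _ ve).
  rewrite inner_norm in cs; rewrite (le_trans (ler_wpM2l (ltW t0) cs))//.
  by rewrite mulrA [leRHS]mulrC ler_wpM2r ?N0 ?Nperp.
have rangel v : inner v e = 0 -> t * `|N v| <= `|N (N v)|.
  move=> ve; have [Nv0|Nv0] := eqVneq (N v) 0.
    by rewrite Nv0 normr0 mulr0.
  have Np : 0 < `|N v| by rewrite normr_gt0.
  rewrite -(ler_pM2r Np) -mulrA -expr2 (le_trans (range _ ve))//.
  by rewrite (le_trans (ler_norm _)) ?cauchy_schwarz.
pose eps n : R := t / 2 * n.+1%:R^-1.
have t2 : 0 < t / 2 by rewrite divr_gt0.
have eps0 n : 0 < eps n by rewrite mulr_gt0 ?invr_gt0.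
have epst n : eps n <= t / 2.
  by rewrite ler_piMr ?(ltW t2)// invf_le1 ?ltr0n// ler1n.
have resolvent n : {w | N w - eps n *: w = x /\ inner w e = 0}.
  apply: cid.
  have /gap/contrapT[Q [_ QN]] : 0 < eps n < t.
    by rewrite eps0 (le_lt_trans (epst n))// ltr_pdivrMr// ltr_pMr// ltr1n.
  exists (Q x); split=> //.
  have := xe; rewrite -{1}(QN x) !innerE sN Ne innerE -mulrBl => /eqP.
  rewrite mulf_eq0 => /orP[|/eqP//]; rewrite subr_eq0 => /eqP le.
  by have := eps0 n; rewrite -le ltNge lam0.
pose w n := projT1 (resolvent n); pose z n := N (w n).
have wx n : N (w n) - eps n *: w n = x by have [] := projT2 (resolvent n).
have we n : inner (w n) e = 0 by have [] := projT2 (resolvent n).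
have Nz n : N (z n) = N x + eps n *: z n.
  by rewrite -{1}(wx n) linearB linearZ/= subrK.
pose C := 2 * `|N x| / t.
have zC n : `|z n| <= C.
  have := rangel _ (we n); rewrite -/(z n) Nz => /le_trans/(_ (ler_normD _ _)).
  rewrite normrZ gtr0_norm// => h.
  have := ler_wpM2r (normr_ge0 (z n)) (epst n).
  rewrite /C ler_pdivlMr// => h'; lra.
have epsle n m : (n <= m)%N -> eps m <= eps n.
  by move=> nm; rewrite ler_wpM2l ?(ltW t2)// lef_pV2 ?posrE ?ltr0n// ler_nat ltnS.
have /cvg_ex[/= l zl] : cvg (z @ \oo).
  apply: (@cauchy_modulus_cvg _ _ _ (fun n => 2 * C / t * eps n)).
    rewrite -[X in _ --> X](mulr0 (2 * C / t)); apply: cvgMl_tmp.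
    rewrite -[X in _ --> X](mulr0 (t / 2)); apply: cvgMl_tmp.
    exact: cvg_harmonic.
  move=> n m nm; rewrite mulrAC ler_pdivlMr//.
  have := @rangel (w n - w m).
  rewrite linearB/= innerBl !we subrr => /(_ erefl).
  rewrite linearB/= -/(z n) -/(z m) !Nz opprD addrACA subrr add0r => h.
  rewrite mulrC (le_trans h)// (le_trans (ler_normB _ _))// !normrZ !gtr0_norm//.
  have h1 := ler_wpM2l (ltW (eps0 n)) (zC n).
  have C0 : 0 <= C by exact: le_trans (zC 0%N).
  have h2 : eps m * `|z m| <= eps n * C.
    by rewrite ler_pM ?(ltW (eps0 _)) ?epsle.
  by apply: le_trans (lerD h1 h2) _; rewrite le_eqVlt; apply/orP; left; apply/eqP; ring.
have Nl : N l = N x.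
  have h1 : N (z n) @[n --> \oo] --> N l.
    by apply: continuous_cvg => //; exact: (blinP N).2.
  suff h2 : N (z n) @[n --> \oo] --> N x.
    exact: (cvg_unique (@norm_hausdorff _ _) h1 h2).
  have -> : (fun n => N (z n)) = (fun n => N x + eps n *: z n) by exact/funext.
  suff : N x + eps n *: z n @[n --> \oo] --> N x + 0 *: l by rewrite scale0r addr0.
  apply: cvgD; first exact: cvg_cst.
  apply: cvgZ => //.
  rewrite -[X in _ --> X](mulr0 (t / 2)); apply: cvgMl_tmp.
  exact: cvg_harmonic.
have lperp k : (forall n, inner (z n) k = 0) -> inner l k = 0.
  move=> zk.
  have h1 : (inner (z n) k : R) @[n --> \oo] --> (inner l k : R).
    by apply: cvg_inner => //; exact: cvg_cst.
  exact: cvg_constant h1 zk.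
have le : inner l e = 0 by apply: lperp => n; exact: Nperp.
have lx : x = l.
  apply/subr0_eq/inner_eq0.
  have Nk : N (x - l) = 0 by rewrite linearB/= Nl subrr.
  rewrite {1}innerBl (xk _ Nk) ?sub0r; last by rewrite innerBl xe le subrr.
  rewrite lperp ?oppr0// => n.
  by rewrite sN Nk inner0r.
rewrite lx -subr_ge0.
have : (inner (N (z n)) (z n) - t * inner (z n) (z n) : R) @[n --> \oo] -->
       (inner (N l) l - t * inner l l : R).
  apply: cvgB; last by apply: cvgMl_tmp; exact: cvg_inner.
  apply: cvg_inner => //.
  by apply: continuous_cvg => //; exact: (blinP N).2.
rewrite inner_norm; apply: (closed_cvg (fun u : R => 0 <= u)).
  exact: closed_ge.
by near=> n; rewrite subr_ge0 inner_norm; exact: range.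
Unshelve. all: by end_near. Qed.

(** If the quadratic form of [A] is nonnegative off a single
    negative direction and [z] is negative for it, the component of [v] along
    that direction is controlled by [(A v, z)], so that the form becomes
    coercive once this one functional is added. *)
Lemma coercive_modulo_negative A (mu delta : R) (chi x0 z : X) :
  self_adjoint A -> mu != 0 -> 0 < delta ->
  A chi = - mu ^+ 2 *: chi -> `|chi| = 1 ->
  A x0 = 0 -> inner x0 chi = 0 ->
  (forall p, inner p chi = 0 -> inner p x0 = 0 ->
    delta * `|p| ^+ 2 <= inner (A p) p) ->
  inner (A z) z < 0 ->
  exists kappa K : R, [/\ 0 < kappa, 0 < K &
    forall v, inner v x0 = 0 ->
      kappa * `|v| ^+ 2 <= inner (A v) v + K * inner (A v) z ^+ 2].
Proof.
move=> sA mu0 delta0 Achi chi1 Ax0 x0chi coer zneg.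
have m2 : 0 < mu ^+ 2 by rewrite exprn_even_gt0.
set M := mu ^+ 2 in Achi m2 *.
have AL u k w : A (u + k *: w) = A u + k *: A w by rewrite linearD linearZ.
have chichi : inner chi chi = 1 :> R by rewrite inner_norm chi1 expr1n.
have chix0 : inner chi x0 = 0 :> R by rewrite innerC.
have decomp v w (a b : R) p q : v = a *: chi + p -> w = b *: chi + q ->
    inner p chi = 0 -> inner q chi = 0 ->
    inner (A v) w = - M * a * b + inner (A p) q.
  move=> -> -> pc qc; rewrite linearD linearZ/= Achi !innerE chichi.
  rewrite (sA p chi) Achi !innerE pc (innerC chi q) qc; ring.
pose b := inner z chi; pose e := inner z x0 / inner x0 x0.
pose q := z - b *: chi - e *: x0.
have qchi : inner q chi = 0.
  by rewrite /q !innerE chichi x0chi /b; ring.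
have qx0 : inner q x0 = 0.
  have [->|x0n] := eqVneq x0 0; first by rewrite inner0r.
  have x0x0 : inner x0 x0 != 0 :> R.
    by apply: contra_neq x0n; exact: inner_eq0.
  by rewrite /q !innerE chix0 /e mulr0 subr0 mulfVK// subrr.
have zdec : z = b *: chi + (q + e *: x0).
  by rewrite /q subrK addrC subrK.
clearbody q.
have Ax0r p : inner (A p) x0 = 0 by rewrite sA Ax0 inner0r.
have nonneg p : inner p chi = 0 -> 0 <= inner (A p) p.
  move=> pchi; pose f := inner p x0 / inner x0 x0; pose r := p - f *: x0.
  have rx0 : inner r x0 = 0.
    have [->|x0n] := eqVneq x0 0; first by rewrite inner0r.
    have x0x0 : inner x0 x0 != 0 :> R.
      by apply: contra_neq x0n; exact: inner_eq0.
    by rewrite /r innerBl innerZl /f mulfVK// subrr.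
  have rchi : inner r chi = 0 by rewrite /r innerBl innerZl x0chi pchi mulr0 subr0.
  have -> : inner (A p) p = inner (A r) r.
    rewrite -(subrK (f *: x0) p) -/r AL Ax0 scaler0 addr0.
    by rewrite innerDr innerZr Ax0r mulr0 addr0.
  by apply: le_trans (coer _ rchi rx0); rewrite mulr_ge0 ?(ltW delta0)// exprn_ge0.
pose Q := inner (A q) q; pose m := M * b ^+ 2; pose g := m - Q.
have Q0 : 0 <= Q by exact: nonneg.
have g0 : 0 < g.
  move: zneg; have -> : inner (A z) z = - M * b * b + inner (A (q + e *: x0)) (q + e *: x0).
    by apply: decomp => //; rewrite innerDl innerZl qchi x0chi mulr0 addr0.
  rewrite AL Ax0 scaler0 addr0 innerDr innerZr Ax0r mulr0 addr0.
  by rewrite /g /m -/Q; nra.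
have m0 : 0 < m by rewrite /g in g0; lra.
pose s := g / (2 * m); pose C := (1 + 2 * m / g) / m.
have s0 : 0 < s by rewrite divr_gt0// mulr_gt0.
have C0 : 0 < C by rewrite divr_gt0// addr_gt0// divr_gt0// mulr_gt0.
exists (s / 2 * Num.min delta M), (2 * C); split.
- have mn0 : 0 < Num.min delta M by rewrite lt_min delta0.
  by rewrite mulr_gt0// divr_gt0.
- by rewrite mulr_gt0.
move=> v vx0; pose a := inner v chi; pose p := v - a *: chi.
have pchi : inner p chi = 0 by rewrite /p innerBl innerZl chichi mulr1 subrr.
have px0 : inner p x0 = 0 by rewrite /p innerBl innerZl chix0 vx0 mulr0 subr0.
have vdec : v = a *: chi + p by rewrite /p addrC subrK.
clearbody p; pose P := inner (A p) p; pose S := inner (A p) q.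
have -> : inner (A v) v = - M * a * a + P by exact: decomp.
have -> : inner (A v) z = - M * a * b + S.
  have -> : S = inner (A p) (q + e *: x0) by rewrite innerDr innerZr Ax0r mulr0 addr0.
  by apply: decomp => //; rewrite innerDl innerZl qchi x0chi mulr0 addr0.
have v2 : `|v| ^+ 2 = a ^+ 2 + `|p| ^+ 2.
  rewrite -!inner_norm vdec !(innerDl, innerDr, innerZl, innerZr) chichi pchi.
  by rewrite (innerC chi) pchi; ring.
have Pp := coer _ pchi px0; rewrite -/P in Pp.
have P0 : 0 <= P by exact: nonneg.
have SPQ : S ^+ 2 <= P * Q by exact: (form_cauchy_schwarz sA nonneg).
have mn1 : Num.min delta M <= delta by rewrite ge_min lexx.
have mn2 : Num.min delta M <= M by rewrite ge_min lexx orbT.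
set mn := Num.min delta M in mn1 mn2 *; rewrite v2.
set B := - M * a * b + S.
have key : M * a ^+ 2 <= (1 - s) * P + C * B ^+ 2.
  have sV : s^-1 = 2 * m / g by rewrite /s invf_div.
  rewrite -(ler_pM2r m0).
  have -> : M * a ^+ 2 * m = (S - B) ^+ 2 by rewrite /B /m; ring.
  have -> : ((1 - s) * P + C * B ^+ 2) * m = (1 - s) * m * P + (1 + s^-1) * B ^+ 2.
    rewrite sV /C; field; rewrite !gt_eqF//.
  have young : (S - B) ^+ 2 <= (1 + s) * S ^+ 2 + (1 + s^-1) * B ^+ 2.
    rewrite -subr_ge0.
    have -> : (1 + s) * S ^+ 2 + (1 + s^-1) * B ^+ 2 - (S - B) ^+ 2
        = s * (S + B / s) ^+ 2 by field; rewrite gt_eqF.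
    by rewrite mulr_ge0 ?sqr_ge0// ltW.
  apply: le_trans young _; rewrite lerD2r.
  apply: (@le_trans _ _ ((1 + s) * (P * Q))); first by rewrite ler_wpM2l// addr_ge0// ltW.
  rewrite mulrCA (mulrC _ P) ler_wpM2l//.
  have sm : s * m = g / 2 by rewrite /s; field; rewrite gt_eqF.
  have -> : Q = m - g by rewrite /g; ring.
  by have := mulr_gt0 s0 g0; lra.
have h1 := ler_wpM2r (sqr_ge0 a) mn2; have h2 := ler_wpM2r (sqr_ge0 `|p|) mn1.
have h3 : mn * (a ^+ 2 + `|p| ^+ 2) <= M * a ^+ 2 + P by rewrite mulrDr; lra.
have h4 := ler_wpM2l (ltW s0) h3.
have s1 : s <= 2^-1.
  have m20 : 0 < 2 * m by lra.
  by rewrite /s ler_pdivrMr /g; lra.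
have CB : 0 <= C * B ^+ 2 by rewrite mulr_ge0 ?sqr_ge0// ltW.
have h5 := ler_wpM2r CB s1; have h6 := ler_wpM2l (ltW s0) key.
have h7 : s * (s * P) >= 0 by exact: mulr_ge0 (ltW s0) (mulr_ge0 (ltW s0) P0).
by lra.
Qed.

(** The gap lemma is used twice: for [A + mu^2], whose gap above [0] shows that
    the form of [A] is nonnegative off [chi], and for [A] itself, whose gap between
    [0] and [delta] gives coercivity off [chi] and [x0]. *)
Lemma index_one_coercive A (mu delta : R) (chi x0 z : X) (Sigma : set R) :
  self_adjoint A -> spectrum A = [set - mu ^+ 2] `|` [set 0] `|` Sigma ->
  - mu ^+ 2 < 0 -> simple_eigenvalue A (- mu ^+ 2) chi -> `|chi| = 1 ->
  simple_eigenvalue A 0 x0 ->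
  0 < delta -> (forall l, Sigma l -> delta <= l) ->
  inner (A z) z < 0 ->
  exists kappa K : R, [/\ 0 < kappa, 0 < K &
    forall v, inner v x0 = 0 ->
      kappa * `|v| ^+ 2 <= inner (A v) v + K * inner (A v) z ^+ 2].
Proof.
move=> sA specA m0 [_ Achi chis] chi1 [_ Ax0 x0s] d0 Sd zneg.
have Ax00 : A x0 = 0 by rewrite Ax0 scale0r.
have M0 : 0 < mu ^+ 2 by rewrite -oppr_lt0.
have x0chi : inner x0 chi = 0.
  have := sA x0 chi; rewrite Ax00 inner0l Achi innerZr => /esym/eqP.
  by rewrite mulf_eq0 oppr_eq0 gt_eqF//= => /eqP.
have free l : l < delta -> l != - mu ^+ 2 -> l != 0 -> ~ spectrum A l.
  move=> ld lm l0; rewrite specA => -[[/= lE|/= lE]|/Sd].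
  - by rewrite lE eqxx in lm.
  - by rewrite lE eqxx in l0.
  - by rewrite leNgt ld.
have mu0 : mu != 0 by apply: contraTneq M0 => ->; rewrite expr0n/= ltxx.
have bottom x : - mu ^+ 2 * `|x| ^+ 2 <= inner (A x) x.
  apply: (spectrum_form_lower_bound sA) => l lm; apply: free.
  - by rewrite (lt_trans lm)// (lt_trans m0).
  - by rewrite lt_eqF.
  - by rewrite lt_eqF// (lt_trans lm).
have nonneg x : inner x chi = 0 -> 0 <= inner (A x) x.
  move=> xchi; pose N := shift_op A (- mu ^+ 2).
  have NE y : N y = A y + mu ^+ 2 *: y by rewrite /N shift_opE scaleNr opprK.
  have : mu ^+ 2 * `|x| ^+ 2 <= inner (N x) x.
    apply: (@gap_coercive N 0 0) => //.
    - exact: shift_self_adjoint.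
    - by rewrite linear0 scaler0.
    - move=> y _; rewrite NE innerDl innerZl inner_norm.
      by have := bottom y; rewrite mulNr -subr_ge0 opprK.
    - move=> l /andP[l0 lm]; rewrite /N spectrum_shift; apply: free; first by lra.
        by rewrite -subr_eq0 opprK subrK gt_eqF.
      by rewrite subr_eq0 lt_eqF.
    - by rewrite inner0r.
    - move=> k; rewrite NE => /eqP; rewrite addr_eq0 -scaleNr => /eqP/chis[a ->] _.
      by rewrite innerZr xchi mulr0.
  by rewrite NE innerDl innerZl inner_norm lerDr.
apply: (coercive_modulo_negative sA mu0 d0 Achi chi1 Ax00 x0chi _ zneg).
move=> p pchi px0; apply: (@gap_coercive A chi (- mu ^+ 2)) => //.
- exact: ltW.
- move=> l /andP[l0 ld]; apply: free => //; last by rewrite gt_eqF.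
  by rewrite gt_eqF// (lt_trans m0).
- move=> k Ak _; have /x0s[a ->] : A k = 0 *: k by rewrite Ak scale0r.
  by rewrite innerZr px0 mulr0.
Qed.

End Coercivity.

(** * Derivatives and smooth functions *)

Section EpsilonDelta.
Context {R : realType}.

Lemma continuous_epsP {V W : normedModType R} (f : V -> W) (x : V) :
  {for x, continuous f} <->
  forall e : R, 0 < e -> exists2 d : R, 0 < d & forall y, `|y - x| < d -> `|f y - f x| < e.
Proof.
split=> [fx e e0|fx].
  have /cvgr_distC_lt/(_ _ e0)/nbhs_normP[d /= d0 dP] := fx.
  by exists d => // y yx; apply: dP; rewrite /= distrC.
apply/cvgrPdist_lt => e e0; have [d d0 dP] := fx e e0.
by apply/nbhs_normP; exists d => //= y yx; rewrite distrC dP// distrC.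
Qed.

Lemma is_derive_epsP {V : normedModType R} (f : R -> V) (t : R) (l : V) :
  is_derive t 1 f l <->
  forall e : R, 0 < e -> exists2 d : R, 0 < d & forall h : R, 0 < `|h| < d ->
    `|f (t + h) - f t - h *: l| <= e * `|h|.
Proof.
have quotient (h : R) : h != 0 ->
    `|l - h^-1 *: (f (h *: 1 + t) - f t)| * `|h| = `|f (t + h) - f t - h *: l|.
  move=> h0; rewrite mulrC -normrZ scalerBr scalerA divff// scale1r distrC.
  by rewrite [_%:A]mulr1 (addrC h).
split=> [[dft dfl] e e0|fl].
  have : h^-1 *: (f (h *: 1 + t) - f t) @[h --> 0^'] --> l by rewrite -dfl; exact: dft.
  move/cvgr_dist_le => /(_ _ e0); rewrite near_withinE => /nbhs_normP[d /= d0 dP].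
  exists d => // h /andP[h0 hd].
  have hn0 : h != 0 by rewrite -normr_gt0.
  by rewrite -quotient// ler_wpM2r// dP//= sub0r normrN.
have cv : h^-1 *: (f (h *: 1 + t) - f t) @[h --> 0^'] --> l.
  apply/cvgrPdist_le => e e0; rewrite near_withinE; have [d d0 dP] := fl e e0.
  apply/nbhs_normP; exists d => // h /=; rewrite sub0r normrN => hd h0.
  have hp : 0 < `|h| by rewrite normr_gt0.
  by rewrite -(ler_pM2r hp) quotient// dP// hp.
apply: DeriveDef; last exact: (cvg_lim (@norm_hausdorff _ _) cv).
by apply/cvg_ex; exists l.
Qed.

Lemma is_derive_continuous {V : normedModType R} (f : R -> V) (t : R) (l : V) :
  is_derive t 1 f l -> {for t, continuous f}.
Proof.
by move=> [dft _]; apply/differentiable_continuous/derivable1_diffP.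
Qed.

Lemma is_derive_local {V : normedModType R} (f g : R -> V) (t d : R) (l : V) : 0 < d ->
  (forall x, `|x - t| < d -> f x = g x) -> is_derive t 1 f l -> is_derive t 1 g l.
Proof.
move=> d0 fg; apply: near_eq_is_derive; apply/nbhs_normP; exists d => //= x xt.
by apply: fg; rewrite distrC.
Qed.

Lemma is_derive_affine (a b t : R) : is_derive t 1 (fun x => a * x + b) a.
Proof.
apply/is_derive_epsP => e e0; exists 1 => // h _.
have -> : a * (t + h) + b - (a * t + b) - h *: a = 0 by rewrite -[h *: a]/(h * a); ring.
by rewrite normr0 mulr_ge0// ltW.
Qed.

Lemma is_derive_mulr (a t : R) : is_derive t 1 (fun x => x * a) a.
Proof.
by have := is_derive_affine a 0 t; under eq_fun do rewrite addr0 mulrC.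
Qed.

Lemma is_derive_constant (f : R -> R) (a b : R) :
  (forall x, a < x < b -> is_derive x 1 f 0) ->
  forall x y, a < x < b -> a < y < b -> f x = f y.
Proof.
move=> df; have wlog x y : a < x < b -> a < y < b -> x < y -> f x = f y.
  move=> /andP[ax xb] /andP[ay yb] xy.
  have d z : z \in `]x, y[ -> is_derive z 1 f ((fun=> 0) z).
    by move=> /itvP z1; apply: df; rewrite (lt_trans ax) ?z1// (lt_trans _ yb) ?z1.
  have c : {within `[x, y], continuous f}.
    apply: continuous_in_subspaceT => z; rewrite inE/= in_itv/= => /andP[z1 z2].
    apply: (@is_derive_continuous _ _ _ 0); apply: df.
    by rewrite (lt_le_trans ax z1) (le_lt_trans z2 yb).
  have [z _ /eqP] := MVT_segment (ltW xy) d c.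
  by rewrite mul0r subr_eq0 eq_sym => /eqP.
move=> x y ax ay; have [xy|yx|-> //] := ltgtP x y; first exact: wlog.
exact/esym/wlog.
Qed.

Lemma within_continuous_epsP (S : set R) {W : normedModType R} (u : R -> W) :
  {within S, continuous u} <-> forall t, S t -> forall e : R, 0 < e ->
    exists2 d : R, 0 < d & forall s, S s -> `|s - t| < d -> `|u s - u t| < e.
Proof.
rewrite subspace_continuousP; split=> cu t St.
  move=> e e0; have /cvgrPdist_lt/(_ _ e0)/nbhs_normP[d d0 dP] := cu t St.
  by exists d => // s Ss st; have := dP s; rewrite /= distrC (distrC (u t)); exact.
apply/cvgrPdist_lt => e /(cu t St)[d d0 dP].
apply/nbhs_normP; exists d => // s /= st Ss.
by rewrite distrC; apply: dP; rewrite // distrC.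
Qed.

Lemma half_open_continuous {W : normedModType R} (u : R -> W) (t1 t : R) :
  (forall t, 0 <= t < t1 -> forall e : R, 0 < e ->
    exists2 d : R, 0 < d & forall s, 0 <= s < t1 -> `|s - t| < d -> `|u s - u t| < e) ->
  0 < t < t1 -> {for t, continuous u}.
Proof.
move=> cu /andP[t0 tt]; apply/continuous_epsP => e e0.
have t01 : 0 <= t < t1 by rewrite (ltW t0).
have [d d0 dP] := cu t t01 e e0.
exists (Num.min d (Num.min t (t1 - t))); first by rewrite !lt_min d0 t0 subr_gt0.
move=> s; rewrite !lt_min => /andP[sd /andP[st1 st2]]; apply: dP => //.
by move: st1 st2; rewrite !ltr_norml => /andP[s1 s2] /andP[s3 s4]; apply/andP; split; lra.
Qed.

(** The mean value theorem on either side of [s]; solutions are glued with this. *)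
Lemma is_derive_removable (f g : R -> R) (s r : R) : 0 < r ->
  (forall t, 0 < `|t - s| < r -> is_derive t 1 f (g t)) ->
  {for s, continuous f} -> {for s, continuous g} -> is_derive s 1 f (g s).
Proof.
move=> r0 df cf cg; apply/is_derive_epsP => e e0.
have /continuous_epsP/(_ _ e0)[d d0 dP] := cg.
exists (Num.min d r); first by rewrite lt_min d0.
move=> h; rewrite lt_min => /andP[h0 /andP[hd hr]].
have dft t : 0 < `|t - s| -> `|t - s| <= `|h| -> is_derive t 1 f (g t).
  by move=> ts th; apply: df; rewrite ts (le_lt_trans th).
have cft t : `|t - s| <= `|h| -> {for t, continuous f}.
  move=> th; have [->//|/eqP ts] := eqVneq t s.
  by apply: is_derive_continuous (dft t _ th); rewrite normr_gt0 subr_eq0; exact/eqP.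
have bound (x : R) : `|x - s| <= `|h| -> `|h * (g x - g s)| <= e * `|h|.
  by move=> xs; rewrite normrM mulrC ler_wpM2r// ltW// dP// (le_lt_trans xs).
have [hp|hn] : 0 < h \/ h < 0 by apply/orP; rewrite -neq_lt eq_sym -normr_gt0.
  rewrite (gtr0_norm hp) in dft cft bound *.
  have d1 t : t \in `]s, s + h[ -> is_derive t 1 f (g t).
    rewrite in_itv/= => /andP[t1 t2]; apply: dft; first by rewrite normr_gt0 subr_eq0 gt_eqF.
    by rewrite ger0_norm; lra.
  have c1 : {within `[s, s + h], continuous f}.
    apply: continuous_in_subspaceT => t; rewrite inE/= in_itv/= => /andP[t1 t2].
    by apply: cft; rewrite ger0_norm; lra.
  have [|t] := MVT_segment _ d1 c1; first by lra.
  rewrite in_itv/= => /andP[t1 t2] ->.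
  rewrite [X in `|X|](_ : _ = h * (g t - g s)); last first.
    by rewrite -[h *: g s]/(h * g s); ring.
  by apply: bound; rewrite ger0_norm; lra.
rewrite (ltr0_norm hn) in dft cft bound *.
have d1 t : t \in `]s + h, s[ -> is_derive t 1 f (g t).
  rewrite in_itv/= => /andP[t1 t2]; apply: dft; first by rewrite normr_gt0 subr_eq0 lt_eqF.
  by rewrite ltr0_norm; lra.
have c1 : {within `[s + h, s], continuous f}.
  apply: continuous_in_subspaceT => t; rewrite inE/= in_itv/= => /andP[t1 t2].
  by apply: cft; rewrite ler0_norm; lra.
have [|t] := MVT_segment _ d1 c1; first by lra.
rewrite in_itv/= => /andP[t1 t2] ft.
rewrite [X in `|X|](_ : _ = h * (g t - g s)); last first.
  by rewrite -[h *: g s]/(h * g s) -[f (s + h) - f s]opprB ft; ring.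
by apply: bound; rewrite ler0_norm; lra.
Qed.

Lemma is_derive_opp_arg {F : normedModType R} (f : R -> F) (t : R) (l : F) :
  is_derive (- t) 1 f l -> is_derive t 1 (fun s => f (- s)) (- l).
Proof.
move=> /is_derive_epsP df; apply/is_derive_epsP => e /df[d d0 dP].
exists d => // h hd; have := dP (- h); rewrite normrN => /(_ hd).
by rewrite opprD scalerN scaleNr.
Qed.

Lemma is_derive_shift0 {F : normedModType R} (f : R -> F) (s : R) (l : F) :
  is_derive (0 : R) 1 (fun r => f (s + r)) l -> is_derive s 1 f l.
Proof.
move=> /is_derive_epsP df; apply/is_derive_epsP => e /df[d d0 dP].
by exists d => // h hd; have := dP h hd; rewrite add0r addr0.
Qed.

End EpsilonDelta.

Section SmoothFunctions.
Context {R : realType}.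
Implicit Types (f g : R -> R) (n k : nat).

Fixpoint ntimes_derivable n f : Prop :=
  if n is n'.+1 then (forall t : R, derivable f t 1) /\ ntimes_derivable n' (derive1 f)
  else True.

Lemma ntimes_derivableP f :
  (forall n, ntimes_derivable n f) -> forall n t, derivable (derive1n n f) t 1.
Proof.
move=> df n; elim: n f df => [|n IH] f df t; first by have [] := df 1%N.
rewrite derive1nS /derive1n -iterS iterSr; apply: IH => m.
by have [] := df m.+1.
Qed.

Lemma ntimes_derivable_pred n f : ntimes_derivable n.+1 f -> ntimes_derivable n f.
Proof. by elim: n f => //= n IH f [df /IH]. Qed.

Lemma derive1_ext f g : (forall t : R, is_derive t 1 f (g t)) -> derive1 f = g.
Proof. by move=> fg; apply/funext => t; rewrite derive1E; have [] := fg t. Qed.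

Lemma ntimes_derivable_is_derive n f g : (forall t : R, is_derive t 1 f (g t)) ->
  ntimes_derivable n g -> ntimes_derivable n.+1 f.
Proof.
by move=> fg ng; split; [move=> t; have [] := fg t|rewrite (derive1_ext fg)].
Qed.

Lemma ntimes_derivableS n f : ntimes_derivable n.+1 f ->
  exists2 g, forall t : R, is_derive t 1 f (g t) & ntimes_derivable n g.
Proof.
by move=> [df nf]; exists (derive1 f) => // t; rewrite derive1E; exact: derivableP.
Qed.

Lemma ntimes_derivable_cst n (a : R) : ntimes_derivable n (fun=> a).
Proof.
elim: n a => // n IH a; apply: (@ntimes_derivable_is_derive _ _ (fun=> 0)) => //.
Qed.

Lemma ntimes_derivableD n f g : ntimes_derivable n f -> ntimes_derivable n g ->
  ntimes_derivable n (fun x => f x + g x).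
Proof.
elim: n f g => // n IH f g /ntimes_derivableS[f' ff' nf'] /ntimes_derivableS[g' gg' ng'].
exact: (ntimes_derivable_is_derive _ (IH _ _ nf' ng')).
Qed.

Lemma ntimes_derivableM n f g : ntimes_derivable n f -> ntimes_derivable n g ->
  ntimes_derivable n (fun x => f x * g x).
Proof.
elim: n f g => // n IH f g nf ng.
have [f' ff' nf'] := ntimes_derivableS nf; have [g' gg' ng'] := ntimes_derivableS ng.
have nfg : ntimes_derivable n (fun x => f x * g' x + g x * f' x).
  by apply: ntimes_derivableD; apply: IH => //; exact: ntimes_derivable_pred.
exact: (ntimes_derivable_is_derive _ nfg).
Qed.

Lemma ntimes_derivableV n f : (forall x, f x != 0) -> ntimes_derivable n f ->
  ntimes_derivable n (fun x => (f x)^-1).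
Proof.
move=> f0; elim: n => // n IH nf; have [f' ff' nf'] := ntimes_derivableS nf.
have nV : ntimes_derivable n (fun x => (fun=> -1) x * ((f x)^-1 * (f x)^-1) * f' x).
  apply: ntimes_derivableM => //; apply: ntimes_derivableM.
    exact: ntimes_derivable_cst.
  by apply: ntimes_derivableM; apply/IH/ntimes_derivable_pred.
apply: (ntimes_derivable_is_derive _ nV) => t.
have [dft <-] := ff' t; apply: DeriveDef; first exact: derivableV.
by rewrite deriveV//= mulN1r -invfM -expr2.
Qed.

Lemma ntimes_derivable_affine n f (a b : R) : ntimes_derivable n f ->
  ntimes_derivable n (fun x => f (a * x + b)).
Proof.
elim: n f => // n IH f /ntimes_derivableS[f' ff' nf'].
have na : ntimes_derivable n (fun x => f' (a * x + b) * (fun=> a) x).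
  by apply: ntimes_derivableM; [exact: IH|exact: ntimes_derivable_cst].
apply: (ntimes_derivable_is_derive _ na) => t; have aff := is_derive_affine a b t.
have gf := ff' (a * t + b).
exact: (@is_derive1_comp _ f (fun x => a * x + b) t (f' (a * t + b)) a).
Qed.

(** The flat function [exp (-1/x)], together with its products by the powers of
    [1/x]: this family is stable under derivation. *)
Definition flat k (x : R) : R := if 0 < x then x^-1 ^+ k * expR (- x^-1) else 0.

Lemma flat_ge0 k x : 0 <= flat k x.
Proof.
by rewrite /flat; case: ifPn => // x0; rewrite mulr_ge0 ?expR_ge0// exprn_ge0// invr_ge0 ltW.
Qed.

Lemma flat_gt0 k x : 0 < x -> 0 < flat k x.
Proof. by move=> x0; rewrite /flat x0 mulr_gt0 ?expR_gt0// exprn_gt0// invr_gt0. Qed.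

Lemma flat_eq0 k x : x <= 0 -> flat k x = 0.
Proof. by rewrite /flat ltNge => ->. Qed.

(** From [x^-(k+2) / (k+2)! <= exp (1/x)]; this is what makes [flat] differentiable
    at the origin. *)
Lemma flat_le_sqr k x : flat k x <= (k.+2)`!%:R * x ^+ 2.
Proof.
have [x0|x0] := ltP 0 x; last by rewrite flat_eq0// mulr_ge0 ?sqr_ge0.
rewrite /flat x0 expRN ler_pdivrMr ?expR_gt0//.
have xV0 : 0 <= x^-1 by rewrite invr_ge0 ltW.
have := expR_ge1Dxn k.+1 xV0; set E := expR _ => hE.
have {}hE : x^-1 ^+ k.+2 / (k.+2)`!%:R <= E by lra.
have f0 : 0 < (k.+2)`!%:R :> R by rewrite ltr0n fact_gt0.
rewrite ler_pdivrMr// in hE.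
have -> : x^-1 ^+ k = x ^+ 2 * x^-1 ^+ k.+2.
  by rewrite -(addn2 k) exprD mulrCA -exprMn divff ?gt_eqF// expr1n mulr1.
by rewrite -[leRHS]mulrA [leRHS]mulrCA ler_wpM2l ?sqr_ge0// mulrC.
Qed.

Lemma is_derive_flat k (t : R) :
  is_derive t 1 (flat k) (flat k.+2 t - k%:R * flat k.+1 t).
Proof.
have [t0|t0|->] := ltgtP t 0.
- rewrite !flat_eq0 ?ltW// mulr0 subr0.
  apply: (@is_derive_local _ _ (cst 0) _ _ (- t)) => [|x]; first by rewrite oppr_gt0.
  by rewrite ltr_norml => /andP[_ xt]; rewrite flat_eq0//; lra.
- pose g : R -> R := fun x => x^-1.
  have dg : is_derive t 1 g (- t ^- 2).
    have := @is_deriveV _ id t 1 1 (lt0r_neq0 t0) _.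
    by rewrite [_%:A]mulr1; apply; exact: is_derive_id.
  have dE : is_derive t 1 (expR \o (- g)) (expR (- g t) * - (- t ^- 2)).
    apply: is_derive1_comp; exact: is_deriveN.
  have := @is_deriveM _ _ (g ^+ k) (expR \o (- g)) t 1 _ _ _ dE.
  move/(_ _ (@is_deriveX _ _ g k t 1 _ dg)) => dF.
  apply: (@is_derive_local _ _ ((g ^+ k) * (expR \o (- g))) _ _ t) => // [x|].
    rewrite ltr_norml => /andP[xt _]; rewrite /flat ifT; last by lra.
    by rewrite /g !fctE/=.
  apply: is_derive_eq dF _.
  rewrite /flat t0 /g !fctE/= /GRing.scale/=.
  have -> : t ^- 2 = t^-1 ^+ 2 by rewrite exprVn.
  by case: k => [|k] /=; rewrite !exprS; ring.
- rewrite !flat_eq0// mulr0 subr0; apply/is_derive_epsP => e e0.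
  have f0 : 0 < (k.+2)`!%:R :> R by rewrite ltr0n fact_gt0.
  exists (e / (k.+2)`!%:R); first exact: divr_gt0.
  move=> h /andP[h0 hd]; rewrite add0r (flat_eq0 k (lexx 0)) subr0 scaler0 subr0.
  rewrite ger0_norm ?flat_ge0// (le_trans (flat_le_sqr _ _))//.
  rewrite -(real_normK (num_real h)) expr2 mulrA ler_wpM2r//.
  by rewrite mulrC -ler_pdivlMr// ltW.
Qed.

Lemma ntimes_derivable_flat n k : ntimes_derivable n (flat k).
Proof.
elim: n k => // n IH k.
have nd : ntimes_derivable n (fun t => flat k.+2 t + (fun=> - k%:R) t * flat k.+1 t).
  apply: ntimes_derivableD; first exact: IH.
  by apply: ntimes_derivableM; [exact: ntimes_derivable_cst|exact: IH].
apply: (ntimes_derivable_is_derive _ nd) => t.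
by rewrite mulNr; exact: is_derive_flat.
Qed.

(** A smooth monotone transition from [0] on the negative axis to [1] beyond [1]. *)
Definition smooth_step (x : R) : R := flat 0 x / (flat 0 x + flat 0 (1 - x)).

Let denominator_gt0 x : 0 < flat 0 x + flat 0 (1 - x).
Proof.
have [x0|x0] := ltP 0 x; first by rewrite ltr_wpDr ?flat_ge0// flat_gt0.
by rewrite ltr_wpDl ?flat_ge0// flat_gt0//; lra.
Qed.

Lemma smooth_step_eq0 x : x <= 0 -> smooth_step x = 0.
Proof. by move=> x0; rewrite /smooth_step flat_eq0// mul0r. Qed.

Lemma smooth_step_eq1 x : 1 <= x -> smooth_step x = 1.
Proof.
move=> x1; rewrite /smooth_step (flat_eq0 _ (x := 1 - x)); last by lra.
by rewrite addr0 divff// gt_eqF// flat_gt0// (lt_le_trans _ x1).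
Qed.

Lemma ntimes_derivable_smooth_step n : ntimes_derivable n smooth_step.
Proof.
have fl1 : ntimes_derivable n (fun x => flat 0 (1 - x)).
  have := ntimes_derivable_affine (-1) 1 (ntimes_derivable_flat n 0).
  by congr ntimes_derivable; apply/funext => x; rewrite mulN1r addrC.
apply: ntimes_derivableM; first exact: ntimes_derivable_flat.
apply: ntimes_derivableV; first by move=> x; rewrite gt_eqF.
by apply: ntimes_derivableD => //; exact: ntimes_derivable_flat.
Qed.

Lemma flat_homo (x y : R) : x <= y -> flat 0 x <= flat 0 y.
Proof.
move=> xy; have [x0|x0] := ltP 0 x; last by rewrite flat_eq0// flat_ge0.
have y0 := lt_le_trans x0 xy.
by rewrite /flat x0 y0 !expr0 !mul1r ler_expR lerN2 lef_pV2.
Qed.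

Lemma smooth_step_homo (x y : R) : x <= y -> smooth_step x <= smooth_step y.
Proof.
move=> xy; rewrite /smooth_step ler_pdivrMr// mulrAC ler_pdivlMr//.
have h1 := flat_homo xy; have h2 : flat 0 (1 - y) <= flat 0 (1 - x) by apply: flat_homo; lra.
rewrite !mulrDr (mulrC (flat 0 y) (flat 0 x)) lerD2l.
by rewrite ler_pM ?flat_ge0.
Qed.

Lemma homo_derive_ge0 (f : R -> R) (t l : R) : {homo f : x y / x <= y} ->
  is_derive t 1 f l -> 0 <= l.
Proof.
move=> fh /is_derive_epsP fl; rewrite leNgt; apply/negP => l0.
have [|d d0 dP] := fl (- l / 2); first by lra.
have := dP (d / 2); rewrite gtr0_norm; last by lra.
have -> : 0 < d / 2 < d by lra.
move=> /(_ isT); rewrite -[d / 2 *: l]/(d / 2 * l) => h.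
have := fh t (t + d / 2); rewrite lerDl => /(_ ltac:(lra)) h1.
have := le_trans (ler_norm _) h; have : 0 < d / 2 by lra.
nra.
Qed.

Lemma smooth_step_derive (t : R) : is_derive t 1 smooth_step (derive1 smooth_step t).
Proof.
by have [d _] := ntimes_derivable_smooth_step 1; rewrite derive1E; exact: derivableP.
Qed.

Lemma smooth_step_derive_ge0 (t : R) : 0 <= derive1 smooth_step t.
Proof. exact: homo_derive_ge0 smooth_step_homo (smooth_step_derive t). Qed.

End SmoothFunctions.

(** * Weak derivatives and classical derivatives *)

Section WeakDerivative.
Context {R : realType}.
Local Notation mu := (@lebesgue_measure R).
Implicit Types (f g F : R -> R) (a b p q : R).

Lemma continuous_integrable f a b : continuous f ->
  mu.-integrable `[a, b] (EFin \o f).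
Proof.
move=> cf; apply: continuous_compact_integrable; first exact: segment_compact.
exact: continuous_subspaceT.
Qed.

Lemma Rintegral_is_derive f F a b : a < b -> continuous f ->
  (forall x, a <= x <= b -> is_derive x 1 F (f x)) ->
  (\int[mu]_(x in `[a, b]) f x)%R = F b - F a.
Proof.
move=> ab cf dF; rewrite /Rintegral (@continuous_FTC2 _ f F)//.
- exact: continuous_subspaceT.
- have cF x : a <= x <= b -> F y @[y --> x] --> F x.
    by move=> /dF; exact: is_derive_continuous.
  split.
  + by move=> x; rewrite in_itv/= => /andP[ax xb]; have [] := dF x _; rewrite ?ltW.
  + by apply: cvg_at_right_filter; apply: cF; rewrite lexx ltW.
  + by apply: cvg_at_left_filter; apply: cF; rewrite lexx ltW.
- move=> x; rewrite in_itv/= => /andP[ax xb].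
  by rewrite derive1E; have [] := dF x _; rewrite ?ltW.
Qed.

Lemma Rintegral_supported (S : set R) f a b : `[a, b] `<=` S ->
  (forall x, ~ (a <= x <= b) -> f x = 0) ->
  (\int[mu]_(x in S) f x)%R = (\int[mu]_(x in `[a, b]) f x)%R.
Proof.
move=> abS f0; rewrite Rintegral_mkcond [RHS]Rintegral_mkcond; congr Rintegral.
apply/funext => x; rewrite !patchE.
have [xab|xab] := boolP (x \in `[a, b]%classic).
  by rewrite ifT//; apply/mem_set/abS; rewrite inE in xab.
case: ifPn => // _; apply: f0; apply/negP; move: xab; apply: contra => xab.
by rewrite inE/= in_itv/=.
Qed.

Section Transition.
Variables (e : R) (e0 : 0 < e).

(** A smooth step across [[p, p + e]], whose slope is an approximate Dirac mass
    at [p]. *)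
Definition transition p (x : R) : R := smooth_step (e^-1 * x + - (e^-1 * p)).
Definition transition_slope p (x : R) : R :=
  e^-1 * derive1 smooth_step (e^-1 * x + - (e^-1 * p)).

Lemma transition_derive p (x : R) : is_derive x 1 (transition p) (transition_slope p x).
Proof.
have aff := is_derive_affine e^-1 (- (e^-1 * p)) x.
rewrite /transition_slope mulrC; have ds := @smooth_step_derive R (e^-1 * x + - (e^-1 * p)).
exact: (@is_derive1_comp _ smooth_step (fun x => e^-1 * x + - (e^-1 * p)) x _ e^-1).
Qed.

Lemma transition_slope_continuous p : continuous (transition_slope p).
Proof.
move=> x; have nd : ntimes_derivable 1 (transition_slope p).
  apply: ntimes_derivableM; first exact: ntimes_derivable_cst.
  apply: ntimes_derivable_affine.
  by have [_] := @ntimes_derivable_smooth_step R 2.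
have [/(_ x) /derivableP d _] := nd; exact: is_derive_continuous d.
Qed.

Lemma transition_slope_ge0 p x : 0 <= transition_slope p x.
Proof. by rewrite mulr_ge0 ?smooth_step_derive_ge0// invr_ge0 ltW. Qed.

Lemma transition_arg p x : e^-1 * x + - (e^-1 * p) = (x - p) / e.
Proof. by rewrite -mulrBr mulrC. Qed.

Lemma transition_left p x : x <= p -> transition p x = 0.
Proof.
move=> xp; rewrite /transition transition_arg smooth_step_eq0//.
by rewrite ler_pdivrMr// mul0r subr_le0.
Qed.

Lemma transition_right p x : p + e <= x -> transition p x = 1.
Proof.
move=> xp; rewrite /transition transition_arg smooth_step_eq1//.
by rewrite ler_pdivlMr// mul1r lerBrDl.
Qed.

Lemma transition_slope_eq0 p x : ~ (p <= x <= p + e) -> transition_slope p x = 0.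
Proof.
move=> /negP; rewrite negb_and -!ltNge => out.
have [_ d0] : is_derive x 1 (transition p) 0; last first.
  by have [_ <-] := transition_derive p x.
have [xp|xp] := orP out.
  apply: (@is_derive_local _ _ (cst 0) _ _ (p - x)) => [|y yx]; first by rewrite subr_gt0.
  rewrite transition_left//; have := le_lt_trans (ler_norm _) yx; lra.
apply: (@is_derive_local _ R^o (cst (1 : R^o)) _ _ (x - (p + e))) => [|y yx].
  by rewrite subr_gt0.
rewrite transition_right//; rewrite distrC in yx.
have := le_lt_trans (ler_norm _) yx; lra.
Qed.

Lemma transition_mean F a b p (k : R) : continuous F -> a < p -> p + e < b ->
  (forall x, p <= x <= p + e -> `|F x - F p| <= k) ->
  `|(\int[mu]_(x in `[a, b]) (F x * transition_slope p x))%R - F p| <= k.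
Proof.
move=> cF ap pb Fk; have ab : a < b by have := e0; lra.
have cs := @transition_slope_continuous p.
have k0 : 0 <= k by apply: le_trans (Fk p _) => //; rewrite lexx lerDl ltW.
have mass : (\int[mu]_(x in `[a, b]) transition_slope p x)%R = 1.
  have -> := Rintegral_is_derive ab cs (fun x _ => transition_derive p x).
  by rewrite (transition_left (ltW ap)) (transition_right (ltW pb)) subr0.
have cFs : continuous (fun x => F x * transition_slope p x).
  by move=> x; apply: cvgM; [exact: cF|exact: cs].
have -> : F p = (\int[mu]_(x in `[a, b]) (F p * transition_slope p x))%R.
  rewrite RintegralZl// ?mass ?mulr1//; exact: continuous_integrable.
rewrite -RintegralB//; last 2 first.
- exact: continuous_integrable.
- by apply: continuous_integrable => x; apply: cvgM; [exact: cvg_cst|exact: cs].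
rewrite (le_trans (le_normr_Rintegral _ _))//.
  by apply: continuous_integrable => x; apply: cvgB; [exact: cFs|
    apply: cvgM; [exact: cvg_cst|exact: cs]].
rewrite -[leRHS]mulr1 -mass -RintegralZl//; last exact: continuous_integrable.
apply: le_Rintegral => //.
- apply: continuous_integrable => x; apply: cvg_norm; apply: cvgB; first exact: cFs.
  by apply: cvgM; [exact: cvg_cst|exact: cs].
- by apply: continuous_integrable => x; apply: cvgM; [exact: cvg_cst|exact: cs].
move=> x _; rewrite -mulrBl normrM (ger0_norm (transition_slope_ge0 _ _)).
have [/Fk h|/negP/transition_slope_eq0 ->] := boolP (p <= x <= p + e).
  by rewrite ler_wpM2r// transition_slope_ge0.
by rewrite !mulr0.
Qed.

End Transition.

(** Functions continuous on a segment are composed with [clamp], since integrals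
    and primitives are handled for functions continuous on the whole line. *)
Definition clamp a b (x : R) : R := Num.max a (Num.min b x).

Lemma clamp_itv a b x : a <= b -> a <= clamp a b x <= b.
Proof. by move=> ab; rewrite /clamp le_max lexx/= ge_max ab ge_min lexx. Qed.

Lemma clamp_id a b x : a <= x <= b -> clamp a b x = x.
Proof. by move=> /andP[ax xb]; rewrite /clamp (min_idPr xb) (max_idPr ax). Qed.

Lemma clamp_lipschitz a b x y : `|clamp a b x - clamp a b y| <= `|x - y|.
Proof.
have maxL (u v w : R) : `|Num.max u v - Num.max u w| <= `|v - w|.
  rewrite ler_norml; have := ler_norm (v - w); have := ler_norm (w - v).
  by rewrite distrC; case: (leP u v) => uv; case: (leP u w) => uw ? ?; apply/andP; split; lra.
have minL (u v w : R) : `|Num.min u v - Num.min u w| <= `|v - w|.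
  rewrite ler_norml; have := ler_norm (v - w); have := ler_norm (w - v).
  by rewrite distrC; case: (leP u v) => uv; case: (leP u w) => uw ? ?; apply/andP; split; lra.
exact: le_trans (maxL _ _ _) (minL _ _ _).
Qed.

Lemma clamp_continuous a b : continuous (clamp a b).
Proof.
move=> x; apply/(continuous_epsP (clamp a b : R^o -> R^o)) => e e0; exists e => // y.
exact: le_lt_trans (clamp_lipschitz _ _ _ _).
Qed.

Lemma continuous_clamp {T : topologicalType} (f : R -> T) a b : a <= b ->
  (forall x, a <= x <= b -> {for x, continuous f}) -> continuous (f \o clamp a b).
Proof.
move=> ab cf x; apply: continuous_comp; first exact: clamp_continuous.
by apply: cf; exact: clamp_itv.
Qed.

(** The test functions are differences of two transitions, at [p] and at [q]:
    their slopes tend to the Dirac masses at [p] and [q], so that a function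
    with zero weak derivative takes equal values at [p] and [q].  This is applied
    to [f] minus a primitive of [g]. *)
Lemma du_bois_reymond (S : set R) f g : open S ->
  (forall x, S x -> {for x, continuous f}) ->
  (forall x, S x -> {for x, continuous g}) ->
  distributional_derivative S f g ->
  forall t, S t -> is_derive t 1 f (g t).
Proof.
move=> oS cf cg weak t St.
have [r r0 tS] : exists2 r, 0 < r & `[t - r, t + r] `<=` S.
  have /nbhs_normP[d /= d0 dS] : nbhs (t : R^o) S by exact: open_nbhs_nbhs.
  exists (d / 2); first by rewrite divr_gt0.
  move=> x /=; rewrite in_itv/= => /andP[x1 x2]; apply: dS => /=.
  by rewrite ltr_norml; lra.
set a := t - r in tS; set b := t + r in tS.
have ab : a < b by rewrite /a /b; lra.
have S_of x : a <= x <= b -> S x by move=> xab; apply: tS; rewrite /= in_itv.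
pose f1 := f \o clamp a b; pose g1 := g \o clamp a b.
have cf1 : continuous f1 by apply: continuous_clamp (ltW ab) _ => x /S_of; exact: cf.
have cg1 : continuous g1 by apply: continuous_clamp (ltW ab) _ => x /S_of; exact: cg.
pose G x : R := (\int[mu]_(s in `[(a - 1), x]) g1 s)%R.
have dG (x : R) : a <= x -> is_derive x 1 G (g1 x).
  move=> ax; have x1 : x < x + 1 by rewrite ltrDl.
  have a1 : a - 1 < x by lra.
  have [d dE] := continuous_FTC1_closed x1 (continuous_integrable (a - 1) (x + 1) cg1) a1 (cg1 x).
  by apply: DeriveDef; [exact: d|rewrite -derive1E; exact: dE].
clearbody G; pose F x := f1 x - G x.
pose F1 := F \o clamp a b.
have cF x : a <= x <= b -> {for x, continuous F}.
  move=> /andP[ax _]; apply: cvgB; first exact: cf1.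
  exact: is_derive_continuous (dG _ ax).
have cF1 : continuous F1 by exact: continuous_clamp (ltW ab) cF.
have F1E x : a <= x <= b -> F1 x = f x - G x.
  by move=> xab; rewrite /F1/= clamp_id// /F /f1/= clamp_id.
have Fconst p q : a < p -> p < q -> q < b -> F1 p = F1 q.
  move=> ap pq qb; apply/eqP; rewrite -subr_eq0 -normr_le0; apply/ler_addgt0Pl => k k0.
  rewrite addr0.
  have k2 : 0 < k / 2 by rewrite divr_gt0.
  have /continuous_epsP/(_ _ k2)[d1 d10 Fp] := cF1 p.
  have /continuous_epsP/(_ _ k2)[d2 d20 Fq] := cF1 q.
  pose e := Num.min (Num.min (d1 / 2) (d2 / 2)) (Num.min ((q - p) / 2) ((b - q) / 2)).
  have e0 : 0 < e by rewrite !lt_min; apply/andP; split; apply/andP; split; lra.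
  have [/andP[e1 e2] /andP[e3 e4]] :
      (e <= d1 / 2) && (e <= d2 / 2) /\ (e <= (q - p) / 2) && (e <= (b - q) / 2).
    by rewrite /e !ge_min !lexx !orbT.
  clearbody e.
  have near p' d : 0 < d -> e <= d / 2 -> (forall y, `|y - p'| < d -> `|F1 y - F1 p'| < k / 2) ->
      forall x, p' <= x <= p' + e -> `|F1 x - F1 p'| <= k / 2.
    move=> d0 ed Fd x /andP[x1 x2]; apply/ltW/Fd.
    by rewrite ger0_norm ?subr_ge0//; lra.
  have hp := transition_mean e0 cF1 ap _ (near p d1 d10 e1 Fp).
  have hq := transition_mean e0 cF1 _ _ (near q d2 d20 e2 Fq).
  have {}hp : `|(\int[mu]_(x in `[a, b]) (F1 x * transition_slope e p x))%R - F1 p| <= k / 2.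
    by apply: hp; lra.
  have {}hq : `|(\int[mu]_(x in `[a, b]) (F1 x * transition_slope e q x))%R - F1 q| <= k / 2.
    by apply: hq; lra.
  pose phi x := transition e p x - transition e q x.
  pose slope x := transition_slope e p x - transition_slope e q x.
  have dphi (x : R) : is_derive x 1 phi (slope x).
    by apply: is_deriveB; exact: transition_derive.
  have phiE : derive1 phi = slope by exact: derive1_ext.
  have slope0 x : ~ (a <= x <= b) -> slope x = 0.
    move=> xab; rewrite /slope !transition_slope_eq0 ?subrr// => /andP[x1 x2];
      apply: xab; lra.
  have phi0 x : ~ (p <= x <= q + e) -> phi x = 0.
    move=> /negP; rewrite negb_and -!ltNge /phi => /orP[xp|qx].
      by rewrite !transition_left//; lra.
    by rewrite !transition_right//; lra.
  have test : test_function S phi.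
    split.
      apply: ntimes_derivableP => n.
      have sm p' : ntimes_derivable n (transition e p').
        apply: ntimes_derivable_affine; exact: ntimes_derivable_smooth_step.
      have := ntimes_derivableD (sm p) (ntimes_derivableM (ntimes_derivable_cst n (-1)) (sm q)).
      by congr ntimes_derivable; apply/funext => x; rewrite mulN1r.
    exists `[p, q + e]%classic; split.
    - exact: segment_compact.
    - by move=> x /=; rewrite in_itv/= => xpq; apply: S_of; lra.
    - by move=> x /=; rewrite in_itv/= => xpq; exact: phi0.
  have := weak phi test; rewrite phiE.
  have cs p' : continuous (transition_slope e p') by exact: transition_slope_continuous.
  have cslope : continuous slope by move=> x; apply: cvgB; exact: cs.
  have cphi : continuous phi by move=> x; exact: is_derive_continuous (dphi x).
  rewrite (@Rintegral_supported S _ a b)//; last first.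
    by move=> x xab; rewrite slope0 ?mulr0.
  rewrite (@Rintegral_supported S _ a b)//; last first.
    move=> x xab; rewrite phi0 ?mulr0// => /andP[x1 x2]; apply: xab; lra.
  pose G1 := G \o clamp a b.
  have cG1 : continuous G1.
    apply: continuous_clamp (ltW ab) _ => x /andP[ax _].
    exact: is_derive_continuous (dG _ ax).
  have F1G1 x : F1 x = f1 x - G1 x.
    by rewrite /F1 /F /G1 /f1 /= (clamp_id (clamp_itv x (ltW ab))).
  have parts : (\int[mu]_(x in `[a, b]) (g1 x * phi x + G1 x * slope x))%R = 0.
    have ch : continuous (fun x => g1 x * phi x + G1 x * slope x).
      by move=> x; apply: cvgD; apply: cvgM; [exact: cg1|exact: cphi|exact: cG1|exact: cslope].
    have dh (x : R) : a <= x <= b ->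
        is_derive x 1 (fun x => G x * phi x) (g1 x * phi x + G1 x * slope x).
      move=> /andP[ax xb]; have := is_deriveM (dG x ax) (dphi x).
      by rewrite /G1/= clamp_id ?ax// addrC [phi x *: _]mulrC.
    by rewrite (Rintegral_is_derive ab ch dh) !phi0 ?mulr0 ?subrr// => /andP[x1 x2]; lra.
  have int1 : mu.-integrable `[a, b] (EFin \o (fun x => g1 x * phi x)).
    by apply: continuous_integrable => x; apply: cvgM; [exact: cg1|exact: cphi].
  have int2 : mu.-integrable `[a, b] (EFin \o (fun x => G1 x * slope x)).
    by apply: continuous_integrable => x; apply: cvgM; [exact: cG1|exact: cslope].
  have int3 : mu.-integrable `[a, b] (EFin \o (fun x => f1 x * slope x)).
    by apply: continuous_integrable => x; apply: cvgM; [exact: cf1|exact: cslope].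
  have int4 p' : mu.-integrable `[a, b] (EFin \o (fun x => F1 x * transition_slope e p' x)).
    by apply: continuous_integrable => x; apply: cvgM; [exact: cF1|exact: cs].
  rewrite RintegralD// in parts.
  rewrite (@eq_Rintegral _ _ _ mu _ (fun x => f1 x * slope x)); last first.
    by move=> x; rewrite inE/= in_itv/= => xab; rewrite /f1/= clamp_id.
  rewrite [X in _ = - X](@eq_Rintegral _ _ _ mu _ (fun x => g1 x * phi x)); last first.
    by move=> x; rewrite inE/= in_itv/= => xab; rewrite /g1/= clamp_id.
  move=> wk.
  have zero : (\int[mu]_(x in `[a, b]) (F1 x * transition_slope e p x))%R =
              (\int[mu]_(x in `[a, b]) (F1 x * transition_slope e q x))%R.
    apply/eqP; rewrite -subr_eq0 -RintegralB//.
    rewrite (@eq_Rintegral _ _ _ mu _ (fun x => f1 x * slope x - G1 x * slope x)); last first.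
      by move=> x _; rewrite -[RHS]mulrBl -F1G1 [RHS]mulrBr.
    by rewrite RintegralB// wk -opprD parts oppr0.
  rewrite zero in hp; move: hp hq; set u := Rintegral _ _ _; clear.
  by rewrite !ler_norml => /andP[? ?] /andP[? ?]; apply/andP; split; lra.
have Fconst' x : a < x < b -> F1 x = F1 t.
  move=> /andP[ax xb]; have [xt|tx|-> //] := ltgtP x t.
    by apply: Fconst => //; rewrite /b; lra.
  by apply/esym/Fconst => //; rewrite /a; lra.
have tab : a <= t <= b by rewrite /a /b; lra.
have : is_derive t 1 (fun x => F1 t + G x) (0 + g1 t).
  apply: is_deriveD.
  by apply: dG; have /andP[] := tab.
rewrite add0r /g1/= clamp_id//; apply: is_derive_local r0 _ => x.
rewrite ltr_norml => /andP[x1 x2].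
have xab : a < x < b by rewrite /a /b; lra.
rewrite -(Fconst' _ xab) F1E; last by lra.
by rewrite subrK.
Qed.

End WeakDerivative.

Section IntegrationByParts.
Context {R : realType}.
Local Notation mu := (@lebesgue_measure R).
Implicit Types (f g F : R -> R) (a b p q : R).

(** Integration by parts on a segment containing the support of the test function
    in its interior, so that the boundary terms vanish. *)
Lemma is_derive_weak_derivative f g (A B : R) : A < B ->
  (forall t : R, A < t < B -> is_derive t 1 f (g t)) ->
  (forall t, A < t < B -> {for t, continuous g}) ->
  distributional_derivative `]A, B[ f g.
Proof.
move=> AB df cg phi [sphi [K [cK KAB phiK]]].
have [m [M [Am mM MB KmM]]] : exists m M, [/\ A < m, m <= M, M < B &
    forall x, K x -> m <= x <= M].
  have [K0|K0] := pselect (K !=set0); last first.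
    by exists ((A + B) / 2), ((A + B) / 2); split; [lra|lra|lra|
      move=> x Kx; case: K0; exists x].
  have cid : {within K, continuous (id : R -> R)} by apply: continuous_subspaceT => x; exact: cvg_id.
  have [m /set_mem Km mP] := compact_EVT_min K0 cK cid.
  have [M /set_mem KM MP] := compact_EVT_max K0 cK cid.
  have := KAB _ Km; have := KAB _ KM; rewrite /= !in_itv/= => /andP[_ MB] /andP[Am _].
  exists m, M; split=> // [|x /mem_set Kx]; first exact: (mP M (mem_set KM)).
  by rewrite (mP x Kx) (MP x Kx).
pose a := (A + m) / 2; pose b := (M + B) / 2.
have Aa : A < a by rewrite /a; lra.
have am : a < m by rewrite /a; lra.
have Mb : M < b by rewrite /b; lra.
have bB : b < B by rewrite /b; lra.
clearbody a b; have ab : a < b by lra.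
have dphi (x : R) : is_derive x 1 phi (derive1 phi x).
  by rewrite derive1E; apply: derivableP; exact: (sphi 0%N).
have cphi : continuous phi by move=> x; exact: is_derive_continuous (dphi x).
have cdphi : continuous (derive1 phi).
  by move=> x; have /derivableP d := sphi 1%N x; exact: is_derive_continuous d.
have phi0 x : ~ (m <= x <= M) -> phi x = 0.
  by move=> xmM; apply: phiK => /KmM.
have dphi0 x : ~ (a <= x <= b) -> derive1 phi x = 0.
  move=> /negP; rewrite negb_and -!ltNge => out.
  have [_ d0] : is_derive x 1 phi 0; last by rewrite derive1E.
  have [xa|bx] := orP out.
    apply: (@is_derive_local _ R^o (cst (0 : R^o)) _ _ (m - x)) => [|y yx].
      by rewrite subr_gt0; lra.
    by rewrite phi0// => /andP[my _]; have := le_lt_trans (ler_norm _) yx; lra.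
  apply: (@is_derive_local _ R^o (cst (0 : R^o)) _ _ (x - M)) => [|y yx].
    by rewrite subr_gt0; lra.
  rewrite distrC in yx.
  by rewrite phi0// => /andP[_ yM]; have := le_lt_trans (ler_norm _) yx; lra.
have abAB : `[a, b] `<=` `]A, B[.
  by move=> x /=; rewrite !in_itv/= => /andP[ax xb]; lra.
pose f1 := f \o clamp a b; pose g1 := g \o clamp a b.
have cf1 : continuous f1.
  apply: continuous_clamp (ltW ab) _ => x /andP[ax xb].
  by apply: is_derive_continuous; apply: df; lra.
have cg1 : continuous g1.
  by apply: continuous_clamp (ltW ab) _ => x /andP[ax xb]; apply: cg; lra.
rewrite (@Rintegral_supported _ _ _ a b)//; last by move=> x xab; rewrite dphi0 ?mulr0.
rewrite [X in _ = - X](@Rintegral_supported _ _ _ a b)//; last first.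
  by move=> x xab; rewrite phi0 ?mulr0// => /andP[x1 x2]; apply: xab; lra.
rewrite (@eq_Rintegral _ _ _ mu _ (fun x => f1 x * derive1 phi x)); last first.
  by move=> x; rewrite inE/= in_itv/= => xab; rewrite /f1/= clamp_id.
rewrite [X in _ = - X](@eq_Rintegral _ _ _ mu _ (fun x => g1 x * phi x)); last first.
  by move=> x; rewrite inE/= in_itv/= => xab; rewrite /g1/= clamp_id.
have cfp : continuous (fun x => f1 x * derive1 phi x).
  by move=> x; apply: cvgM; [exact: cf1|exact: cdphi].
have cgp : continuous (fun x => g1 x * phi x).
  by move=> x; apply: cvgM; [exact: cg1|exact: cphi].
apply/eqP; rewrite -addr_eq0; apply/eqP.
rewrite -RintegralD//; [|exact: continuous_integrable..].
have csum : continuous (fun x => f1 x * derive1 phi x + g1 x * phi x).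
  by move=> x; apply: cvgD; [exact: cfp|exact: cgp].
have dprod (x : R) : a <= x <= b ->
    is_derive x 1 (fun x => f x * phi x) (f1 x * derive1 phi x + g1 x * phi x).
  move=> xab; have xAB : A < x < B by lra.
  have := is_deriveM (df _ xAB) (dphi x).
  by rewrite /f1 /g1/= clamp_id// [phi x *: _]mulrC.
by rewrite (Rintegral_is_derive ab csum dprod) !phi0 ?mulr0 ?subrr// => /andP[x1 x2]; lra.
Qed.

End IntegrationByParts.

(** * Taylor expansions *)

Section Frechet.
Context {R : realType}.

Lemma norm_le_dist {V : normedModType R} (a b : V) : `|a| <= `|a - b| + `|b|.
Proof. by rewrite -{1}(subrK b a) ler_normD. Qed.

Lemma frechetE {V W : normedModType R} (f : V -> W) (x h : V) :
  differentiable f x -> frechet f x h = 'd f x h.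
Proof. by rewrite /frechet; case: pselect. Qed.

Lemma is_derive_frechet_comp {V W : normedModType R} (f : V -> W) (g : R -> V)
    (t : R) (l : V) : is_derive t 1 g l -> differentiable f (g t) ->
  is_derive t 1 (f \o g) (frechet f (g t) l).
Proof.
move=> [dg gl] df; have dg' : differentiable g t by exact/derivable1_diffP.
have dfg : differentiable (f \o g) t by exact: differentiable_comp.
apply: DeriveDef; first exact/derivable1_diffP.
rewrite -derive1E derive1E'// diff_comp//= frechetE//; congr ('d f _ _).
by rewrite -gl -derive1E derive1E'.
Qed.

Lemma is_derive_affine_line {V : normedModType R} (u v : V) (t : R) :
  is_derive t 1 (fun s : R => u + s *: v) v.
Proof.
apply/is_derive_epsP => e e0; exists 1 => // h _.
rewrite scalerDl addrA [X in X - _]addrAC subrr add0r subrr.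
by rewrite normr0 mulr_ge0// ltW.
Qed.

Lemma is_derive_line {V W : normedModType R} (f : V -> W) (u v : V) (t : R) :
  differentiable f (u + t *: v) ->
  is_derive t 1 (fun s : R => f (u + s *: v)) (frechet f (u + t *: v) v).
Proof.
by move=> df; exact: (is_derive_frechet_comp (is_derive_affine_line u v t) df).
Qed.

Lemma is_derive_blin_eval {V W : normedModType R} (F : R -> blin V W) (t : R)
    (L : blin V W) (z : V) :
  is_derive t 1 F L -> is_derive t 1 (fun s => F s z) (L z).
Proof.
move=> /is_derive_epsP dF; apply/is_derive_epsP => e e0.
have z0 : 0 < `|z| + 1 by rewrite ltr_wpDl.
have [d d0 dP] := dF (e / (`|z| + 1)) (divr_gt0 e0 z0); exists d => // h hd.
apply: le_trans (blin_le (F (t + h) - F t - h *: L) z) _.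
apply: le_trans (ler_wpM2r (normr_ge0 z) (dP _ hd)) _.
rewrite [leLHS](_ : _ = e * `|h| * (`|z| / (`|z| + 1))); last by ring.
by rewrite ler_piMr ?mulr_ge0 ?(ltW e0)// ler_pdivrMr// mul1r lerDl.
Qed.

Lemma derivative_bound (f f' : R -> R) (s K : R) : 0 <= s ->
  (forall x, 0 <= x <= s -> is_derive x 1 f (f' x)) ->
  (forall x, 0 <= x <= s -> `|f' x| <= K) ->
  `|f s - f 0| <= K * s.
Proof.
move=> s0 df fK.
have d z : z \in `]0, s[ -> is_derive z 1 f (f' z).
  by rewrite in_itv/= => /andP[z0 zs]; apply: df; rewrite !ltW.
have c : {within `[0, s], continuous f}.
  apply: continuous_in_subspaceT => z; rewrite inE/= in_itv/= => zs.
  exact: is_derive_continuous (df _ zs).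
have [z] := MVT_segment s0 d c; rewrite in_itv/= subr0 => zs ->.
by rewrite normrM (ger0_norm s0) ler_wpM2r// fK.
Qed.

Lemma derivative_lower_bound (f f' : R -> R) (a b m : R) : a <= b ->
  (forall x, a <= x <= b -> is_derive x 1 f (f' x)) ->
  (forall x, a <= x <= b -> m <= f' x) -> m * (b - a) <= f b - f a.
Proof.
move=> ab df fm.
have d z : z \in `]a, b[ -> is_derive z 1 f (f' z).
  by rewrite in_itv/= => /andP[z0 zs]; apply: df; rewrite !ltW.
have ct : {within `[a, b], continuous f}.
  apply: continuous_in_subspaceT => z; rewrite inE/= in_itv/= => zs.
  exact: is_derive_continuous (df _ zs).
have [z] := MVT_segment ab d ct; rewrite in_itv/= => zs ->.
by rewrite ler_wpM2r ?subr_ge0// fm.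
Qed.

(** A quantitative intermediate value theorem, by comparison with lines of slope
    [q]. *)
Lemma steep_zero (f f' : R -> R) (q d : R) : 0 < q ->
  (forall x : R, `|x| < d -> is_derive x 1 f (f' x)) -> (forall x, `|x| < d -> q <= f' x) ->
  `|f 0| / q < d -> exists r, [/\ `|r| <= `|f 0| / q, f r = 0 &
    forall t, `|t| < d -> `|r - t| <= `|f t| / q].
Proof.
move=> q0 df qf; set m := `|f 0| / q => md.
have mono a b : `|a| < d -> a <= b -> `|b| < d -> q * (b - a) <= f b - f a.
  move=> ad ab bd; have inside x : a <= x <= b -> `|x| < d.
    by move: ad bd; rewrite !ltr_norml => /andP[? ?] /andP[? ?] /andP[? ?]; apply/andP; split; lra.
  by apply: (derivative_lower_bound ab (f' := f')) => x /inside; [exact: df|exact: qf].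
have m0 : 0 <= m by rewrite divr_ge0// ltW.
have qm : q * m = `|f 0| by rewrite mulrC divfK// gt_eqF.
have md' : `|m| < d by rewrite ger0_norm.
have Nmd : `|- m| < d by rewrite normrN.
have z0 : `|0 : R| < d by rewrite normr0 (le_lt_trans m0).
have fN : f (- m) <= 0.
  have := mono _ _ Nmd _ z0; rewrite oppr_le0 sub0r opprK qm => /(_ m0) h.
  have := ler_norm (f 0); lra.
have fp : 0 <= f m.
  have := mono _ _ z0 m0 md'; rewrite subr0 qm => h.
  have := ler_norm (- f 0); rewrite normrN; lra.
have cf : {within `[- m, m], continuous f}.
  apply: continuous_in_subspaceT => x; rewrite inE/= in_itv/= -ler_norml => xm.
  exact: is_derive_continuous (df x (le_lt_trans xm md)).
have Nmm : - m <= m by lra.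
have [|r rm fr] := IVT (v := 0) Nmm cf; first by rewrite ge_min fN le_max fp orbT.
have {}rm : `|r| <= m by rewrite ler_norml; move: rm; rewrite in_itv.
exists r; split => // t td; have rd := le_lt_trans rm md.
rewrite ler_pdivlMr// mulrC; have [tr|/ltW rt] := leP t r.
  have := mono _ _ td tr rd; rewrite fr sub0r (ger0_norm (x := r - t)) ?subr_ge0//.
  by move/le_trans; apply; rewrite -normrN ler_norm.
have := mono _ _ rd rt td; rewrite fr subr0 (ler0_norm (x := r - t)) ?subr_le0// opprB.
by move/le_trans; apply; exact: ler_norm.
Qed.

Lemma second_order_bound (f f' f'' : R -> R) (s K : R) : 0 <= s ->
  (forall x, 0 <= x <= s -> is_derive x 1 f (f' x)) ->
  (forall x, 0 <= x <= s -> is_derive x 1 f' (f'' x)) ->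
  (forall x, 0 <= x <= s -> `|f'' x| <= K) ->
  `|f s - f 0 - s * f' 0| <= K * s ^+ 2.
Proof.
move=> s0 df df' fK.
have K0 : 0 <= K by apply: le_trans (fK 0 _) => //; rewrite lexx.
pose g x := f x - x * f' 0.
have dg (x : R) : 0 <= x <= s -> is_derive x 1 g (f' x - f' 0).
  by move=> xs; apply: is_deriveB; [exact: df|exact: is_derive_mulr].
have := @derivative_bound g (fun x => f' x - f' 0) s (K * s) s0 dg.
rewrite /g mul0r subr0 expr2 mulrA => h.
have -> : f s - f 0 - s * f' 0 = f s - s * f' 0 - f 0 by ring.
apply: h => x /andP[x0 xs].
apply: (@le_trans _ _ (K * x)); last by rewrite ler_wpM2l.
apply: (derivative_bound x0) => y /andP[y0 yx]; [apply: df'|apply: fK];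
  by rewrite y0 (le_trans yx).
Qed.

(** Both remainders come from the boundedness of the third derivative near [u],
    integrated along the segment from [u] to [u + v]. *)
Lemma C3_taylor {V : normedModType R} (O : set V) (f : V -> R^o) (u : V) :
  open O -> Ck 3 O f -> O u ->
  exists r C : R, [/\ 0 < r, 0 < C, forall v, `|v| < r -> O (u + v),
    forall v z, `|v| < r ->
      `|frechet f (u + v) z - frechet f u z - frechet (frechet f) u v z|
        <= C * `|v| ^+ 2 * `|z| &
    forall v, `|v| < r ->
      `|f (u + v) - f u - frechet f u v - 2^-1 * frechet (frechet f) u v v|
        <= C * `|v| ^+ 3].
Proof.
move=> oO [d0 [d1 [d2 c3]]] Ou.
set D1 := frechet f in d1 d2 c3 *; set D2 := frechet D1 in d2 c3 *.
set D3 := frechet D2 in c3 *.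
have /continuous_epsP/(_ _ ltr01)[r1 r10 r1P] := c3 _ Ou.
have [r2 r20 r2P] : exists2 r, 0 < r & forall v, `|v| < r -> O (u + v).
  have /nbhs_normP[d /= d0' dO] : nbhs u O by exact: open_nbhs_nbhs.
  by exists d => // v vd; apply: dO; rewrite /= opprD addrA subrr sub0r normrN.
pose r := Num.min r1 r2; pose C := `|D3 u| + 1.
have C0 : 0 < C by rewrite ltr_wpDl.
have line v s : `|v| < r -> 0 <= s <= 1 -> `|s *: v| < r.
  move=> vr /andP[s0 s1]; rewrite normrZ (ger0_norm s0).
  by apply: le_lt_trans vr; rewrite ler_piMl.
have Or v : `|v| < r -> O (u + v).
  by rewrite lt_min => /andP[_]; exact: r2P.
have D3C v : `|v| < r -> `|D3 (u + v)| <= C.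
  rewrite lt_min => /andP[vr1 _].
  apply: le_trans (norm_le_dist (D3 (u + v)) (D3 u)) _.
  rewrite /C addrC lerD2l; apply/ltW/r1P.
  by rewrite (addrC u) addrK.
have D1bound v z s : `|v| < r -> 0 <= s <= 1 ->
    `|D1 (u + s *: v) z - D1 u z - s * D2 u v z| <= C * `|v| ^+ 2 * `|z| * s ^+ 2.
  move=> vr /andP[s0 s1].
  have := @second_order_bound (fun x => D1 (u + x *: v) z)
    (fun x => D2 (u + x *: v) v z) (fun x => D3 (u + x *: v) v v z) s
    (C * `|v| ^+ 2 * `|z|) s0.
  rewrite scale0r addr0; apply => x /andP[x0 xs].
  - have Ox : O (u + x *: v) by apply/Or/line => //; rewrite x0 (le_trans xs).
    by apply: is_derive_blin_eval; apply: is_derive_line; exact: d1.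
  - have Ox : O (u + x *: v) by apply/Or/line => //; rewrite x0 (le_trans xs).
    apply: (is_derive_blin_eval (F := fun x => D2 (u + x *: v) v)).
    apply: (is_derive_blin_eval (F := fun x => D2 (u + x *: v))).
    by apply: is_derive_line; exact: d2.
  have := blin_le (D3 (u + x *: v) v v) z; move=> /le_trans; apply.
  rewrite ler_wpM2r// (le_trans (blin_le _ _))// expr2 mulrA ler_wpM2r//.
  rewrite (le_trans (blin_le _ _))// ler_wpM2r// D3C// line// x0.
  exact: le_trans s1.
exists r, C; split => //; first by rewrite lt_min r10.
  move=> v z vr; have := D1bound v z 1 vr; rewrite ler01 lexx => /(_ isT).
  by rewrite !scale1r mul1r expr1n mulr1.
move=> v vr.
pose g x := f (u + x *: v) - x * D1 u v - x ^+ 2 * (2^-1 * D2 u v v).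
have := @derivative_bound g (fun x => D1 (u + x *: v) v - D1 u v - x * D2 u v v) 1
  (C * `|v| ^+ 3) ler01.
rewrite /g !scale1r scale0r !addr0 !mul1r mul0r expr0n/= mul0r !subr0 expr1n mul1r mulr1.
have -> : f (u + v) - D1 u v - 2^-1 * D2 u v v - f u =
  f (u + v) - f u - D1 u v - 2^-1 * D2 u v v by ring.
apply.
- move=> x /andP[x0 x1].
  have Ox : O (u + x *: v) by apply/Or/line => //; rewrite x0.
  apply: is_deriveB; first apply: is_deriveB.
  + by apply: is_derive_line; exact: d0.
  + exact: is_derive_mulr.
  + set q := D2 u v v; apply/is_derive_epsP => e e0.
    exists (e / (`|q| + 1)); first by rewrite divr_gt0// ltr_wpDl.
    move=> h /andP[h0 hd].
    have -> : (x + h) ^+ 2 * (2^-1 * q) - x ^+ 2 * (2^-1 * q) - h *: (x * q) = h * (h * (q / 2)).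
      by rewrite -[h *: _]/(h * (x * q)); field.
    rewrite normrM mulrC ler_wpM2r// normrM.
    have : `|q / 2| <= `|q| + 1.
      by rewrite normrM (@ger0_norm _ 2^-1)//; have := normr_ge0 q; lra.
    move/(ler_wpM2l (normr_ge0 h))/le_trans; apply.
    by rewrite -ler_pdivlMr ?ltr_wpDl// ltW.
- move=> x /andP[x0 x1]; have := D1bound v v x vr; rewrite x0 x1 => /(_ isT) h.
  apply: le_trans h _; rewrite -(mulrA C) -exprSr ler_piMr ?mulr_ge0 ?exprn_ge0 ?(ltW C0)//.
  by rewrite expr_le1.
Qed.

End Frechet.

(** * Density and bounded operators *)

Section Density.
Context {R : realType}.

Lemma dense_approx {V : normedModType R} (D O : set V) (u : V) (e : R) :
  dense D -> open O -> O u -> 0 < e -> exists v, [/\ D v, O v & `|v - u| < e].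
Proof.
move=> dD oO Ou e0.
pose N := [set v | `|u - v| < e] `&` O.
have N0 : N !=set0 by exists u; split => //=; rewrite subrr normr0.
have oN : open N.
  apply: openI => //; rewrite openE => v /= vu; apply/nbhs_normP.
  exists (e - `|u - v|); first by rewrite /= subr_gt0.
  move=> w /= wv; have := ler_normD (u - v) (v - w); rewrite addrA subrK; lra.
have [v [[/= vu Ov] Dv]] := dD N N0 oN.
by exists v; split => //; rewrite distrC.
Qed.

Lemma dense_continuous_eq {V W : normedModType R} (D O : set V) (f g : V -> W) :
  dense D -> open O ->
  (forall v, O v -> {for v, continuous f}) -> (forall v, O v -> {for v, continuous g}) ->
  (forall v, D v -> O v -> f v = g v) -> forall v, O v -> f v = g v.
Proof.
move=> dD oO cf cg fg v Ov; apply/eqP; rewrite -subr_eq0 -normr_le0.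
apply/ler_addgt0Pl => e e0; rewrite addr0.
have e2 : 0 < e / 2 by rewrite divr_gt0.
have /continuous_epsP/(_ _ e2)[d1 d10 fP] := cf _ Ov.
have /continuous_epsP/(_ _ e2)[d2 d20 gP] := cg _ Ov.
have d0 : 0 < Num.min d1 d2 by rewrite lt_min d10.
have [w [Dw Ow]] := dense_approx dD oO Ov d0; rewrite lt_min => /andP[w1 w2].
have := fP _ w1; have := gP _ w2; rewrite (fg w Dw Ow) => h2 h1.
have := ler_normD (f v - g w) (g w - g v); rewrite addrA subrK (distrC (f v) (g w)); lra.
Qed.

Lemma is_derive_unique {V : normedModType R} (f : R -> V) (t : R) (l m : V) :
  is_derive t 1 f l -> is_derive t 1 f m -> l = m.
Proof. by move=> [_ <-] [_ <-]. Qed.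

Lemma is_derive_shift_arg {V : normedModType R} (f : R -> V) (s t : R) (l : V) :
  is_derive (s + t) 1 f l -> is_derive t 1 (fun x => f (s + x)) l.
Proof.
move=> /is_derive_epsP df; apply/is_derive_epsP => e /df[d d0 dP].
by exists d => // h hd; rewrite addrA; exact: dP.
Qed.

Lemma blinD {V W : normedModType R} (A : blin V W) x y : A (x + y) = A x + A y.
Proof. exact: linearD. Qed.

Lemma blinB {V W : normedModType R} (A : blin V W) x y : A (x - y) = A x - A y.
Proof. exact: linearB. Qed.

Lemma blinZ {V W : normedModType R} (A : blin V W) (a : R) x : A (a *: x) = a *: A x.
Proof. exact: linearZ. Qed.

Lemma blin0 {V W : normedModType R} (A : blin V W) : A 0 = 0.
Proof. exact: linear0. Qed.

Lemma is_derive_blin {V W : normedModType R} (A : blin V W) (f : R -> V) (t : R) (l : V) :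
  is_derive t 1 f l -> is_derive t 1 (fun s => A (f s)) (A l).
Proof.
move=> /is_derive_epsP df; apply/is_derive_epsP => e e0.
have A0 : 0 < `|A| + 1 by rewrite ltr_wpDl.
have [d d0 dP] := df (e / (`|A| + 1)) (divr_gt0 e0 A0); exists d => // h hd.
have -> : A (f (t + h)) - A (f t) - h *: A l = A (f (t + h) - f t - h *: l).
  by rewrite !blinB blinZ.
apply: le_trans (blin_le A _) _; apply: le_trans (ler_wpM2l (normr_ge0 A) (dP _ hd)) _.
rewrite [leLHS](_ : _ = e * `|h| * (`|A| / (`|A| + 1))); last by ring.
by rewrite ler_piMr ?mulr_ge0 ?(ltW e0)// ler_pdivrMr// mul1r lerDl.
Qed.

Lemma blin_continuous {V W : normedModType R} (A : blin V W) : continuous A.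
Proof. exact: (blinP A).2. Qed.

Lemma cvg_blin_app {I : Type} {F : set_system I} {FF : Filter F} {V W : normedModType R}
    (A : I -> blin V W) (A0 : blin V W) (f : I -> V) (f0 : V) :
  A @ F --> A0 -> f @ F --> f0 -> A i (f i) @[i --> F] --> A0 f0.
Proof.
move=> cA cf; apply/cvgrPdist_lt => e e0.
pose K := `|f0| + 1; have K0 : 0 < K by rewrite ltr_wpDl.
have L0 : 0 < `|A0| + 1 by rewrite ltr_wpDl.
have e1 : 0 < e / 2 / K by rewrite !divr_gt0.
have e2 : 0 < e / 2 / (`|A0| + 1) by rewrite !divr_gt0.
near=> i.
have hA : `|A0 - A i| < e / 2 / K by near: i; exact: cvgr_dist_lt.
have hf : `|f0 - f i| < e / 2 / (`|A0| + 1) by near: i; exact: cvgr_dist_lt.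
have hf1 : `|f0 - f i| < 1 by near: i; apply: cvgr_dist_lt.
have fK : `|f i| <= K.
  have := norm_le_dist (f i) f0; rewrite distrC /K; lra.
have -> : A0 f0 - A i (f i) = A0 (f0 - f i) + (A0 - A i) (f i).
  by rewrite blinB -[(A0 - A i) _]/(A0 (f i) - A i (f i)) addrA subrK.
apply: le_lt_trans (ler_normD _ _) _.
have h1 : `|A0 (f0 - f i)| <= (`|A0| + 1) * `|f0 - f i|.
  by apply: le_trans (blin_le _ _) _; rewrite ler_wpM2r// lerDl.
have h2 : `|(A0 - A i) (f i)| <= `|A0 - A i| * K.
  by apply: le_trans (blin_le _ _) _; rewrite ler_wpM2l.
rewrite ltr_pdivlMr// in hA; rewrite ltr_pdivlMr// mulrC in hf.
lra.
Unshelve. all: by end_near. Qed.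

Lemma inner_continuous {X : hilbertType R} (x : X) : continuous (inner x : X -> R^o).
Proof. exact: (blinP (riesz x)).2. Qed.

Lemma is_derive_inner {X : hilbertType R} (x : X) (f : R -> X) (t : R) (l : X) :
  is_derive t 1 f l -> is_derive t 1 (fun s => inner x (f s) : R^o) (inner x l).
Proof. exact: (is_derive_blin (riesz x)). Qed.

Lemma generator_is_derive {F : normedModType R} (S : R -> F -> F) (u : F) :
  S 0 u = u -> dom (generator S) u -> is_derive (0 : R) 1 (fun s => S s u) (generator S u).
Proof.
move=> S0 cv.
have qE : (fun h : R => h^-1 *: (S (h *: 1 + 0) u - S 0 u)) =
          (fun h => h^-1 *: (S h u - u)).
  by apply/funext => h; rewrite addr0 [_%:A]mulr1 S0.
by apply: DeriveDef; [rewrite /derivable /= qE|rewrite /derive /= qE].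
Qed.

Lemma is_derive_generator {F : normedModType R} (S : R -> F -> F) (u l : F) :
  S 0 u = u -> is_derive (0 : R) 1 (fun s => S s u) l ->
  dom (generator S) u /\ generator S u = l.
Proof.
move=> S0 [+ <-]; have qE : (fun h : R => h^-1 *: (S (h *: 1 + 0) u - S 0 u)) =
          (fun h => h^-1 *: (S h u - u)).
  by apply/funext => h; rewrite addr0 [_%:A]mulr1 S0.
by rewrite /derivable /derive /= qE => cv; split.
Qed.

End Density.

(** * The Riesz representation *)

Section RieszRepresentation.
Context {R : realType} {X : hilbertType R}.

Lemma parallelogram (x y : X) :
  `|x - y| ^+ 2 = 2 * `|x| ^+ 2 + 2 * `|y| ^+ 2 - 4 * `|2^-1 *: (x + y)| ^+ 2.
Proof.
by rewrite -!inner_norm !innerE (innerC y x); field.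
Qed.

(** The representing vector minimizes [|x|^2 / 2 - w x]; minimizing sequences are
    Cauchy by the parallelogram identity. *)
Lemma riesz_representation (w : dual X) : exists x : X, riesz x = w.
Proof.
pose F (x : X) : R := `|x| ^+ 2 / 2 - w x.
have Flb x : - (`|w| ^+ 2 / 2) <= F x.
  have := blin_le w x; have := ler_norm (w x); have := sqr_ge0 (`|w| - `|x|).
  rewrite /F sqrrB; set a := `|w|; set b := `|x|; lra.
have hinf : has_inf (range F).
  split; first by exists (F 0), 0.
  by exists (- (`|w| ^+ 2 / 2)) => _ [x _ <-].
pose m := inf (range F).
have mF x : m <= F x by apply: ge_inf; [exact: hinf.2|exists x].
pose eps n : R := n.+1%:R^-1.
have eps0 n : 0 < eps n by rewrite invr_gt0.
have seq n : {x | F x < m + eps n ^+ 2}.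
  apply: cid; have e2 : 0 < eps n ^+ 2 by rewrite exprn_gt0.
  by have [_ [x _ <-] xm] := inf_adherent e2 hinf; exists x.
pose x n := projT1 (seq n).
have Fx n : F (x n) < m + eps n ^+ 2 by exact: (projT2 (seq n)).
have epsle n k : (n <= k)%N -> eps k <= eps n.
  by move=> nk; rewrite lef_pV2 ?posrE ?ltr0n// ler_nat ltnS.
have /cvg_ex[/= l xl] : cvg (x @ \oo).
  apply: (@cauchy_modulus_cvg _ _ _ (fun n => 4 * eps n)).
    by rewrite -[X in _ --> X](mulr0 4); apply: cvgMl_tmp; exact: cvg_harmonic.
  move=> n k nk; rewrite -ler_sqr ?nnegrE ?mulr_ge0 ?(ltW (eps0 n))//.
  rewrite parallelogram.
  have := mF (2^-1 *: (x n + x k)); have := Fx n; have := Fx k.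
  have := epsle n k nk => nke.
  have : eps k ^+ 2 <= eps n ^+ 2 by rewrite ler_sqr ?nnegrE ?(ltW (eps0 _)).
  rewrite /F blinZ blinD exprMn -[2^-1 *: (w _ + w _)]/(2^-1 * (w (x n) + w (x k))).
  have := exprn_gt0 2 (eps0 n).
  set a := w _; set b := w _; set e := eps n ^+ 2; set e' := eps k ^+ 2.
  set p := `|x n| ^+ 2; set q := `|x k| ^+ 2; set r := `|_| ^+ 2; lra.
have Fl : F l <= m.
  apply/ler_addgt0Pl => e e0.
  have cF : F (x n) @[n --> \oo] --> F l.
    apply: cvgB; last by apply: continuous_cvg => //; exact: blin_continuous.
    by apply: cvgMr_tmp; rewrite expr2; apply: cvgM; apply: cvg_norm.
  have ce : m + eps n * eps n @[n --> \oo] --> m + 0 * 0.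
    apply: cvgD; first exact: cvg_cst.
    by apply: cvgM; exact: cvg_harmonic.
  rewrite mul0r addr0 in ce.
  suff h : F l <= m by rewrite (le_trans h)// lerDr ltW.
  apply: (ler_cvg_to cF ce); apply: nearW => n.
  by rewrite -expr2 ltW.
exists l; apply/val_inj/funext => y /=; rewrite -[LHS]/(inner l y).
apply/eqP; rewrite -subr_eq0 -normr_le0; apply/ler_addgt0Pl => e e0; rewrite addr0.
pose d := inner l y - w y.
have var t : 0 <= t * d + t ^+ 2 * (`|y| ^+ 2 / 2).
  have := le_trans Fl (mF (l + t *: y)).
  rewrite /F blinD blinZ -!inner_norm !innerE (innerC y l).
  rewrite -[t *: w y]/(t * w y) /d.
  set a := inner l l; set b := inner l y; set q := inner y y; set k := w l; set j := w y.
  nra.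
rewrite -/d; have [->|d0] := eqVneq d 0; first by rewrite normr0 ltW.
have y2 : 0 < `|y| ^+ 2 + 1 by rewrite ltr_wpDl// sqr_ge0.
have := var (- d / (`|y| ^+ 2 + 1)).
have -> : - d / (`|y| ^+ 2 + 1) * d + (- d / (`|y| ^+ 2 + 1)) ^+ 2 * (`|y| ^+ 2 / 2) =
   - (d ^+ 2 * ((`|y| ^+ 2 / 2 + 1) / (`|y| ^+ 2 + 1) ^+ 2)).
  by field; rewrite gt_eqF.
rewrite oppr_ge0 leNgt mulr_gt0//; first by rewrite exprn_even_gt0.
Qed.

Lemma riesz_linear (a : R) (x y : X) : riesz (a *: x + y) = a *: riesz x + riesz y.
Proof.
apply/val_inj/funext => z.
have e : inner (a *: x + y) z = a * inner x z + inner y z by rewrite innerDl innerZl.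
exact: e.
Qed.

End RieszRepresentation.

(** * Functions of class C^k *)

Section CkTheory.
Context {R : realType}.

Lemma open_radius {V : normedModType R} (O : set V) (u : V) : open O -> O u ->
  exists2 r : R, 0 < r & forall w, `|w - u| < r -> O w.
Proof.
move=> oO Ou; have /nbhs_normP[d /= d0 dO] : nbhs u O by exact: open_nbhs_nbhs.
by exists d => // w wd; apply: dO; rewrite /= distrC.
Qed.

Lemma differentiable_expansion {V W : normedModType R} (f : V -> W) (u : V) (e : R) :
  differentiable f u -> 0 < e -> exists2 d : R, 0 < d &
    forall h, `|h| < d -> `|f (u + h) - f u - 'd f u h| <= e * `|h|.
Proof.
move=> /diff_locally/eqaddoP df e0; have /nbhs_normP[d /= d0 dP] := df e e0.
exists d => // h hd; have := dP h; rewrite /= sub0r normrN => /(_ hd).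
by rewrite !fctE /= opprD addrA (addrC h).
Qed.

Lemma expansion_differentiable {V W : normedModType R} (g : V -> W) (u : V)
    (L : {linear V -> W}) : continuous L ->
  (forall e : R, 0 < e -> exists2 d : R, 0 < d &
    forall h, `|h| < d -> `|g (u + h) - g u - L h| <= e * `|h|) ->
  differentiable g u /\ 'd g u = L :> (V -> W).
Proof.
move=> cL gL.
have exp : g \o shift u = cst (g u) + L +o_ 0 id.
  apply/eqaddoP => e e0; have [d d0 dP] := gL e e0.
  apply/nbhs_normP; exists d => // h /=; rewrite sub0r normrN => /dP.
  by rewrite !fctE /= opprD addrA (addrC h).
have dg := diff_unique cL exp; split => //.
by apply/diff_locallyP; rewrite dg.
Qed.

Lemma differentiable_local {V W : normedModType R} (O : set V) (f g : V -> W) (u : V) :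
  open O -> O u -> (forall v, O v -> f v = g v) -> differentiable f u ->
  differentiable g u /\ frechet g u = frechet f u.
Proof.
move=> oO Ou fg df; have [r r0 rO] := open_radius oO Ou.
have [||dg dgE] := @expansion_differentiable _ _ g u ('d f u).
- exact: diff_continuous.
- move=> e e0; have [d d0 dP] := differentiable_expansion df e0.
  exists (Num.min d r); first by rewrite lt_min d0.
  move=> h; rewrite lt_min => /andP[hd hr]; rewrite -!fg//; first exact: dP.
  by apply: rO; rewrite addrC addKr.
- split => //; apply/val_inj/funext => h.
  by rewrite [LHS](frechetE _ dg) [RHS](frechetE _ df) dgE.
Qed.

Lemma Ck_local n {V W : normedModType R} (O : set V) (f g : V -> W) :
  open O -> (forall v, O v -> f v = g v) -> Ck n O f -> Ck n O g.
Proof.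
elim: n W f g => [|n IH] W f g oO fg.
  move=> cf x Ox; apply/continuous_epsP => e e0.
  have /continuous_epsP/(_ _ e0)[d d0 dP] := cf _ Ox.
  have [r r0 rP] := open_radius oO Ox.
  exists (Num.min d r); first by rewrite lt_min d0.
  by move=> y; rewrite lt_min => /andP[yd yr]; rewrite -!fg//; [exact: dP|exact: rP].
move=> [df cdf]; split.
  by move=> x Ox; have [] := differentiable_local oO Ox fg (df _ Ox).
apply: IH cdf => // x Ox.
by have [_ ->] := differentiable_local oO Ox fg (df _ Ox).
Qed.

Lemma frechetB {V W : normedModType R} (f g : V -> W) (k : R) (u : V) :
  differentiable f u -> differentiable g u ->
  differentiable (fun v => f v - k *: g v) u /\
  frechet (fun v => f v - k *: g v) u = frechet f u - k *: frechet g u.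
Proof.
move=> df dg; have dkg : differentiable (k *: g) u by exact: differentiableZ.
have d : differentiable (f - k *: g) u by exact: differentiableB.
split => //; apply/val_inj/funext => h /=.
rewrite [LHS](frechetE _ d) diffB//; last first.
rewrite diffZ// -[RHS]/(frechet f u h - k *: frechet g u h).
by rewrite (frechetE _ df) (frechetE _ dg).
Qed.

Lemma CkB n {V W : normedModType R} (O : set V) (f g : V -> W) (k : R) :
  open O -> Ck n O f -> Ck n O g -> Ck n O (fun v => f v - k *: g v).
Proof.
elim: n W f g => [|n IH] W f g oO.
  by move=> cf cg x Ox; apply: cvgB; [exact: cf|apply: cvgZ; [exact: cvg_cst|exact: cg]].
move=> [df cdf] [dg cdg]; split.
  by move=> x Ox; have [] := frechetB k (df _ Ox) (dg _ Ox).
apply: Ck_local (IH _ _ _ oO cdf cdg) => // v Ov.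
by have [_ ->] := frechetB k (df _ Ov) (dg _ Ov).
Qed.

End CkTheory.

Section Setting.
Context {R : realType} {X : hilbertType R} {V W : completeNormedModType R}.
Context (M : setting X V W) (hspaces : spaces M).
Context (h1 : A1 M) (h2 : A2 M) (h3 : A3 M) (h4 : A4 M) (h5 : A5 M).
Local Notation jV := (s_jV M).
Local Notation jW := (s_jW M).
Local Notation B := (s_B M).
Local Notation BW := (s_BW M).
Local Notation Jhat := (s_Jhat M).
Local Notation E := (s_E M).
Local Notation P := (s_P M).
Local Notation gradE := (s_gradE M).
Local Notation gradP := (s_gradP M).
Local Notation T := (s_T M).
Local Notation TV := (s_TV M).
Local Notation TW := (s_TW M).
Local Notation U := (s_U M).
Local Notation dT := (dT M).
Local Notation jWX := (jWX M).

(** * The affine group in the three spaces *)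

Definition embWX : blin W X := blin_comp jV jW.

Lemma jWX0 : jWX 0 = 0. Proof. exact: (blin0 embWX). Qed.

Lemma jWXD u v : jWX (u + v) = jWX u + jWX v. Proof. exact: (blinD embWX). Qed.

Lemma jWXB u v : jWX (u - v) = jWX u - jWX v. Proof. exact: (blinB embWX). Qed.

Lemma jWXZ a u : jWX (a *: u) = a *: jWX u. Proof. exact: (blinZ embWX). Qed.

Lemma jWX_continuous : continuous jWX.
Proof. exact: (@blin_continuous _ _ _ embWX). Qed.

Lemma jV_inj : injective jV. Proof. by have [] := hspaces. Qed.

Lemma jWX_inj : injective jWX.
Proof. by have [iV iW _ _ _] := hspaces; move=> u v /iV/iW. Qed.

Lemma openO : open (s_O M). Proof. by have [] := hspaces. Qed.

Lemma openOV : open (OV M).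
Proof. by apply: open_comp openO => u _; exact: blin_continuous. Qed.

Lemma OW_OV w : OW M w -> OV M (jW w). Proof. by []. Qed.

Lemma T_dT s u : T s u = dT s u + T s 0.
Proof. by rewrite /dT /linpart subrK. Qed.

Lemma dTP s a u v : dT s (a *: u + v) = a *: dT s u + dT s v.
Proof. exact: (A4_linpart h4). Qed.

Lemma dTD s u v : dT s (u + v) = dT s u + dT s v.
Proof. by have := dTP s 1 u v; rewrite !scale1r. Qed.

Lemma dT0 s : dT s 0 = 0.
Proof. by rewrite /dT /linpart subrr. Qed.

Lemma dTZ s a u : dT s (a *: u) = a *: dT s u.
Proof. by have := dTP s a u 0; rewrite dT0 !addr0. Qed.

Lemma dTB s u v : dT s (u - v) = dT s u - dT s v.
Proof. by rewrite dTD -scaleN1r dTZ scaleN1r. Qed.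

Lemma TB s u v : T s u - T s v = dT s (u - v).
Proof. by rewrite dTB /dT /linpart opprB addrA subrK. Qed.

Lemma jWX_linpart s w : jWX (linpart TW s w) = dT s (jWX w).
Proof. by rewrite jWXB !(A4_i_W h4) jWX0. Qed.

Lemma jV_linpart s v : jV (linpart TV s v) = dT s (jV v).
Proof. by rewrite blinB !(A4_i_V h4) blin0. Qed.

Lemma jW_TW s w : jW (TW s w) = TV s (jW w).
Proof. by apply: jV_inj; rewrite (A4_i_V h4); exact: (A4_i_W h4). Qed.

Lemma TW_0 w : TW 0 w = w.
Proof. by apply: jWX_inj; rewrite (A4_i_W h4) (A4_ii_0 h4). Qed.

Lemma TWD s r w : TW (s + r) w = TW s (TW r w).
Proof. by apply: jWX_inj; rewrite !(A4_i_W h4) (A4_ii_D h4). Qed.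

Lemma TV_0 v : TV 0 v = v.
Proof. by apply: jV_inj; rewrite (A4_i_V h4) (A4_ii_0 h4). Qed.

Lemma TVD s r v : TV (s + r) v = TV s (TV r v).
Proof. by apply: jV_inj; rewrite !(A4_i_V h4) (A4_ii_D h4). Qed.

Lemma TWB s u v : TW s u - TW s v = linpart TW s (u - v).
Proof.
by apply: jWX_inj; rewrite jWX_linpart !jWXB !(A4_i_W h4) TB.
Qed.

Lemma TW_isometry s u v : `|TW s u - TW s v| = `|u - v|.
Proof. by rewrite TWB (A4_iii_W h4). Qed.

Lemma TV_line s u (a : R) v : TV s (u + a *: v) = TV s u + a *: linpart TV s v.
Proof.
apply: jV_inj; rewrite blinD blinZ jV_linpart !(A4_i_V h4) blinD blinZ.
by rewrite T_dT dTD dTZ addrAC -T_dT.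
Qed.

Lemma TV_isometry s u v : `|TV s u - TV s v| = `|u - v|.
Proof.
suff -> : TV s u - TV s v = linpart TV s (u - v) by rewrite (A4_iii_V h4).
by apply: jV_inj; rewrite jV_linpart !blinB !(A4_i_V h4) TB.
Qed.

Lemma OV_TV s u : OV M u -> OV M (TV s u).
Proof. by rewrite /OV /= (A4_i_V h4); exact: (A4_i_O h4). Qed.

Lemma dT_inner s x y : inner (dT s x) (dT s y) = inner x y.
Proof. exact: (A4_iii_X h4 s).1. Qed.

Lemma dT_0 x : dT 0 x = x.
Proof. by rewrite /dT /linpart !(A4_ii_0 h4) subr0. Qed.

Lemma dT_D s r x : dT (s + r) x = dT s (dT r x).
Proof.
by rewrite {1}/dT /linpart !(A4_ii_D h4) TB.
Qed.

Lemma dT_adjoint s x y : inner (dT s x) y = inner x (dT (- s) y).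
Proof. by rewrite -(dT_inner (- s)) -dT_D addNr dT_0. Qed.

Lemma dT_K s x : dT s (dT (- s) x) = x.
Proof. by rewrite -dT_D subrr dT_0. Qed.

Lemma dense_range_jWX : dense (jWX @` setT).
Proof.
move=> Y Y0 oY; have [x [Yx [[w Dw wx] Rx]]] := A4_viii h4 Y0 oY.
by exists x; split => //; exists w.
Qed.

Lemma dense_range_jV : dense (jV @` setT).
Proof.
move=> Y Y0 oY; have [x [Yx [w _ wx]]] := dense_range_jWX Y0 oY.
by exists x; split => //; exists (jW w).
Qed.

Lemma dual_eq_on_V (f g : dual X) : (forall v, f (jV v) = g (jV v)) -> forall x, f x = g x.
Proof.
move=> fg x; have cont (h : dual X) : forall y, setT y -> {for y, continuous h}.
  by move=> y _; exact: blin_continuous.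
apply: (dense_continuous_eq dense_range_jV openT (cont f) (cont g) _ (I : setT x)).
by move=> _ [v _ <-] _; exact: fg.
Qed.

Lemma generator_jWX b : dom (generator TW) b -> dom (generator T) (jWX b).
Proof.
move=> /(generator_is_derive (TW_0 b))/(is_derive_blin embWX) d.
apply: (proj1 (@is_derive_generator _ _ T (jWX b) (embWX (generator TW b)) _ _)).
  exact: (A4_ii_0 h4).
by move: d; congr (is_derive _ _ _ _); apply/funext => s; exact: (A4_i_W h4).
Qed.

Lemma generator_jV v : dom (generator TV) v ->
  dom (generator T) (jV v) /\ generator T (jV v) = jV (generator TV v).
Proof.
move=> /(generator_is_derive (TV_0 v))/(is_derive_blin jV) d.
apply: is_derive_generator; first exact: (A4_ii_0 h4).
by move: d; congr (is_derive _ _ _ _); apply/funext => s; exact: (A4_i_V h4).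
Qed.

Lemma generator_dT u : dom (generator T) u -> dom (generator dT) u.
Proof. by move=> /(A4_vii_affine h4)[]. Qed.

Lemma generator_at0 : dom (generator T) 0.
Proof.
have T0 : [set: X] !=set0 by exists 0.
by have [u [_ /(A4_vii_affine h4)[]]] := A4_vii_dense_X h4 T0 openT.
Qed.

(** Compactness of the time interval; that the translations are isometries reduces
    their strong continuity to the points [u t]. *)
Lemma uniform_translation (u : R -> W) (a b : R) :
  (forall t, a <= t <= b -> {for t, continuous u}) ->
  forall e : R, 0 < e -> exists2 d : R, 0 < d & forall t t' r,
    a <= t <= b -> `|t' - t| < d -> `|r| < d -> `|TW r (u t') - u t| < e.
Proof.
move=> cu e e0; pose P (d t : R) := forall t' r : R,
  `|t' - t| < d -> `|r| < d -> `|TW r (u t') - u t| < e.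
have : \forall d \near (0 : R)^'+, `[a, b] `<=` P d.
  have /compact_near_coveringP cK := @segment_compact R a b.
  apply: cK => t; rewrite /= in_itv/= => tab.
  have e4 : 0 < e / 4 by rewrite divr_gt0.
  have /continuous_epsP/(_ _ e4)[d1 d10 d1P] := cu t tab.
  have cT : {for 0, continuous (fun s => TW s (u t))} by exact: (A4_iv_W h4).
  have /continuous_epsP/(_ _ e4)[d2 d20 d2P] := cT.
  have d12 : 0 < d1 / 2 by rewrite divr_gt0.
  pose d := Num.min (d1 / 2) d2.
  have d0 : 0 < d by rewrite lt_min d12.
  exists (ball t (d1 / 2), [set d' | 0 < d' < d]) => /=.
    split; first by apply: nbhsx_ballx.
    near=> d'; rewrite /=; apply/andP; split => //.
  move=> [t' d'] [/=]; rewrite -ball_normE/= => tt' /andP[d'0].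
  rewrite lt_min => /andP[dd1 dd2] t'' r tr rd.
  have q1 : `|u t' - u t| < e / 4 by apply: d1P; rewrite distrC; lra.
  have q2 : `|u t'' - u t| < e / 4.
    apply: d1P; have := ler_normD (t'' - t') (t' - t); rewrite addrA subrK.
    rewrite (distrC t' t); lra.
  have q3 : `|TW r (u t) - u t| < e / 4.
    by have := d2P r; rewrite subr0 TW_0; apply; exact: lt_trans rd _.
  have q4 : `|TW r (u t'') - TW r (u t)| < e / 4 by rewrite TW_isometry.
  have := ler_normD (TW r (u t'') - TW r (u t)) (TW r (u t) - u t).
  have := ler_normD (TW r (u t'') - u t) (u t - u t').
  rewrite !addrA !subrK (distrC (u t) (u t')); lra.
move=> nearP; have [d [d0 dP]] := filter_ex (filterI (nbhs_right_gt (0 : R)) nearP).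
exists d => // t t' r tab; apply: dP.
by rewrite /= in_itv.
Unshelve. all: by end_near. Qed.

(** * Differentiating along the group and along solutions *)

Lemma B_continuous u : OV M u -> {for u, continuous B}.
Proof.
by move=> Ou; have [_ _ _ [[dB _] _ _] _] := h2; exact/differentiable_continuous/dB.
Qed.

Lemma gradB_continuous (grad : V -> dual X) (y : X) : Ck 0 (OV M) grad ->
  forall u, OV M u -> {for u, continuous (fun v => grad v (B v y))}.
Proof.
move=> cg u Ou; apply: cvg_blin_app; first exact: cg.
apply: cvg_blin_app; last exact: cvg_cst.
exact: B_continuous.
Qed.

(** Pairings with such [x] can be differentiated along the group and along
    solutions, the derivatives being gradients applied to [B u (jWX b)]. *)
Definition regular (x : X) (b : W) : Prop :=
  [/\ dom (JhatI M) x, dom (generator TW) b & jWX b = JhatI M x].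

Lemma regular_generator x b : regular x b -> dom (generator dT) x.
Proof.
move=> [dx db bx]; have [E _] := A4_vii_comm h4.
suff : dom (comp_map (generator dT) (JhatI M)) x by rewrite -E => -[].
split => //; rewrite -bx; apply: generator_dT.
exact: generator_jWX.
Qed.

Lemma is_derive_inner_T_affine (x : X) (u : X) : dom (generator dT) x ->
  is_derive (0 : R) 1 (fun s => inner x (T s u) : R^o)
    (- inner (generator dT x) u + inner x (generator T 0)).
Proof.
move=> dx; have d1 := generator_is_derive (dT_0 x) dx.
have d2 := generator_is_derive (A4_ii_0 h4 0) generator_at0.
have d1' : is_derive (- (0 : R)) 1 (fun s => inner u (dT s x) : R^o)
    (inner u (generator dT x)) by rewrite oppr0; exact: is_derive_inner.
have d3 := is_derive_opp_arg d1'.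
have -> : (fun s => inner x (T s u) : R^o) =
    (fun s => inner u (dT (- s) x) : R^o) + (fun s => inner x (T s 0) : R^o).
  apply/funext => s; rewrite [RHS]/(inner u (dT (- s) x) + inner x (T s 0)).
  by rewrite T_dT innerDr -dT_adjoint (innerC x (dT s u)).
by rewrite (innerC (generator dT x)); exact: is_deriveD d3 (is_derive_inner x d2).
Qed.

(** Formally [T'(0) u = J(u) gradP(u)], and [J(u)] is skew.  This holds on the
    domain of the generator, and both sides are continuous in [u] once paired
    with a regular [x]. *)
Lemma is_derive_inner_T0 x b u : regular x b -> OV M u ->
  is_derive (0 : R) 1 (fun s => inner x (T s (jV u)) : R^o)
    (- gradP u (B u (jWX b))).
Proof.
move=> rx Ou; have dx := regular_generator rx; have [[_ domx] db bx] := rx.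
have := is_derive_inner_T_affine (jV u) dx.
suff -> : - inner (generator dT x) (jV u) + inner x (generator T 0)
  = - gradP u (B u (jWX b)) by [].
have [_ _ _ _ skew] := h2; have [_ _ _ cP _] := h3.
move: u Ou; apply: (dense_continuous_eq (A4_vii_dense_V h4) openOV).
- move=> v _; apply: cvgD; last exact: cvg_cst.
  apply: cvgN; apply: continuous_comp; first exact: blin_continuous.
  exact: inner_continuous.
- by move=> v Ov; apply: cvgN; exact: gradB_continuous.
move=> v dv Ov; have [dJ PE] := A4_vii_P h4 dv Ov.
have [dTv gE] := generator_jV dv.
have := is_derive_inner x (generator_is_derive (A4_ii_0 h4 _) dTv).
move/is_derive_unique => /(_ _ (is_derive_inner_T_affine (jV v) dx)) <-.
rewrite PE; have := skew v Ov (gradP v) (riesz x) dJ domx.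
by rewrite -[riesz x _]/(inner x _) => ->; rewrite bx.
Qed.

Lemma is_derive_inner_T x b u (s : R) : regular x b -> OV M u ->
  is_derive s 1 (fun r => inner x (T r (jV u)) : R^o)
    (- gradP (TV s u) (B (TV s u) (jWX b))).
Proof.
move=> rx Ou; apply: is_derive_shift0.
have := is_derive_inner_T0 rx (OV_TV s Ou).
congr (is_derive _ _ _ _); apply/funext => r.
by rewrite (A4_i_V h4) -(A4_ii_D h4) addrC.
Qed.

Lemma linpart_TV_B s u v : linpart TV s (u - v) = linpart TV s u - linpart TV s v.
Proof. by apply: jV_inj; rewrite [RHS]blinB !jV_linpart blinB dTB. Qed.

Lemma linpart_TV_Z s (a : R) v : linpart TV s (a *: v) = a *: linpart TV s v.
Proof. by apply: jV_inj; rewrite [RHS]blinZ !jV_linpart blinZ dTZ. Qed.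

Lemma TVB s u v : TV s u - TV s v = linpart TV s (u - v).
Proof. by rewrite linpart_TV_B /linpart opprB addrA subrK. Qed.

Lemma is_derive_TV v (s : R) : dom (generator TV) v ->
  is_derive s 1 (fun r => TV r v) (linpart TV s (generator TV v)).
Proof.
move=> /(generator_is_derive (TV_0 v))/is_derive_epsP d.
apply: is_derive_shift0; apply/is_derive_epsP => e /d[k k0 kP].
exists k => // h hk; have := kP h hk; rewrite !add0r addr0 TV_0.
rewrite TVD TVB -linpart_TV_Z -linpart_TV_B.
by rewrite (A4_iii_V h4).
Qed.

Lemma generator_TV v (s : R) : dom (generator TV) v -> dom (generator TV) (TV s v).
Proof.
move=> dv; have := is_derive_TV s dv.
have {1}-> : s = s + 0 by rewrite addr0.
move=> /is_derive_shift_arg d; have [] := @is_derive_generator _ _ TV (TV s v)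
  (linpart TV s (generator TV v)) (TV_0 _) => //.
move: d; congr (is_derive _ _ _ _); apply/funext => r.
by rewrite addrC TVD.
Qed.

Lemma TV_continuous s : continuous (TV s).
Proof.
move=> v; apply/continuous_epsP => e e0; exists e => // w.
by rewrite TV_isometry.
Qed.

(** The derivative of [P] along the group is [<gradP, J gradP> = 0]. *)
Lemma P_invariant s u : OV M u -> s_P M (TV s u) = s_P M u.
Proof.
have [_ [dP _] _ _ grad] := h3; have [_ _ _ _ skew] := h2.
have cP v : OV M v -> {for v, continuous (s_P M)}.
  by move=> Ov; exact/differentiable_continuous/dP.
move: u; apply: (dense_continuous_eq (A4_vii_dense_V h4) openOV) => //.
  move=> v Ov; apply: continuous_comp; first exact: TV_continuous.
  by apply: cP; exact: OV_TV.
move=> v dv Ov; rewrite -[in RHS](TV_0 v).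
have d (r : R) : is_derive r 1 (fun r => s_P M (TV r v) : R^o) 0.
  have Or := OV_TV r Ov; have dr := generator_TV (s := r) dv.
  have := is_derive_frechet_comp (is_derive_TV r dv) (dP _ Or).
  have <- : generator TV (TV r v) = linpart TV r (generator TV v).
    have := is_derive_TV r dv; have {1}-> : r = r + 0 by rewrite addr0.
    move=> /is_derive_shift_arg d.
    apply: is_derive_unique (generator_is_derive (TV_0 _) dr) _.
    move: d; congr (is_derive _ _ _ _); apply/funext => q.
    by rewrite addrC TVD.
  rewrite -(grad _ Or _).2 -(generator_jV dr).2.
  have [dJ ->] := A4_vii_P h4 dr Or.
  have -> : gradP (TV r v) (J M (TV r v) (gradP (TV r v))) = 0 :> R.
    have := skew _ Or _ _ dJ dJ; set q := gradP _ _ => qN; lra.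
  by [].
apply: (@is_derive_constant R (fun r => s_P M (TV r v)) (- `|s| - 1) (`|s| + 1)).
- by have := ler_norm s; have := ler_norm (- s); rewrite normrN; lra.
- by have := normr_ge0 s; lra.
Qed.

Lemma dT_norm s x : `|dT s x| = `|x|.
Proof.
by apply/eqP; rewrite -(@eqrXn2 _ 2)// -!inner_norm dT_inner.
Qed.

(** The derivative of [E (T(s) u) = E u] on [V], extended to [X] by density. *)
Lemma gradE_equivariant s u x : OV M u -> gradE (TV s u) (dT s x) = gradE u x.
Proof.
move=> Ou; have [[dE _] _ _ _ grad] := h3; have Os := OV_TV s Ou.
move: x.
have dTlin : (dT s : X -> X) \in @is_blin R X X.
  apply/asboolP; split=> [a y z|y]; first exact: dTP.
  apply/continuous_epsP => e e0; exists e => // z.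
  by rewrite -dTB dT_norm.
apply: (@dual_eq_on_V (blin_comp (gradE (TV s u)) (Blin dTlin)) (gradE u)).
move=> v /=; rewrite -jV_linpart (grad _ Os _).1 (grad _ Ou _).1.
have d1 : is_derive (0 : R) 1 (fun h : R => s_E M (u + h *: v) : R^o) (frechet (s_E M) u v).
  have := @is_derive_line R V R^o (s_E M) u v 0; rewrite scale0r addr0.
  by apply; exact: dE.
have d2 : is_derive (0 : R) 1 (fun h : R => s_E M (TV s u + h *: linpart TV s v) : R^o)
    (frechet (s_E M) (TV s u) (linpart TV s v)).
  have := @is_derive_line R V R^o (s_E M) (TV s u) (linpart TV s v) 0; rewrite scale0r addr0.
  by apply; exact: dE.
have [r r0 rP] : exists2 r, 0 < r & forall h : R, `|h| < r -> OV M (u + h *: v).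
  have /nbhs_normP[k /= k0 kO] : nbhs u (OV M).
    by apply: open_nbhs_nbhs; split => //; exact: openOV.
  exists (k / (`|v| + 1)); first by rewrite divr_gt0// ltr_wpDl.
  move=> h hk; apply: kO => /=; rewrite opprD addrA subrr sub0r normrN normrZ.
  rewrite ltr_pdivlMr ?ltr_wpDl// in hk; apply: le_lt_trans hk.
  by rewrite ler_wpM2l// lerDl.
apply: is_derive_unique d2 _; apply: is_derive_local r0 _ d1 => h.
by rewrite subr0 => hr; rewrite -TV_line (A4_ix h4)//; exact: rP.
Qed.

Lemma inner_T x s y : inner x (T s y) = inner (dT (- s) x) y + inner x (T s 0).
Proof. by rewrite T_dT innerDr dT_adjoint opprK. Qed.

Lemma solution_continuous D (u : R -> W) t : solution_on M D u -> D° t ->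
  {for t, continuous u}.
Proof.
move=> [cu _ _ _ _] Dt; have := cu.
move/continuous_subspaceW => /(_ D° (@interior_subset _ _)).
rewrite continuous_open_subspace; last exact: open_interior.
by apply; rewrite inE.
Qed.

(** All functions in the weak equation are continuous, so it holds pointwise. *)
Lemma solution_is_derive D (u : R -> W) (w : dual X) (t : R) :
  solution_on M D u -> dom (s_Jhat M) w -> D° t ->
  is_derive t 1 (fun r => w (jWX (u r)) : R^o) (- gradE (jW (u t)) (J M (jW (u t)) w)).
Proof.
move=> su dw Dt; have [cu Ou weak _ _] := su; have [_ _ cE _ _] := h3.
have cut r : D° r -> {for r, continuous u} by exact: solution_continuous.
apply: (du_bois_reymond (open_interior D) _ _ (weak w dw) Dt) => r Dr.
  apply: (continuous_comp (f := u) (g := fun z => w (jWX z))); first exact: cut.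
  by apply: continuous_comp; [exact: jWX_continuous|exact: blin_continuous].
apply: cvgN; apply: (continuous_comp (g := fun v => gradE (jW v) (J M (jW v) w))).
  exact: cut.
apply: (continuous_comp (f := jW) (g := fun v => gradE v (B v (s_Jhat M w)))).
  exact: blin_continuous.
apply: gradB_continuous; [exact: cE|exact: (Ou _ (interior_subset Dr))].
Qed.

(** In the frame moved by a fixed [s] the equation keeps the same form, by the
    equivariance of [B], [Jhat] and [gradE]. *)
Lemma solution_is_derive_frame D (u : R -> W) x b (s t : R) :
  solution_on M D u -> regular x b -> D° t ->
  is_derive t 1 (fun r => inner x (T s (jWX (u r))) : R^o)
    (- gradE (jW (TW s (u t))) (B (jW (TW s (u t))) (jWX b))).
Proof.
move=> su rx Dt; have [[_ domx] db bx] := rx; have [_ Ou _ _ _] := su.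
have Out : OV M (jW (u t)) := Ou _ (interior_subset Dt).
have domsx : dom (s_Jhat M) (riesz (dT (- s) x)) by exact: (A4_i_dom h4).
have d := solution_is_derive su domsx Dt.
have -> : (fun r => inner x (T s (jWX (u r))) : R^o) =
   (fun r => riesz (dT (- s) x) (jWX (u r)) : R^o) + cst (inner x (T s 0)).
  apply/funext => r; rewrite [RHS]/(inner (dT (- s) x) (jWX (u r)) + inner x (T s 0)).
  exact: inner_T.
suff -> : - gradE (jW (TW s (u t))) (B (jW (TW s (u t))) (jWX b)) =
   - gradE (jW (u t)) (J M (jW (u t)) (riesz (dT (- s) x))) + 0.
  by apply: is_deriveD.
rewrite addr0 jW_TW; congr (- _).
have [_ JdT] := A4_vi_J h4 (- s).
have JE : s_Jhat M (riesz (dT (- s) x)) = dT (- s) (jWX b) by rewrite bx; exact: JdT.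
rewrite -[J M _ _]/(B _ (s_Jhat M _)) JE.
rewrite -(gradE_equivariant s _ Out) (A4_vi_B h4)//.
by rewrite dT_K.
Qed.

Lemma regular_lipschitz x b : regular x b -> exists C d : R, [/\ 0 < C, 0 < d &
  forall r s : R, `|r - s| < d -> `|dT r x - dT s x| <= C * `|r - s|].
Proof.
move=> rx; have dx := regular_generator rx.
have /is_derive_epsP/(_ _ ltr01)[d d0 dP] := generator_is_derive (dT_0 x) dx.
exists (`|generator dT x| + 1), d; split => //.
move=> r s rs; have [->|rsn] := eqVneq r s; first by rewrite !subrr !normr0 mulr0.
have hd : 0 < `|r - s| < d by rewrite normr_gt0 subr_eq0 rsn.
have -> : dT r x - dT s x = dT s (dT (r - s) x - x).
  by rewrite dTB -dT_D (addrC s) subrK.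
rewrite dT_norm; have := dP _ hd; rewrite add0r dT_0 => h.
have := norm_le_dist (dT (r - s) x - x) ((r - s) *: generator dT x).
rewrite normrZ; lra.
Qed.

(** Product rule for [(x, T(s(t)) u(t))] along an affine [s]: the two partial
    derivatives are known, and the mixed increment is [o(h)] because [dT(s) x] is
    Lipschitz in [s] while [u] is continuous. *)
Lemma is_derive_moving_frame D (u : R -> W) x b (a s0 t0 t : R) :
  solution_on M D u -> regular x b -> D° t ->
  let U := jW (TW (s0 + (t - t0) * a) (u t)) in
  is_derive t 1 (fun r => inner x (T (s0 + (r - t0) * a) (jWX (u r))) : R^o)
    (- gradE U (B U (jWX b)) - a * gradP U (B U (jWX b))).
Proof.
move=> su rx Dt /=; set s := s0 + (t - t0) * a; set z := jWX (u t).
have [_ Ou _ _ _] := su.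
have Out : OV M (jW (u t)) := Ou _ (interior_subset Dt).
have d1 := solution_is_derive_frame s su rx Dt.
have ds (r : R) : is_derive r 1 (fun r => s0 + (r - t0) * a) a.
  apply/is_derive_epsP => e e0; exists 1 => // h _.
  have -> : s0 + (r + h - t0) * a - (s0 + (r - t0) * a) - h *: a = 0.
    by rewrite -[h *: a]/(h * a); ring.
  by rewrite normr0 mulr_ge0// ltW.
have d2 : is_derive t 1 (fun r => inner x (T (s0 + (r - t0) * a) z) : R^o)
    (- gradP (TV s (jW (u t))) (B (TV s (jW (u t))) (jWX b)) * a).
  have := @is_derive1_comp R (fun r => inner x (T r z)) (fun r => s0 + (r - t0) * a) t _ a
    (is_derive_inner_T s rx Out).
  by apply.
have d12 := is_deriveD d1 d2.
rewrite jW_TW in d12 *.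
have -> : - gradE (TV s (jW (u t))) (B (TV s (jW (u t))) (jWX b)) -
    a * gradP (TV s (jW (u t))) (B (TV s (jW (u t))) (jWX b)) =
    - gradE (TV s (jW (u t))) (B (TV s (jW (u t))) (jWX b)) +
    - gradP (TV s (jW (u t))) (B (TV s (jW (u t))) (jWX b)) * a :> R by ring.
move/is_derive_epsP: d12 => d12; apply/is_derive_epsP => e e0.
have e2 : 0 < e / 2 by rewrite divr_gt0.
have [k1 k10 k1P] := d12 _ e2.
have [C [d [C0 d0 Cx]]] := regular_lipschitz rx.
pose L := C * (`|a| + 1).
have L0 : 0 < L by rewrite mulr_gt0// ltr_wpDl.
have cz : {for t, continuous (fun r => jWX (u r))}.
  by apply: continuous_comp; [exact: solution_continuous Dt|exact: jWX_continuous].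
have eL : 0 < e / 2 / L by rewrite divr_gt0.
have /continuous_epsP/(_ _ eL)[k2 k20 k2P] := cz.
pose k3 := d / (`|a| + 1).
have k30 : 0 < k3 by rewrite divr_gt0// ltr_wpDl.
exists (Num.min k1 (Num.min k2 k3)); first by rewrite !lt_min k10 k20.
move=> h; rewrite !lt_min => /andP[h0 /andP[hk1 /andP[hk2 hk3]]].
have := k1P h; rewrite h0 hk1 => /(_ isT).
set q := - gradE _ _ + _; rewrite !fctE -/z -/s.
set sh := s0 + (t + h - t0) * a; set zh := jWX (u (t + h)) => hd.
have mixed : inner x (T sh zh) - inner x (T s z) - h *: q =
   (inner x (T s zh) + inner x (T sh z) - (inner x (T s z) + inner x (T s z)) - h *: q) +
   inner (dT (- sh) x - dT (- s) x) (zh - z).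
  rewrite (inner_T x sh zh) (inner_T x s z) (inner_T x s zh) (inner_T x sh z).
  by rewrite innerBl !innerBr; ring.
rewrite mixed; apply: le_trans (ler_normD _ _) _.
have shs : `|- sh - - s| <= (`|a| + 1) * `|h|.
  have -> : - sh - - s = - (a * h) by rewrite /sh /s; ring.
  by rewrite normrN normrM ler_wpM2r// lerDl.
have hdd : `|- sh - - s| < d.
  by apply: le_lt_trans shs _; rewrite mulrC -ltr_pdivlMr// ltr_wpDl.
have zz : `|zh - z| < e / 2 / L by apply: k2P; rewrite addrAC subrr add0r.
have := cauchy_schwarz (dT (- sh) x - dT (- s) x) (zh - z).
have zx : `|dT (- sh) x - dT (- s) x| * `|zh - z| <= e / 2 * `|h|.
  apply: (@le_trans _ _ (L * `|h| * (e / 2 / L))).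
    rewrite ler_pM ?(ltW zz)//; apply: le_trans (Cx _ _ hdd) _.
    by rewrite /L -mulrA ler_wpM2l// ltW.
  by rewrite le_eqVlt; apply/orP; left; apply/eqP; field; rewrite gt_eqF.
lra.
Qed.

(** * Solutions in differential form *)

Definition rate (w : dual X) (u : W) : R := - gradE (jW u) (J M (jW u) w).

Lemma rate_continuous w u : OW M u -> {for u, continuous (rate w : W -> R^o)}.
Proof.
have [_ _ cE _ _] := h3 => Ou; apply: cvgN.
apply: (continuous_comp (f := jW) (g := fun v => gradE v (B v (Jhat w)))).
  exact: blin_continuous.
by apply: gradB_continuous; [exact: cE|exact: Ou].
Qed.

(** Solutions in differential form: restriction, translation in time and gluing
    are elementary for these, and they are the solutions in the weak sense. *)
Definition strict_solution (t1 : R) (u : R -> W) : Prop :=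
  [/\ forall t, 0 <= t < t1 -> forall e : R, 0 < e ->
        exists2 d : R, 0 < d & forall s, 0 <= s < t1 -> `|s - t| < d -> `|u s - u t| < e,
      forall t, 0 <= t < t1 -> OW M (u t),
      forall w, dom Jhat w -> forall t : R, 0 < t < t1 ->
        is_derive t 1 (fun r => w (jWX (u r)) : R^o) (rate w (u t)),
      forall t, 0 <= t < t1 -> E (jW (u t)) = E (jW (u 0)) &
      forall t, 0 <= t < t1 -> P (jW (u t)) = P (jW (u 0))].

Lemma strict_solution_continuous t1 u t : strict_solution t1 u -> 0 < t < t1 ->
  {for t, continuous u}.
Proof. by move=> [cu _ _ _ _]; exact: half_open_continuous. Qed.

Lemma strict_solutionP t1 u : 0 < t1 -> solution_on M `[0, t1[ u <-> strict_solution t1 u.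
Proof.
move=> t10; have inD t : (0 <= t < t1) = (t \in `[0, t1[) by rewrite in_itv.
have D0 : `[0, t1[%classic (0 : R) by rewrite /= -inD lexx.
split=> [su|su].
  have [cu Ou _ cE cP] := su; split.
  - move=> t; rewrite inD => Dt e e0; have [d d0 dP] := (within_continuous_epsP _ _).1 cu t Dt e e0.
    by exists d => // s; rewrite inD => Ds; exact: dP.
  - by move=> t; rewrite inD; exact: Ou.
  - move=> w dw t tt; apply: (solution_is_derive su dw).
    by rewrite interior_itv /= in_itv.
  - by move=> t; rewrite inD => Dt; exact: cE.
  - by move=> t; rewrite inD => Dt; exact: cP.
have [cu Ou du cE cP] := su; split.
- apply/within_continuous_epsP => t Dt e e0.
  have Dt' : 0 <= t < t1 by rewrite inD.
  have [d d0 dP] := cu t Dt' e e0.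
  by exists d => // s Ds; apply: dP; rewrite inD.
- by move=> t Dt; apply: Ou; rewrite inD.
- move=> w dw; rewrite interior_itv.
  apply: (@is_derive_weak_derivative R _ _ 0 t1 t10) => [t tt|t tt]; first exact: du.
  apply: (continuous_comp (f := u) (g := rate w)).
    exact: strict_solution_continuous tt.
  by apply: rate_continuous; apply: Ou; move/andP: tt => [/ltW -> ->].
- by move=> s t Ds Dt; rewrite (cE s) ?inD// (cE t) ?inD.
- by move=> s t Ds Dt; rewrite (cP s) ?inD// (cP t) ?inD.
Qed.

Lemma strict_solution_restrict t1 t2 u : t2 <= t1 -> strict_solution t1 u ->
  strict_solution t2 u.
Proof.
move=> t21 [cu Ou du cE cP].
have sub t : 0 <= t < t2 -> 0 <= t < t1.
  by move=> /andP[-> tt]; exact: lt_le_trans tt t21.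
split=> [t tt e e0|t tt|w dw t /andP[t0 tt]|t tt|t tt].
- have [d d0 dP] := cu t (sub t tt) e e0; exists d => // s ss; apply: dP; exact: sub.
- exact/Ou/sub.
- by apply: du; rewrite // t0 (lt_le_trans tt t21).
- exact/cE/sub.
- exact/cP/sub.
Qed.

(** The second solution starts at a time [s] interior to the first; at the junction
    both derivatives agree with the continuous right-hand side. *)
Lemma strict_solution_glue t1 t2 s u v : 0 <= s < t1 -> v 0 = u s ->
  strict_solution t1 u -> strict_solution t2 v ->
  exists2 w, w 0 = u 0 & strict_solution (s + t2) w.
Proof.
move=> /andP[s0 st1] vs su sv; have [cu Ou du cEu cPu] := su; have [cv Ov dv cEv cPv] := sv.
pose w t := if t <= s then u t else v (t - s).
have wu t : t <= s -> w t = u t by rewrite /w => ->.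
have wv t : s <= t -> w t = v (t - s).
  rewrite /w le_eqVlt => /predU1P[<-|st]; first by rewrite lexx subrr vs.
  by rewrite leNgt st.
have inu t : 0 <= t -> t <= s -> 0 <= t < t1 by move=> -> ts; exact: le_lt_trans ts st1.
have inv t : s <= t -> t < s + t2 -> 0 <= t - s < t2 by move=> ? ?; apply/andP; split; lra.
have cw t : 0 <= t < s + t2 -> forall e : R, 0 < e ->
    exists2 d : R, 0 < d & forall r, 0 <= r < s + t2 -> `|r - t| < d -> `|w r - w t| < e.
  move=> /andP[t0 tt] e e0.
  have left : t <= s -> exists2 d : R, 0 < d &
      forall r, 0 <= r -> r <= s -> `|r - t| < d -> `|w r - w t| < e.
    move=> ts; have [d d0 dP] := cu t (inu _ t0 ts) e e0; exists d => // r r0 rs rt.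
    by rewrite !wu//; apply: dP => //; exact: inu.
  have right : s <= t -> exists2 d : R, 0 < d &
      forall r, s <= r -> r < s + t2 -> `|r - t| < d -> `|w r - w t| < e.
    move=> ts; have [d d0 dP] := cv (t - s) (inv _ ts tt) e e0; exists d => // r sr rt2 rt.
    by rewrite !wv//; apply: dP; [exact: inv|rewrite opprB addrA subrK].
  have [ts|st|ts] := ltgtP t s.
  - have [d d0 dP] := left (ltW ts); exists (Num.min d (s - t)).
      by rewrite lt_min d0 subr_gt0.
    move=> r /andP[r0 _]; rewrite lt_min => /andP[rd]; rewrite ltr_norml => /andP[_ rs].
    by apply: dP => //; lra.
  - have [d d0 dP] := right (ltW st); exists (Num.min d (t - s)).
      by rewrite lt_min d0 subr_gt0.
    move=> r /andP[_ rt2]; rewrite lt_min => /andP[rd]; rewrite ltr_norml => /andP[rs _].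
    by apply: dP => //; lra.
  - have ts1 : t <= s by rewrite ts.
    have ts2 : s <= t by rewrite ts.
    have [d d0 dP] := left ts1; have [d' d'0 dP'] := right ts2.
    exists (Num.min d d'); first by rewrite lt_min d0.
    move=> r /andP[r0 rt2]; rewrite lt_min => /andP[rd rd'].
    by have [rs|/ltW rs] := leP r s; [exact: dP|exact: dP'].
have Ow t : 0 <= t < s + t2 -> OW M (w t).
  move=> /andP[t0 tt]; have [ts|/ltW ts] := leP t s.
    by rewrite wu//; exact/Ou/inu.
  by rewrite wv//; exact/Ov/inv.
exists w; first by rewrite wu.
split => //.
- have cwt t : 0 < t < s + t2 -> {for t, continuous w} by exact: half_open_continuous.
  move=> l dl; pose F r := l (jWX (w r)).
  have dl_left t : 0 < t -> t < s -> is_derive t 1 (F : R -> R^o) (rate l (w t)).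
    move=> t0 ts; have st0 : 0 < s - t by rewrite subr_gt0.
    rewrite wu ?(ltW ts)//; have := du l dl t; rewrite t0 (lt_trans ts st1) => /(_ isT).
    apply: is_derive_local st0 _ => x; rewrite ltr_norml => /andP[_ xs].
    by rewrite /F wu//; lra.
  have dl_right t : s < t -> t < s + t2 -> is_derive t 1 (F : R -> R^o) (rate l (w t)).
    move=> ts tt; have st0 : 0 < t - s by rewrite subr_gt0.
    rewrite wv ?(ltW ts)//; have tI : 0 < t - s < t2 by apply/andP; split; lra.
    have := dv l dl _ tI; rewrite (addrC t) => /is_derive_shift_arg.
    apply: is_derive_local st0 _ => x; rewrite ltr_norml => /andP[xs _].
    by rewrite /F wv ?(addrC x)//; lra.
  move=> t tt; have /andP[t0 tt2] := tt.
  have [ts|st|ts] := ltgtP t s; [exact: dl_left|exact: dl_right|].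
  have r0 : 0 < Num.min t (s + t2 - t) by rewrite lt_min t0 subr_gt0.
  apply: (is_derive_removable (g := fun r => rate l (w r)) r0).
  + move=> x /andP[]; rewrite normr_gt0 subr_eq0 lt_min !ltr_norml => xt.
    move=> /andP[/andP[x1 x2] /andP[x3 x4]].
    have [xs|xs|xs] := ltgtP x s; [apply: dl_left => //; lra|apply: dl_right => //; lra|].
    by move: xt; rewrite xs ts eqxx.
  + apply: (continuous_comp (f := w) (g := fun z => l (jWX z))); first exact: cwt.
    by apply: continuous_comp; [exact: jWX_continuous|exact: blin_continuous].
  + apply: (continuous_comp (f := w) (g := rate l)); first exact: cwt.
    by apply: rate_continuous; apply: Ow; rewrite (ltW t0).
- move=> t /andP[t0 tt]; rewrite (wu 0)//; have [ts|/ltW ts] := leP t s.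
    by rewrite wu//; exact/cEu/inu.
  by rewrite wv// cEv ?inv// vs; exact/cEu/inu.
- move=> t /andP[t0 tt]; rewrite (wu 0)//; have [ts|/ltW ts] := leP t s.
    by rewrite wu//; exact/cPu/inu.
  by rewrite wv// cPv ?inv// vs; exact/cPu/inu.
Qed.

(** * A direction of negative energy *)

(** The group is only affine: [T(s) (a u + v) = a T(s) u + T(s) v - a T(s) 0], so
    that the differentiability of [T(s) 0] enters. *)
Lemma generator_TW_linear (a : R) b1 b2 : dom (generator TW) b1 -> dom (generator TW) b2 ->
  dom (generator TW) (a *: b1 + b2).
Proof.
move=> d1 d2; have e1 := generator_is_derive (TW_0 b1) d1.
have e2 := generator_is_derive (TW_0 b2) d2.
have [dT0 _] := A4_v_C3 h4.
have e0 : is_derive (0 : R) 1 (fun s => TW s 0) ('D_1 (fun s => TW s 0) 0).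
  by apply: derivableP; apply/derivable1_diffP; exact: dT0.
have dl := is_deriveD (is_deriveD (is_deriveZ a e1) e2) (is_deriveZ (- a) e0).
suff e : is_derive (0 : R) 1 (fun s => TW s (a *: b1 + b2))
    (a *: generator TW b1 + generator TW b2 + (- a) *: 'D_1 (fun s => TW s 0) 0).
  by have [] := is_derive_generator (TW_0 _) e.
have -> : (fun s => TW s (a *: b1 + b2)) =
   (a *: (TW^~ b1) + (TW^~ b2)) + (- a) *: (TW^~ 0) :> (R -> W).
  apply/funext => s; rewrite [RHS]/(a *: TW s b1 + TW s b2 + (- a) *: TW s 0).
  apply: jWX_inj; rewrite !jWXD !jWXZ !(A4_i_W h4) !jWXD !jWXZ jWX0.
  rewrite (T_dT s (_ + _)) (T_dT s (jWX b1)) (T_dT s (jWX b2)) dTP.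
  move: (dT s (jWX b1)) (dT s (jWX b2)) (T s 0) => p q r.
  by rewrite scalerDr scaleNr [RHS]addrAC addrK addrA.
exact: dl.
Qed.

Lemma regular_linear (a : R) x1 b1 x2 b2 : regular x1 b1 -> regular x2 b2 ->
  regular (a *: x1 + x2) (a *: b1 + b2).
Proof.
move=> [[_ d1] g1 e1] [[_ d2] g2 e2]; have [[[_ lin] _] _ _ _ _] := h2.
have [dl el] := lin a _ _ d1 d2; split.
- by split => //; rewrite /= riesz_linear.
- exact: generator_TW_linear.
- rewrite jWXD jWXZ e1 e2 -[RHS]/(s_Jhat M (riesz (a *: x1 + x2))) riesz_linear.
  exact/esym.
Qed.

(** The dense set of the range of [Jhat], transported by the bijection [B u]. *)
Lemma dense_regular u : OV M u ->
  dense [set z | exists x b, regular x b /\ z = B u (jWX b)].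
Proof.
move=> Ou Y [y Yy] oY; have [_ _ bij _ _] := h2; have [inv BK KB] := bij _ Ou.
have oY' : open (B u @^-1` Y).
  by apply: open_comp oY => x _; exact: blin_continuous.
have Y'0 : (B u @^-1` Y) !=set0 by exists (inv y); rewrite /= KB.
have [x [Yx [[b db bx] [w dw wx]]]] := A4_viii h4 Y'0 oY'.
have [q qw] := riesz_representation w.
exists (B u (jWX b)); split; first by rewrite bx.
exists q, b; split => //; split => //.
  by split => //=; rewrite qw.
by rewrite bx -[RHS]/(s_Jhat M (riesz q)) qw.
Qed.

(** [A psi] represents the functional [l], so that
    [z1 = chi - l(chi) / l(psi) psi] lies in the kernel of [l] and is negative for
    the form of [A]; it is then approximated inside that kernel by images of
    regular elements. *)
Lemma negative_direction (A : blin X X) (l : dual X) (psi chi : X) u : OV M u ->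
  self_adjoint A -> (forall x, inner (A psi) x = l x) -> 0 < (l psi : R) ->
  inner (A chi) chi < 0 ->
  exists y b, [/\ regular y b, l (B u (jWX b)) = 0 &
    inner (A (B u (jWX b))) (B u (jWX b)) < 0].
Proof.
move=> Ou sA Apsi lpsi neg; have dS := dense_regular Ou.
have cl : {for psi, continuous l} by exact: blin_continuous.
have /continuous_epsP/(_ _ lpsi)[r r0 rP] := cl.
have [z0 [[y0 [b0 [reg0 z0E]]] _ /rP z0psi]] := dense_approx dS openT (I : setT psi) r0.
have l0 : l z0 != 0 :> R.
  by apply/eqP => l0; move: z0psi; rewrite l0 sub0r normrN gtr0_norm// ltxx.
pose k z : R := - (l z / l z0).
pose F z : X := k z *: z0 + z.
have lF z : l (F z) = 0.
  by rewrite /F blinD blinZ -[_ *: l z0]/(k z * l z0) /k mulNr divfK// addNr.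
pose Phi z : R := inner (A (F z)) (F z).
pose z1 := chi - (l chi / l psi) *: psi.
have lz1 : l z1 = 0.
  by rewrite /z1 blinB blinZ -[_ *: l psi]/(l chi / l psi * l psi) divfK ?subrr// gt_eqF.
have Fz1 : F z1 = z1 by rewrite /F /k lz1 mul0r oppr0 scale0r add0r.
have Phi1 : Phi z1 < 0.
  rewrite /Phi Fz1 /z1 blinB blinZ !innerE (sA chi psi) (innerC chi) !Apsi.
  rewrite [ltLHS](_ : _ = inner (A chi) chi - l chi ^+ 2 / l psi); last first.
    by field; rewrite gt_eqF.
  by apply: le_lt_trans neg; rewrite gerBl divr_ge0 ?sqr_ge0// ltW.
have cF : {for z1, continuous F}.
  apply: cvgD; last exact: cvg_id.
  apply: cvgZ; last exact: cvg_cst.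
  by apply: cvgN; apply: cvgMr_tmp; exact: blin_continuous.
have cPhi : {for z1, continuous (Phi : X -> R^o)}.
  apply: cvg_inner; last exact: cF.
  by apply: (continuous_comp (f := F) (g := A)); [exact: cF|exact: blin_continuous].
have nPhi1 : 0 < - Phi z1 by rewrite oppr_gt0.
have /continuous_epsP/(_ _ nPhi1)[d d0 dP] := cPhi.
have [z [[y [b [reg zE]]] _ /dP zz1]] := dense_approx dS openT (I : setT z1) d0.
exists (k z *: y0 + y), (k z *: b0 + b).
have Fz : B u (jWX (k z *: b0 + b)) = F z.
  by rewrite jWXD jWXZ blinD blinZ -z0E -zE.
split; [exact: regular_linear|by rewrite Fz; exact: lF|rewrite Fz -/(Phi z)].
have := ler_norm (Phi z - Phi z1); lra.
Qed.

(** * The bound state *)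

Section BoundState.
Context (c : R) (hc : s_speeds M c).
Local Notation Uc := (s_U M c).
Local Notation x0 := (generator T (jWX Uc)).

Lemma bound_state : [/\ OW M Uc, solution_on M setT (fun t => TW (c * t) Uc),
  dom (generator TW) Uc, exists b0, regular x0 b0 & x0 <> 0].
Proof.
have [_ _ _ _ /(_ c hc)[OU [_ sol] [_ [dx dJ]] [dW [w dw wE]] [x0n _]]] := h5.
by split => //; exists w.
Qed.

Lemma OVc : OV M (jW Uc).
Proof. by have [OU _ _ _ _] := bound_state. Qed.

Lemma generator_bound_state : dom (s_Jhat M) (gradP (jW Uc)) /\
  x0 = J M (jW Uc) (gradP (jW Uc)).
Proof.
have [_ _ dW _ _] := bound_state.
have dV : dom (generator TV) (jW Uc).
  have d := generator_is_derive (TW_0 Uc) dW.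
  have [] := @is_derive_generator _ _ TV (jW Uc) (jW (generator TW Uc)) (TV_0 _) _ => //.
  have -> : (fun s => TV s (jW Uc)) = (fun s => jW (TW s Uc)).
    by apply/funext => s; rewrite jW_TW.
  exact: is_derive_blin.
exact: (A4_vii_P h4 dV OVc).
Qed.

Lemma dense_range_Jhat : dense (range_op (s_Jhat M)).
Proof.
move=> Y Y0 oY; have [x [Yx [_ Rx]]] := A4_viii h4 Y0 oY.
by exists x.
Qed.

(** The weak equation for [t |-> T(c t) Uc] at [t = 0] says that
    [gradE - c gradP] vanishes on the range of [J(Uc)], which is dense. *)
Lemma critical_point x : gradE (jW Uc) x = c * gradP (jW Uc) x.
Proof.
have [_ sol dW _ _] := bound_state; have [dJP x0E] := generator_bound_state.
have [_ _ bij _ skew] := h2.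
have onJ w : dom (s_Jhat M) w ->
    gradE (jW Uc) (J M (jW Uc) w) = c * gradP (jW Uc) (J M (jW Uc) w).
  move=> dw; have T0 : (setT : set R)° 0 by rewrite interiorT.
  have := solution_is_derive sol dw T0.
  rewrite mulr0 TW_0 => d1.
  have d2 : is_derive (0 : R) 1 (fun t => w (T (c * t) (jWX Uc)) : R^o) (w x0 * c).
    have dT0 := generator_is_derive (A4_ii_0 h4 (jWX Uc)) (generator_jWX dW).
    have dw0 : is_derive (c * 0) 1 (fun t => w (T t (jWX Uc)) : R^o) (w x0).
      by rewrite mulr0; exact: is_derive_blin.
    have dc : is_derive (0 : R) 1 (fun t : R => c * t) c.
      by have := is_derive_affine c 0 0; under eq_fun do rewrite addr0.
    exact: (@is_derive1_comp R (fun t => w (T t (jWX Uc))) (fun t => c * t) 0).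
  have fE : (fun r : R => w (jWX (TW (c * r) Uc)) : R^o) = (fun t => w (T (c * t) (jWX Uc))).
    by apply/funext => r; rewrite (A4_i_W h4).
  rewrite fE in d1; have := is_derive_unique d1 d2.
  rewrite x0E (skew _ OVc _ _ dJP dw); set p := gradE _ _; set q := gradP _ _ => pq.
  have -> : p = - (- p) by rewrite opprK.
  by rewrite pq; ring.
have [invB BK KB] := bij _ OVc.
rewrite -(KB x); set y := invB x.
pose f : dual X := blin_comp (gradE (jW Uc)) (B (jW Uc)).
pose g : dual X := c *: blin_comp (gradP (jW Uc)) (B (jW Uc)).
suff fg : f y = g y by exact: fg.
have cont (h : dual X) : forall x', setT x' -> {for x', continuous h}.
  by move=> x' _; exact: blin_continuous.
apply: (dense_continuous_eq dense_range_Jhat openT (cont f) (cont g) _ (I : setT y)).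
by move=> _ [w dw <-] _; exact: onJ.
Qed.

Lemma augE_Ck k : Ck 3 (OV M) (augE M k).
Proof.
have [cE cP _ _ _] := h3.
exact: (@CkB _ 3 V R^o (OV M) E P k openOV cE cP).
Qed.

Lemma frechet_augE k u v : OV M u ->
  frechet (augE M k) u v = gradE u (jV v) - k * gradP u (jV v).
Proof.
move=> Ou; have [[dE _] [dP _] _ _ grad] := h3.
have [_ ->] := @frechetB _ V R^o E P k u (dE _ Ou) (dP _ Ou).
by rewrite (grad _ Ou v).1 (grad _ Ou v).2.
Qed.

Lemma frechet_augE_bound_state v : frechet (augE M c) (jW Uc) v = 0.
Proof. by rewrite (frechet_augE _ _ OVc) critical_point subrr. Qed.

End BoundState.

Section Moment.
Context (c : R) (hc : s_speeds M c).
Local Notation Uc := (s_U M c).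
Local Notation x0 := (generator T (jWX Uc)).

Definition speed_derivative : W := frechet (U : R^o -> W) c 1.
Local Notation U' := speed_derivative.

Lemma U_is_derive t : s_speeds M t -> is_derive t 1 U (frechet (U : R^o -> W) t 1).
Proof.
move=> st; have [_ _ _ [dU _] _] := h5; have dUt := dU _ st.
rewrite frechetE//.
have d : derivable U t 1 by exact/derivable1_diffP.
by apply: DeriveDef => //; rewrite -derive1E derive1E'.
Qed.

Lemma speeds_radius t : s_speeds M t ->
  exists2 r : R, 0 < r & forall s, `|s - t| < r -> s_speeds M s.
Proof.
by move=> st; have [_ oS _ _ _] := h5; exact: (@open_radius _ R^o (s_speeds M) t oS st).
Qed.

(** [U_t] is a critical point of [E - t P], so that only the explicit dependence
    on [t] contributes. *)
Lemma moment_derive t : s_speeds M t -> is_derive t 1 (moment M) (- P (jW (U t))).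
Proof.
move=> st; have [[dE _] [dP _] _ _ grad] := h3.
have Ot := OVc st; have dU := is_derive_blin jW (U_is_derive st).
have d1 := is_derive_frechet_comp dU (dE _ Ot).
have d2 := is_derive_frechet_comp dU (dP _ Ot).
set u' := frechet U t 1 in dU d1 d2.
have d3 := is_deriveM (is_derive_id t (1 : R)) d2.
have := is_deriveB d1 d3.
rewrite -(grad _ Ot _).1 -(grad _ Ot _).2 (critical_point st).
congr (is_derive _ _ _ _).
rewrite -[_ *: gradP _ _]/(t * gradP (jW (U t)) (jV (jW u'))) opprD addrA subrr add0r.
by rewrite [_%:A]mulr1.
Qed.

Lemma moment_second_derivative :
  derive1n 2 (moment M) c = - gradP (jW Uc) (jWX U').
Proof.
have [[dE _] [dP _] _ _ grad] := h3; have Oc := OVc hc.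
have [r r0 rS] := speeds_radius hc.
have dU := is_derive_blin jW (U_is_derive hc).
have d2 := is_derive_frechet_comp dU (dP _ Oc).
rewrite -(grad _ Oc _).2 in d2.
have d3 : is_derive c 1 (fun t => - P (jW (U t)) : R^o) (- gradP (jW Uc) (jWX U')).
  exact: is_deriveN.
have : is_derive c 1 (derive1 (moment M)) (- gradP (jW Uc) (jWX U')).
  apply: is_derive_local r0 _ d3 => t /rS st.
  by rewrite derive1E; have [_ ->] := moment_derive st.
by rewrite derive1nS derive1n1 derive1E => -[_ ->].
Qed.

(** Differentiating [DE(U_t) = t DP(U_t)] in the speed [t]. *)
Lemma hessian_speed_derivative z :
  frechet (frechet (augE M c)) (jW Uc) (jW U') z = gradP (jW Uc) (jV z).
Proof.
have [_ [dP [dP1 _]] _ _ grad] := h3; have Oc := OVc hc.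
have [r r0 rS] := speeds_radius hc.
have dU := is_derive_blin jW (U_is_derive hc).
have [_ [dA1 _]] := augE_Ck c.
have d1 := is_derive_blin_eval z (is_derive_frechet_comp dU (dA1 _ Oc)).
have cP : {for c, continuous (fun t => frechet P (jW (U t)) z)}.
  have d := is_derive_frechet_comp dU (dP1 _ Oc).
  exact: is_derive_continuous (is_derive_blin_eval z d).
have d2 : is_derive c 1 (fun t => (t - c) * frechet P (jW (U t)) z : R^o)
    (gradP (jW Uc) (jV z)).
  rewrite (grad _ Oc _).2; apply/is_derive_epsP => e e0.
  have /continuous_epsP/(_ _ e0)[d d0 dPz] := cP; exists d => // h /andP[h0 hd].
  have -> : (c + h - c) * frechet P (jW (U (c + h))) z - (c - c) * frechet P (jW (U c)) z
     - h *: frechet P (jW (U c)) z = h * (frechet P (jW (U (c + h))) z - frechet P (jW (U c)) z).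
    by rewrite -[h *: _]/(h * frechet P (jW (U c)) z); ring.
  rewrite normrM mulrC ler_wpM2r// ltW// dPz//.
  by rewrite addrAC subrr add0r.
apply: is_derive_unique d1 _; apply: is_derive_local r0 _ d2 => t /rS st.
have Ot := OVc st.
have e : (t - c) * frechet P (jW (U t)) z = frechet (augE M c) (jW (U t)) z :> R.
  rewrite (frechet_augE _ _ Ot) (critical_point st).
  by rewrite (grad _ Ot _).2; ring.
exact: e.
Qed.

End Moment.

Section Instability.
Context (c : R) (hc : s_speeds M c).
Local Notation Uc := (s_U M c).
Local Notation x0 := (generator T (jWX Uc)).

Local Notation augE := (augE M c).

(** * Frames transversal to the orbit *)

Lemma jWX_bound : exists2 k : R, 0 < k & forall u, `|jWX u| <= k * `|u|.
Proof.
exists (`|embWX| + 1); first by rewrite ltr_wpDl.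
by move=> u; apply: le_trans (blin_le embWX u) _; rewrite ler_wpM2r// lerDl.
Qed.

(** For [(x, b)] regular, [- momentum_rate b u] is the derivative of the pairing
    with [x] along the group through [u]. *)
Definition momentum_rate (b u : W) : R := gradP (jW u) (B (jW u) (jWX b)).

Lemma momentum_rate_continuous (b : W) (e : R) : 0 < e -> exists2 d : R, 0 < d &
  forall v : W, `|v| < d -> `|momentum_rate b (Uc + v) - momentum_rate b Uc| < e.
Proof.
move=> e0; have [_ _ _ cP _] := h3.
have OUc : OW M Uc by have [] := bound_state hc.
have cm : {for Uc, continuous (momentum_rate b : W -> R^o)}.
  apply: (continuous_comp (f := jW) (g := fun v => gradP v (B v (jWX b)))).
    exact: blin_continuous.
  by apply: gradB_continuous; [exact: cP|exact: OUc].
have /continuous_epsP/(_ _ e0)[d d0 dP] := cm.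
by exists d => // v vd; apply: dP; rewrite addrAC subrr add0r.
Qed.

Lemma tube_translate nu u : tube M c nu u -> exists s, `|TW s u - Uc| < nu.
Proof.
move=> [_ infnu]; apply: contrapT => none; move: infnu; apply/negP; rewrite -leNgt.
apply: lb_le_inf; first by exists `|u - TW 0 Uc|, 0.
move=> _ [s _ <-]; rewrite leNgt; apply/negP => su; apply: none; exists (- s).
have -> : Uc = TW (- s) (TW s Uc) by rewrite -TWD addNr TW_0.
by rewrite TW_isometry.
Qed.

Lemma near_tube nu u : OW M u -> `|u - Uc| < nu -> tube M c nu u.
Proof.
move=> Ou uU; split => //; apply: le_lt_trans uU; apply: ge_inf.
  by exists 0 => _ [s _ <-].
by exists 0; rewrite // TW_0.
Qed.

Let dist (s : R) : R := `|T s (jWX Uc) - jWX Uc|.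

Let dist_continuous : continuous dist.
Proof.
move=> s; apply: cvg_norm; apply: cvgB; last exact: cvg_cst.
exact: (A4_iv_X h4).
Qed.

Let stabilizer : set R := [set q | T q (jWX Uc) = jWX Uc].

Let dist_shift s q : stabilizer q -> dist (s - q) = dist s.
Proof.
by move=> qs; rewrite /dist -{1}qs -(A4_ii_D h4) subrK.
Qed.

(** In the periodic case translate by a multiple of the period; otherwise the lower
    limit at infinity keeps the orbit away from its base point at large times. *)
Lemma orbit_return_bounded : exists e S : R, [/\ 0 < e, 0 <= S &
  forall s, dist s < e -> exists2 q, stabilizer q & `|s - q| <= S].
Proof.
have [_ _ _ _ /(_ c hc)[_ _ _ _ [_ [[p p0 per]|lim]]]] := h5.
  exists 1, p; split => //; first exact: ltW.
  move=> s _.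
  have mult n : stabilizer (p *+ n) /\ stabilizer (- (p *+ n)).
    have h a : T (a + p *+ n) (jWX Uc) = T a (jWX Uc) by exact: (periodicn per).
    by split; rewrite /stabilizer/=; [rewrite -[p *+ n]add0r h|rewrite -h addNr]; exact: (A4_ii_0 h4).
  pose n := Num.truncn (`|s| / p).
  have /truncn_itv/andP[n1 n2] : 0 <= `|s| / p by rewrite divr_ge0// ltW.
  rewrite -/n ler_pdivlMr// in n1; rewrite -/n ltr_pdivrMr// in n2.
  rewrite mulr_natl in n1; rewrite mulr_natl mulrS in n2.
  have [s0|s0] := leP 0 s.
    exists (p *+ n); first exact: (mult n).1.
    by rewrite ger0_norm// in n1 n2; rewrite ger0_norm ?subr_ge0//; lra.
  exists (- (p *+ n)); first exact: (mult n).2.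
  by rewrite ltr0_norm// in n1 n2; rewrite ler0_norm; lra.
rewrite limf_einfE in lim; have [_ [A [[M1 [_ A1]] [M2 [_ A2]]] <-] infA] := ereal_sup_gt lim.
have [e e0 eA] : exists2 e : R, 0 < e & forall s, A s -> e <= dist s.
  have lb s : A s -> (ereal_inf [set (dist s)%:E | s in A] <= (dist s)%:E)%E.
    by move=> As; apply: ereal_inf_lbound; exists s.
  move: infA lb; case: (ereal_inf _) => [r| |] //.
    by rewrite lte_fin => r0 lb; exists r => // s /lb; rewrite lee_fin.
  by move=> _ lb; exists 1 => // s /lb.
exists e, (`|M1| + `|M2|); split => //.
move=> s se; exists 0; first exact: (A4_ii_0 h4).
have nA : ~ A s by move=> /eA; rewrite leNgt se.
rewrite subr0 ler_norml.
have h1' : s <= M1 by rewrite leNgt; apply/negP => /A1.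
have h2' : M2 <= s by rewrite leNgt; apply/negP => /A2.
have := ler_norm M1; have := ler_norm (- M2); rewrite normrN.
have := normr_ge0 M1; have := normr_ge0 M2; move=> *; apply/andP; split; lra.
Qed.

(** Compactness on a bounded interval, to which the previous lemma reduces every
    time modulo the stabilizer. *)
Lemma orbit_return (d : R) : 0 < d -> exists2 e : R, 0 < e &
  forall s, dist s < e -> exists2 q, stabilizer q & `|s - q| < d.
Proof.
move=> d0; have [e [S [e0 S0 eS]]] := orbit_return_bounded.
pose K := `[- S, S] `&` \bigcap_(q in stabilizer) [set r | d <= `|r - q|].
have cK : compact K.
  apply: (subclosed_compact _ (@segment_compact _ (- S) S)); last by move=> x [].
  apply: closedI; first exact: interval_closed.
  apply: closed_bigI => q _.
  have -> : [set r | d <= `|r - q|] = (fun r => `|r - q|) @^-1` [set x | d <= x] by [].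
  apply: closed_comp; last exact: closed_ge.
  move=> r _; apply: cvg_norm; apply: cvgB; [exact: cvg_id|exact: cvg_cst].
have [e1 e10 e1K] : exists2 e1 : R, 0 < e1 & forall r, K r -> e1 <= dist r.
  have [K0|K0] := pselect (K !=set0); last by exists 1 => // r Kr; case: K0; exists r.
  have cd : {within K, continuous dist} by exact: continuous_subspaceT.
  have [r /set_mem Kr rmin] := compact_EVT_min K0 cK cd.
  exists (dist r); last by move=> t Kt; apply: rmin; exact: mem_set.
  rewrite lt_def normr_ge0 andbT; apply/eqP => /normr0_eq0/subr0_eq rs.
  by have [_ /(_ r rs)] := Kr; rewrite /= subrr normr0 leNgt d0.
exists (Num.min e e1); first by rewrite lt_min e0.
move=> s; rewrite lt_min => /andP[se se1].
have [q qs sq] := eS _ se.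
have : ~ K (s - q) by move=> /e1K; rewrite dist_shift// leNgt se1.
move=> nK; have [q' qs' sq'] : exists2 q', stabilizer q' & `|s - q - q'| < d.
  apply: contrapT => none; apply: nK; split.
    by rewrite /= in_itv/= -ler_norml.
  by move=> q' qs' /=; rewrite leNgt; apply/negP => h; apply: none; exists q'.
exists (q' + q); last by rewrite (addrC q') opprD addrA.
by rewrite /stabilizer/= (A4_ii_D h4) qs.
Qed.

Lemma stabilizerW q : stabilizer q -> TW q Uc = Uc.
Proof. by move=> qs; apply: jWX_inj; rewrite (A4_i_W h4). Qed.

(** The skewness of [J], applied to [x0 = J gradP]. *)
Lemma momentum_rate_bound_state b0 : regular x0 b0 ->
  momentum_rate b0 Uc = - `|x0| ^+ 2.
Proof.
move=> [[_ d0] _ bE]; have [dJP x0E] := generator_bound_state hc.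
have [_ _ _ _ skew] := h2; have := skew _ (OVc hc) _ _ dJP d0.
rewrite -x0E -[riesz x0 x0]/(inner x0 x0) inner_norm => ->.
by rewrite opprK /momentum_rate bE.
Qed.

Definition phase (u : W) (s : R) : R := inner x0 (T s (jWX u) - jWX Uc).

Lemma phase_derive b0 u (s : R) : regular x0 b0 -> OW M u ->
  is_derive s 1 (phase u) (- momentum_rate b0 (TW s u)).
Proof.
move=> reg Ou; have := is_derive_inner_T s reg (OW_OV Ou).
rewrite -jW_TW => d.
have -> : phase u = (fun r => inner x0 (T r (jV (jW u)))) - cst (inner x0 (jWX Uc)).
  by apply/funext => r; rewrite /phase innerBr.
by rewrite -[X in is_derive _ _ _ X]subr0; apply: is_deriveB.
Qed.

(** Along the translates of a state near the orbit the phase has a slope close to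
    [|x0|^2], so that it vanishes nearby.  The last clause is what keeps the
    translations continuous in time, although the stabilizer of [Uc] may be
    nontrivial and need not act trivially on neighbouring states. *)
Lemma slice : exists nu1 : R, 0 < nu1 /\ forall nu2 : R, 0 < nu2 < nu1 ->
  exists2 nu0 : R, 0 < nu0 & forall u, tube M c nu0 u ->
  forall s, `|TW s u - Uc| < 2 * nu2 ->
  exists s1, [/\ phase u s1 = 0, `|TW s1 u - Uc| < nu2 &
    `|s1 - s| <= 2 / `|x0| ^+ 2 * `|phase u s|].
Proof.
have [_ _ _ [b0 reg] x0n] := bound_state hc.
have [k k0 kP] := jWX_bound.
pose p := `|x0| ^+ 2; have p0 : 0 < p by rewrite exprn_gt0// normr_gt0; exact/eqP.
have p20 : 0 < p / 2 by rewrite divr_gt0.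
have [r1 r10 r1P] := momentum_rate_continuous b0 p20.
have slope u s : `|TW s u - Uc| < r1 -> p / 2 <= - momentum_rate b0 (TW s u).
  move=> /r1P; rewrite (addrC Uc) subrK momentum_rate_bound_state// -/p.
  by rewrite ltr_norml => /andP[_]; lra.
have cU : {for 0, continuous (fun s => TW s Uc)} by exact: (A4_iv_W h4).
have nearU (e : R) : 0 < e -> exists2 d : R, 0 < d & forall r, `|r| < d -> `|TW r Uc - Uc| < e.
  move=> e0; have /continuous_epsP/(_ _ e0)[d d0 dP] := cU.
  by exists d => // r rd; have := dP r; rewrite subr0 TW_0; exact.
have r120 : 0 < r1 / 2 by rewrite divr_gt0.
have [d0 d00 d0P] := nearU _ r120.
have [e e0 eP] := orbit_return d00.
have k3 : 0 < 3 * k by rewrite mulr_gt0.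
exists (e / (3 * k)); split; first by rewrite divr_gt0.
move=> nu2 /andP[nu20]; rewrite ltr_pdivlMr// => nu2e.
have nu22 : 0 < nu2 / 2 by rewrite divr_gt0.
have [d1 d10 d1P] := nearU _ nu22.
pose m := Num.min d0 d1; have m0 : 0 < m by rewrite lt_min d00.
have q0 : 0 < `|x0| * k * (2 / p) by apply: mulr_gt0; [apply: mulr_gt0; rewrite // normr_gt0; exact/eqP|rewrite divr_gt0].
pose nu0 := Num.min (nu2 / 2) (Num.min (r1 / 2) (m / (`|x0| * k * (2 / p)))).
exists nu0; first by rewrite !lt_min nu22 r120 divr_gt0.
move=> u tu s su; have Ou : OW M u by have [] := tu.
have [s' s'u] := tube_translate tu.
move: s'u; rewrite /nu0 !lt_min => /andP[u1 /andP[u2 u3]].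
have [q qs sq] : exists2 q, stabilizer q & `|(s - s') - q| < d0.
  apply: eP; rewrite /dist -(A4_i_W h4) -jWXB.
  apply: le_lt_trans (kP _) _; apply: lt_trans nu2e.
  have : `|TW (s - s') Uc - Uc| < 3 * nu2.
    have h : `|TW s u - TW (s - s') Uc| < nu2 / 2.
      have -> : TW s u = TW (s - s') (TW s' u) by rewrite -TWD subrK.
      by rewrite TW_isometry.
    have := ler_normD (TW (s - s') Uc - TW s u) (TW s u - Uc).
    rewrite addrA subrK distrC; rewrite distrC in h; lra.
  move=> h; rewrite [ltRHS](_ : _ = k * (3 * nu2)); last by ring.
  by rewrite (ltr_pM2l k0).
pose o := s' + q.
have ou : `|TW o u - Uc| = `|TW s' u - Uc|.
  rewrite /o (addrC s') TWD.
  by rewrite -{1}(stabilizerW qs) TW_isometry.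
have window r : `|r| < d0 -> `|TW (o + r) u - Uc| < r1.
  move=> rd; rewrite (addrC o) TWD.
  have h : `|TW r (TW o u) - TW r Uc| < r1 / 2 by rewrite TW_isometry ou.
  have := ler_normD (TW r (TW o u) - TW r Uc) (TW r Uc - Uc).
  by rewrite addrA subrK; have := d0P _ rd; lra.
pose f r := phase u (o + r).
have df (r : R) : is_derive r 1 f (- momentum_rate b0 (TW (o + r) u)).
  by apply: is_derive_shift_arg; exact: phase_derive.
have small : `|f 0| / (p / 2) < m.
  have : `|f 0| <= `|x0| * k * `|TW s' u - Uc|.
    rewrite /f addr0 /phase; apply: le_trans (cauchy_schwarz _ _) _.
    rewrite -mulrA ler_wpM2l// -ou -(A4_i_W h4) -jWXB; exact: kP.
  move: u3; rewrite ltr_pdivlMr// => u3 f0; apply: le_lt_trans u3.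
  apply: (@le_trans _ _ (`|x0| * k * `|TW s' u - Uc| * (2 / p))).
    by rewrite invf_div ler_wpM2r// divr_ge0// ltW.
  by rewrite le_eqVlt; apply/orP; left; apply/eqP; ring.
have [small0 small1] : `|f 0| / (p / 2) < d0 /\ `|f 0| / (p / 2) < d1.
  by move: small; rewrite lt_min => /andP[].
have [r [rd fr rt]] := steep_zero p20 (fun x _ => df x) (fun x xd => slope _ _ (window x xd)) small0.
exists (o + r); split.
- exact: fr.
- rewrite (addrC o) TWD -(subrK (TW r Uc) (TW r (TW o u))) -addrA.
  apply: le_lt_trans (ler_normD _ _) _; rewrite TW_isometry ou [ltRHS](splitr nu2) ltrD//.
  exact: d1P (le_lt_trans rd small1).
have td : `|s - o| < d0 by rewrite /o opprD addrA.
have := rt _ td; rewrite /f (addrC o) subrK invf_div mulrC.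
by have -> : o + r - s = r - (s - o) by ring.
Qed.

(** * Expansions at the bound state *)

(** Consequences of the interpolation inequality that do not mention the
    exponent: the [V]-norm remainders of the Taylor expansions are dominated by
    the [X]-norm, up to a factor that is small with the [W]-norm. *)
Lemma interpolation : exists2 C : R, 0 < C & forall u,
  `|jW u| ^+ 3 <= C * `|jWX u| ^+ 2 * `|u| /\ `|jW u| ^+ 2 <= C * `|jWX u| * `|u|.
Proof.
have [theta [C [/andP[th0 th1] C0 hC]]] := h1.
have [k k0 kP] := jWX_bound.
have kth : 0 < k `^ theta by rewrite powR_gt0.
pose C1 := C * k `^ theta; have C10 : 0 < C1 by rewrite mulr_gt0.
pose kV := `|jV| + 1; have kV0 : 0 < kV by rewrite ltr_wpDl.
have jVk v : `|jV v| <= kV * `|v|.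
  by apply: le_trans (blin_le _ _) _; rewrite ler_wpM2r// lerDl.
exists (C1 * (1 + kV)); first by rewrite mulr_gt0// addr_gt0.
move=> u; set n := `|jW u|; set x := `|jWX u|; set w := `|u|.
have n0 : 0 <= n := normr_ge0 _; have x0 : 0 <= x := normr_ge0 _.
have w0 : 0 <= w := normr_ge0 _.
have cube : n ^+ 3 <= C1 * x ^+ 2 * w.
  apply: le_trans (hC u) _; rewrite -/x -/w.
  have [->|xn0] := eqVneq x 0.
    by rewrite powR0 ?gt_eqF ?mulr0 ?mul0r ?expr0n ?mulr0 ?mul0r// addr_gt0.
  have xp : 0 < x by rewrite lt_def xn0.
  have wp : 0 < w.
    by have := lt_le_trans xp (kP u); rewrite -/w pmulr_rgt0.
  rewrite powRD ?xn0 ?implybT// powR_mulrn//.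
  have h : x `^ theta <= k `^ theta * w `^ theta.
    rewrite -powRM// ?(ltW k0)//; apply: ge0_ler_powR; rewrite ?nnegrE ?(ltW th0)//.
      by rewrite mulr_ge0// ltW.
    exact: kP.
  have wE : w `^ theta * w `^ (1 - theta) = w.
    by rewrite -powRD ?(gt_eqF wp) ?implybT// addrC subrK powRr1.
  rewrite -[in leRHS]wE /C1.
  rewrite [leLHS](_ : _ = C * x ^+ 2 * (x `^ theta * w `^ (1 - theta))); last by ring.
  rewrite [leRHS](_ : _ = C * x ^+ 2 * (k `^ theta * w `^ theta * w `^ (1 - theta)));
    last by ring.
  by rewrite ler_wpM2l ?mulr_ge0 ?sqr_ge0 ?(ltW C0)// ler_wpM2r ?powR_ge0.
have kn : x <= kV * n by exact: jVk.
split.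
  apply: le_trans cube _; rewrite ler_wpM2r// ler_wpM2r ?sqr_ge0//.
  by rewrite ler_peMr ?(ltW C10)// lerDl ltW.
have [xz|xn0] := eqVneq x 0.
  have : n ^+ 3 <= 0 by apply: le_trans cube _; rewrite xz expr0n/= mulr0 mul0r.
  rewrite xz mulr0 mul0r => n3; have : n ^+ 3 = 0 by apply/eqP; rewrite eq_le n3 exprn_ge0.
  by move/eqP; rewrite expf_eq0/= => /eqP ->; rewrite expr0n.
have xp : 0 < x by rewrite lt_def xn0.
rewrite -(ler_pM2r xp).
apply: (@le_trans _ _ (n ^+ 2 * (kV * n))); first by rewrite ler_wpM2l ?sqr_ge0.
rewrite mulrCA -exprSr.
apply: (@le_trans _ _ (kV * (C1 * x ^+ 2 * w))); first by rewrite ler_wpM2l// ltW.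
rewrite [leLHS](_ : _ = C1 * kV * (x ^+ 2 * w)); last by ring.
rewrite [leRHS](_ : _ = C1 * (1 + kV) * (x ^+ 2 * w)); last by ring.
by rewrite ler_wpM2r ?mulr_ge0 ?sqr_ge0// ler_wpM2l ?(ltW C10)// lerDr.
Qed.

Context (A : blin X X).
Hypothesis hessian : forall v w,
  inner (A (jV v)) (jV w) = frechet (frechet (augE)) (jW Uc) v w.

(** Taylor expansions in [V], where the first derivative vanishes at [Uc], combined
    with the interpolation inequality. *)
Lemma taylor_bound_state : exists d C : R, [/\ 0 < d, 0 < C,
  forall v : W, `|v| < d -> OW M (Uc + v),
  forall (v : W) (z : V), `|v| < d ->
    `|frechet (augE) (jW (Uc + v)) z - inner (A (jWX v)) (jV z)|
      <= C * `|jWX v| * `|v| * `|z| &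
  forall v : W, `|v| < d ->
    `|augE (jW (Uc + v)) - augE (jW Uc) - 2^-1 * inner (A (jWX v)) (jWX v)|
      <= C * `|jWX v| ^+ 2 * `|v|].
Proof.
have [r [C1 [r0 C10 rO T1 T2]]] :=
  C3_taylor openOV (augE_Ck c) (OVc hc).
have [C2 C20 C2P] := interpolation.
pose k := `|jW| + 1; have k0 : 0 < k by rewrite ltr_wpDl.
have jWr v : `|v| < r / k -> `|jW v| < r.
  rewrite ltr_pdivlMr// => vr; apply: le_lt_trans vr; apply: le_trans (blin_le _ _) _.
  by rewrite mulrC ler_wpM2l// lerDl.
exists (r / k), (C1 * C2); split.
- by rewrite divr_gt0.
- by rewrite mulr_gt0.
- by move=> v /jWr/rO; rewrite -blinD.
- move=> v z /jWr vr; have := T1 _ z vr.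
  rewrite -blinD -hessian (frechet_augE_bound_state hc) subr0.
  move/le_trans; apply; rewrite ler_wpM2r// -2!mulrA ler_wpM2l ?(ltW C10)//.
  by rewrite mulrA; exact: (C2P v).2.
- move=> v /jWr vr; have := T2 _ vr.
  rewrite -blinD -hessian (frechet_augE_bound_state hc) subr0.
  move/le_trans; apply; rewrite -2!mulrA ler_wpM2l ?(ltW C10)//.
  by rewrite mulrA; exact: (C2P v).1.
Qed.

Lemma energy_expansion (e : R) : 0 < e -> exists2 d : R, 0 < d & forall v : W, `|v| < d ->
  OW M (Uc + v) /\
  `|augE (jW (Uc + v)) - augE (jW Uc) - 2^-1 * inner (A (jWX v)) (jWX v)|
      <= e * `|jWX v| ^+ 2.
Proof.
move=> e0; have [d [C [d0 C0 Od _ T2]]] := taylor_bound_state.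
exists (Num.min d (e / C)); first by rewrite lt_min d0 divr_gt0.
move=> v; rewrite lt_min => /andP[vd ve]; split; first exact: Od.
apply: le_trans (T2 v vd) _; rewrite mulrAC ler_wpM2r ?sqr_ge0//.
by rewrite mulrC -ler_pdivlMr// ltW.
Qed.

(** For [(x, b)] regular, [- energy_rate b u] is the derivative of the pairing with
    [x] along the flow through [u] seen in a frame translated at the speed [- c]
    of the bound state. *)
Definition energy_rate (b u : W) : R :=
  gradE (jW u) (B (jW u) (jWX b)) - c * momentum_rate b u.

(** The direction [B(u) jWX b] stays in [W] and varies continuously there: this is
    where [BW] is used. *)
Lemma energy_rate_expansion (b : W) (e : R) : 0 < e -> exists2 d : R, 0 < d &
  forall v : W, `|v| < d ->
  `|energy_rate b (Uc + v) - inner (A (jWX v)) (B (jW Uc) (jWX b))| <= e * `|jWX v|.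
Proof.
move=> e0; have [d [C [d0 C0 Od T1 _]]] := taylor_bound_state.
have [_ _ _ [_ BWE [dBW _]] _] := h2.
have OUc : OW M Uc by have [] := bound_state hc.
pose zeta u := jW (BW u b).
have cz : {for Uc, continuous zeta}.
  apply: (continuous_comp (f := fun u => BW u b) (g := jW)); last exact: blin_continuous.
  apply: cvg_blin_app; last exact: cvg_cst.
  exact/differentiable_continuous/dBW.
pose K := `|zeta Uc| + 1; have K0 : 0 < K by rewrite ltr_wpDl.
pose L := (`|A| + 1) * (`|jV| + 1); have L0 : 0 < L by rewrite mulr_gt0// ltr_wpDl.
pose e1 := Num.min 1 (e / 2 / L); have e10 : 0 < e1 by rewrite lt_min ltr01 !divr_gt0.
have /continuous_epsP/(_ _ e10)[d1 d10 d1P] := cz.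
pose d2 := e / 2 / (C * K).
have d20 : 0 < d2 by rewrite !divr_gt0// mulr_gt0.
exists (Num.min d (Num.min d1 d2)); first by rewrite !lt_min d0 d10.
move=> v; rewrite !lt_min => /andP[vd /andP[vd1 vd2]].
have Ov : OW M (Uc + v) by exact: Od.
have := d1P (Uc + v); rewrite addrAC subrr add0r => /(_ vd1).
rewrite lt_min => /andP[z1 zL].
have zK : `|zeta (Uc + v)| <= K.
  have := norm_le_dist (zeta (Uc + v)) (zeta Uc); rewrite /K; lra.
have rateE : energy_rate b (Uc + v) = frechet (augE) (jW (Uc + v)) (zeta (Uc + v)).
  by rewrite (frechet_augE _ _ (OW_OV Ov)) /energy_rate /momentum_rate -BWE.
have -> : B (jW Uc) (jWX b) = jV (zeta Uc) by rewrite -BWE.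
rewrite rateE.
have -> : frechet (augE) (jW (Uc + v)) (zeta (Uc + v)) - inner (A (jWX v)) (jV (zeta Uc)) =
  frechet (augE) (jW (Uc + v)) (zeta (Uc + v)) - inner (A (jWX v)) (jV (zeta (Uc + v)))
  + inner (A (jWX v)) (jV (zeta (Uc + v) - zeta Uc)).
  by rewrite blinB innerBr; ring.
apply: le_trans (ler_normD _ _) _; set x := `|jWX v|.
have x0 : 0 <= x := normr_ge0 _.
have t1 := T1 v (zeta (Uc + v)) vd; rewrite -/x in t1.
have {}t1 : `|frechet (augE) (jW (Uc + v)) (zeta (Uc + v)) -
    inner (A (jWX v)) (jV (zeta (Uc + v)))| <= e / 2 * x.
  apply: le_trans t1 _; rewrite [leLHS](_ : _ = C * `|v| * `|zeta (Uc + v)| * x); last by ring.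
  rewrite ler_wpM2r//; apply: (@le_trans _ _ (C * `|v| * K)).
    by rewrite ler_wpM2l// mulr_ge0// ltW.
  rewrite mulrAC mulrC -ler_pdivlMr ?mulr_gt0//; exact: ltW.
have t2 : `|inner (A (jWX v)) (jV (zeta (Uc + v) - zeta Uc))| <= e / 2 * x.
  apply: le_trans (cauchy_schwarz _ _) _.
  have q1 : `|A (jWX v)| <= (`|A| + 1) * x.
    by apply: le_trans (blin_le _ _) _; rewrite ler_wpM2r// lerDl.
  have q2 : `|jV (zeta (Uc + v) - zeta Uc)| <= (`|jV| + 1) * (e / 2 / L).
    apply: le_trans (blin_le _ _) _; apply: ler_pM => //; last exact: ltW.
    by rewrite lerDl.
  apply: le_trans (ler_pM _ _ q1 q2) _ => //.
  rewrite le_eqVlt; apply/orP; left; apply/eqP; rewrite /L; field.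
  by rewrite !gt_eqF// ltr_wpDl.
lra.
Qed.

(** A small displacement from [Uc] along a direction of [W] negative for the form of
    [A]. *)
Lemma unstable_data (b : W) :
  inner (A (B (jW Uc) (jWX b))) (B (jW Uc) (jWX b)) < 0 ->
  forall nu : R, 0 < nu -> exists2 u0, tube M c nu u0 & augE (jW u0) < augE (jW Uc).
Proof.
set z := B _ _ => zneg nu nu0.
have [OU _ _ _ _] := bound_state hc.
have [_ _ _ [_ /(_ Uc b OU) zE _] _] := h2.
pose v := BW Uc b; have {}zE : jWX v = z := zE.
pose q := - inner (A z) z; have q0 : 0 < q by rewrite oppr_gt0.
pose n := `|z| ^+ 2 + 1; have n0 : 0 < n by rewrite ltr_wpDl ?sqr_ge0.
have e0 : 0 < q / 4 / n by rewrite !divr_gt0.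
have [d d0 dP] := energy_expansion e0.
pose m := Num.min d nu; have m0 : 0 < m by rewrite lt_min d0.
pose s := m / 2 / (`|v| + 1); have v0 : 0 < `|v| + 1 by rewrite ltr_wpDl.
have s0 : 0 < s by rewrite !divr_gt0.
have : `|s *: v| < m.
  rewrite normrZ (gtr0_norm s0); apply: (@le_lt_trans _ _ (s * (`|v| + 1))).
    by rewrite ler_wpM2l ?(ltW s0)// lerDl.
  by rewrite /s divfK ?gt_eqF//; lra.
rewrite lt_min => /andP[sd snu]; have [Os] := dP _ sd.
rewrite !jWXZ zE !blinZ innerZl innerZr normrZ (gtr0_norm s0) exprMn.
move=> en; exists (Uc + s *: v).
  by apply: near_tube => //; rewrite addrAC subrr add0r.
have s2 : 0 < s ^+ 2 by rewrite exprn_gt0.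
have bound : q / 4 / n * (s ^+ 2 * `|z| ^+ 2) <= s ^+ 2 * q / 4.
  rewrite [leLHS](_ : _ = s ^+ 2 * q / 4 * (`|z| ^+ 2 / n)); last first.
    by field; rewrite gt_eqF.
  have zn : `|z| ^+ 2 / n <= 1 by rewrite ler_pdivrMr// mul1r lerDl.
  have sq4 : 0 <= s ^+ 2 * q / 4 by rewrite divr_ge0// mulr_ge0// ltW.
  by rewrite ler_piMr.
have := le_trans en bound; rewrite ler_norml => /andP[_].
have -> : inner (A z) z = - q by rewrite opprK.
have -> : 2^-1 * (s * (s * - q)) = - (s ^+ 2 * q / 2) by field.
have sq : 0 < s ^+ 2 * q by rewrite mulr_gt0.
move: (augE _) (augE _) (s ^+ 2 * q) sq => E1 E2 w w0; lra.
Qed.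

(** * Growth below the energy of the bound state *)

Context (y : X) (b : W).
Hypothesis y_regular : regular y b.
Hypothesis y_tangent : momentum_rate b Uc = 0.
Local Notation z := (B (jW Uc) (jWX b)).
Context (kappa K : R).
Hypothesis kappa0 : 0 < kappa.
Hypothesis K0 : 0 < K.
Hypothesis coercive : forall v, inner v x0 = 0 ->
  kappa * `|v| ^+ 2 <= inner (A v) v + K * inner (A v) z ^+ 2.

Let Q (v : W) : R := inner (A (jWX v)) z.

(** Below the energy of the bound state, and transversally to its orbit, the
    quadratic form of [A] is negative; since it is positive modulo its negative
    direction [z], the component [Q] along [z] controls the whole state. *)
Lemma negative_cone : exists d c1 : R, [/\ 0 < d, 0 < c1 &
  forall v, `|v| < d -> inner x0 (jWX v) = 0 ->
    augE (jW (Uc + v)) < augE (jW Uc) -> c1 * `|jWX v| <= `|Q v|].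
Proof.
have k8 : 0 < kappa / 8 by rewrite divr_gt0.
have [d d0 dP] := energy_expansion k8.
pose c1 := Num.min 1 (kappa / 2 / K).
have c10 : 0 < c1 by rewrite lt_min ltr01 !divr_gt0.
have c11 : K * c1 ^+ 2 <= kappa / 2.
  rewrite mulrC -ler_pdivlMr//; apply: (@le_trans _ _ c1); last by rewrite ge_min lexx orbT.
  by rewrite expr2 ger_pMr// ge_min lexx.
exists d, c1; split => // v vd vx E; have [_] := dP v vd.
have := @coercive (jWX v); rewrite innerC vx => /(_ erefl).
rewrite -[inner (A _) z]/(Q v); set q := inner _ _; set n := `|jWX v| => co.
rewrite ler_norml => /andP[en _].
have cn0 : 0 <= c1 * n by rewrite mulr_ge0 ?(ltW c10)// normr_ge0.
rewrite -(@ler_pXn2r _ 2) ?nnegrE//.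
have -> : `|Q v| ^+ 2 = Q v ^+ 2 by rewrite real_normK ?num_real.
rewrite -(ler_pM2l K0) exprMn mulrA.
apply: (@le_trans _ _ (kappa / 2 * n ^+ 2)); first by rewrite ler_wpM2r ?sqr_ge0.
have n2 : 0 <= n ^+ 2 := sqr_ge0 _.
have kn : 0 <= kappa * n ^+ 2 by rewrite mulr_ge0// ltW.
have e8 : kappa / 8 * n ^+ 2 = kappa * n ^+ 2 / 8 by ring.
have e2 : kappa / 2 * n ^+ 2 = kappa * n ^+ 2 / 2 by ring.
rewrite e8 in en; rewrite e2; move: (augE _) (augE _) E en => E1 E2.
move: (kappa * _) kn co => k kn co; lra.
Qed.

Lemma energy_gap : exists2 d : R, 0 < d & forall E0 : R, E0 < augE (jW Uc) ->
  exists2 rho : R, 0 < rho & forall v, `|v| < d ->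
    augE (jW (Uc + v)) <= E0 -> rho <= `|jWX v|.
Proof.
have [d d0 dP] := energy_expansion ltr01.
exists d => // E0 E0U; pose e := augE (jW Uc) - E0; have e0 : 0 < e by rewrite subr_gt0.
pose L := `|A| + 2; have L0 : 0 < L by rewrite ltr_wpDl.
exists (Num.min 1 (e / L)); first by rewrite lt_min ltr01 divr_gt0.
move=> v vd vE; rewrite leNgt; apply/negP; rewrite lt_min => /andP[v1 v2].
have [_] := dP v vd; set n := `|jWX v| in v1 v2 *; rewrite mul1r.
have n0 : 0 <= n := normr_ge0 _.
have n2 : n ^+ 2 <= n by rewrite expr2 ler_piMl// ltW.
have q1 : `|inner (A (jWX v)) (jWX v)| <= `|A| * n.
  apply: le_trans (cauchy_schwarz _ _) _.
  apply: (@le_trans _ _ (`|A| * n * n)); first by rewrite ler_wpM2r// blin_le.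
  by rewrite -mulrA ler_wpM2l// -expr2.
rewrite ltr_pdivlMr// /L mulrDr in v2.
move: q1; rewrite ler_norml => /andP[q1 _].
rewrite ler_norml => /andP[en _]; move: vE v2; rewrite /e.
move: (augE _) (augE _) en q1 => E1 E2; move: (n ^+ 2) n2 => n2 n2n.
have kn0 : 0 <= `|A| * n by rewrite mulr_ge0.
clear v1; move: n n0 n2n kn0 => n n0 n2n; move: `|A| => k; move: (inner _ _) => q.
rewrite (mulrC n k); move: (k * n) => kn kn0 *; lra.
Qed.

(** If the pairing with [x0] is stationary then the frame moves at the speed of the
    bound state up to [O(|v|)]: the momentum rate is near [- |x0|^2], hence away
    from [0], while the energy rate is [O(|v|)]. *)
Lemma speed_bound b0 : regular x0 b0 -> exists d C : R, [/\ 0 < d, 0 < C &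
  forall v a, `|v| < d -> energy_rate b0 (Uc + v) + a * momentum_rate b0 (Uc + v) = 0 ->
    `|a| <= C * `|jWX v|].
Proof.
move=> reg; have [_ _ _ _ x0n] := bound_state hc.
pose p := `|x0| ^+ 2; have p0 : 0 < p by rewrite exprn_gt0// normr_gt0; exact/eqP.
have p20 : 0 < p / 2 by rewrite divr_gt0.
have [r1 r10 r1P] := momentum_rate_continuous b0 p20.
have [r2 r20 r2P] := energy_rate_expansion b0 ltr01.
set z0 := B _ _ in r2P.
pose C := `|A| * `|z0| + 1; have C0 : 0 < C by rewrite ltr_wpDl// mulr_ge0.
exists (Num.min r1 r2), (C / (p / 2)); split; rewrite ?lt_min ?r10// ?divr_gt0//.
move=> v a; rewrite lt_min => /andP[v1 v2] eqn.
have := r1P v v1; rewrite (momentum_rate_bound_state reg) -/p.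
rewrite ltr_norml => /andP[_ mom].
have := r2P v v2; rewrite mul1r.
have := cauchy_schwarz (A (jWX v)) z0; have := blin_le A (jWX v).
set n := `|jWX v|; set q := inner _ _ => An qn en.
have {}qn : `|q| <= `|A| * `|z0| * n.
  by apply: le_trans qn _; rewrite mulrAC ler_wpM2r.
have rate : `|energy_rate b0 (Uc + v)| <= C * n.
  have := norm_le_dist (energy_rate b0 (Uc + v)) q; rewrite /C mulrDl mul1r; lra.
rewrite mulrAC ler_pdivlMr//; apply: le_trans rate.
have -> : energy_rate b0 (Uc + v) = - (a * momentum_rate b0 (Uc + v)).
  by apply/eqP; rewrite -addr_eq0 eqn.
rewrite normrN normrM ler_wpM2l// ler0_norm; lra.
Qed.

Lemma Q_close (v w : W) eps : `|jWX v - jWX w| <= eps * `|jWX w| ->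
  `|Q v - Q w| <= `|A| * `|z| * eps * `|jWX w|.
Proof.
move=> vw; rewrite /Q -innerBl -blinB; apply: le_trans (cauchy_schwarz _ _) _.
rewrite -mulrA mulrAC ler_wpM2r//; apply: le_trans (blin_le _ _) _.
by rewrite ler_wpM2l.
Qed.

(** Along a frame whose speed differs from the natural one by [O(|v|)], the
    pairing with [y] evolves at the rate [- Q], up to [o(|v|)]. *)
Lemma growth_rate (C m : R) : 0 < C -> 0 < m -> exists d eps : R,
  [/\ 0 < d, 0 < eps, eps <= 1 & forall v w a, `|v| < d -> `|a| <= C * `|jWX w| ->
    `|jWX v - jWX w| <= eps * `|jWX w| ->
    `|energy_rate b (Uc + v) + a * momentum_rate b (Uc + v) - Q w| <= m * `|jWX w| /\
    `|Q v - Q w| <= m * `|jWX w| ].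
Proof.
move=> C0 m0.
have m6 : 0 < m / 6 by rewrite divr_gt0.
have m6C : 0 < m / 6 / C by rewrite !divr_gt0.
have [r1 r10 r1P] := momentum_rate_continuous b m6C.
have [r2 r20 r2P] := energy_rate_expansion b m6.
pose L := `|A| * `|z| + 1; have L0 : 0 < L by rewrite ltr_wpDl// mulr_ge0.
pose eps := Num.min 1 (m / 3 / L).
have eps0 : 0 < eps by rewrite lt_min ltr01 !divr_gt0.
have epsL : `|A| * `|z| * eps <= m / 3.
  apply: (@le_trans _ _ (L * eps)); first by rewrite ler_wpM2r ?(ltW eps0)// lerDl.
  by rewrite mulrC -ler_pdivlMr// ge_min lexx orbT.
exists (Num.min r1 r2), eps; split; [by rewrite lt_min r10|exact: eps0|by rewrite ge_min lexx|].
move=> v w a; rewrite lt_min => /andP[v1 v2] aC vw.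
have {}q : `|Q v - Q w| <= m / 3 * `|jWX w|.
  by apply: le_trans (Q_close vw) _; rewrite ler_wpM2r.
have nw := normr_ge0 (jWX w); set n := `|jWX w| in nw q vw *.
have mn : 0 <= m * n by rewrite mulr_ge0// ltW.
have m3 : m / 3 * n = m * n / 3 by ring.
rewrite m3 in q; split; last by lra.
have v2n : `|jWX v| <= 2 * n.
  have := norm_le_dist (jWX v) (jWX w); rewrite -/n.
  have : eps * n <= n by rewrite ler_piMl// ge_min lexx.
  lra.
have e1 : `|energy_rate b (Uc + v) - Q v| <= m * n / 3.
  apply: le_trans (r2P v v2) _; apply: (@le_trans _ _ (m / 6 * (2 * n))).
    by rewrite ler_wpM2l// ltW.
  by rewrite le_eqVlt; apply/orP; left; apply/eqP; field.
have e2 : `|a * momentum_rate b (Uc + v)| <= m * n / 3.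
  have := r1P v v1; rewrite y_tangent subr0 => mom.
  rewrite normrM; apply: (@le_trans _ _ (C * n * (m / 6 / C))).
    by apply: ler_pM => //; exact: ltW.
  rewrite [leLHS](_ : _ = m * n / 6); last by field; rewrite gt_eqF.
  by move: (m * n) mn => mn; lra.
have -> : energy_rate b (Uc + v) + a * momentum_rate b (Uc + v) - Q w =
  (energy_rate b (Uc + v) - Q v) + a * momentum_rate b (Uc + v) + (Q v - Q w) by ring.
have := ler_normD (energy_rate b (Uc + v) - Q v + a * momentum_rate b (Uc + v)) (Q v - Q w).
have := ler_normD (energy_rate b (Uc + v) - Q v) (a * momentum_rate b (Uc + v)).
lra.
Qed.

Lemma signed_lower_bound (sg r r' e : R) : sg = 1 \/ sg = -1 -> `|r' - r| <= e ->
  sg * r - e <= sg * r'.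
Proof.
by rewrite ler_norml => sg1 /andP[q1 q2]; case: sg1 => ->; rewrite ?mul1r ?mulN1r; lra.
Qed.

Lemma frame_derive (t1 : R) u x b' (a sa ta t : R) :
  solution_on M `[0, t1[ u -> regular x b' -> 0 < t < t1 ->
  is_derive t 1 (fun r => inner x (T (sa + (r - ta) * a) (jWX (u r))) : R^o)
    (- (energy_rate b' (TW (sa + (t - ta) * a) (u t)) +
        (c + a) * momentum_rate b' (TW (sa + (t - ta) * a) (u t)))).
Proof.
move=> su reg tt; have Dt : (`[0, t1[ : set R)° t by rewrite interior_itv /= in_itv.
have := is_derive_moving_frame a sa ta su reg Dt.
congr (is_derive _ _ _ _); rewrite /energy_rate /momentum_rate.
set p := s_gradE M _ _; set q := s_gradP M _ _.
by rewrite -[LHS]/(- p - a * q : R); ring.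
Qed.

Lemma augE_frame (t1 : R) u s t : solution_on M `[0, t1[ u -> 0 <= t < t1 ->
  augE (jW (TW s (u t))) = augE (jW (u 0)).
Proof.
move=> [_ Ou _ cE cP] /andP[t0 tt].
have Dt : `[0, t1[%classic t by rewrite /= in_itv/= t0.
have D0 : `[0, t1[%classic (0 : R) by rewrite /= in_itv/= lexx (le_lt_trans t0).
rewrite /augE jW_TW (A4_ix h4 s (Ou _ Dt)).
by rewrite (P_invariant s (Ou _ Dt)) (cE _ _ Dt D0) (cP _ _ Dt D0).
Qed.

(** One step of the mesh.  Between two times at which the frame is chosen
    orthogonal to [x0] the frame is interpolated linearly; by the mean value
    theorem for the pairing with [x0] its speed is [- c + O(|v|)], and the mean
    value theorem for the pairing with [y] then measures the growth. *)
Lemma growth_step (C m d eps t1 : R) u b0 (sa sb ta tb : R) : 0 <= C -> eps <= 1 ->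
  regular x0 b0 ->
  (forall v a, `|v| < d -> energy_rate b0 (Uc + v) + a * momentum_rate b0 (Uc + v) = 0 ->
    `|a| <= C * `|jWX v|) ->
  (forall v w a, `|v| < d -> `|a| <= 2 * C * `|jWX w| ->
    `|jWX v - jWX w| <= eps * `|jWX w| ->
    `|energy_rate b (Uc + v) + a * momentum_rate b (Uc + v) - Q w| <= m * `|jWX w| /\
    `|Q v - Q w| <= m * `|jWX w|) ->
  solution_on M `[0, t1[ u -> 0 < ta -> ta < tb -> tb < t1 ->
  phase (u ta) sa = 0 -> phase (u tb) sb = 0 ->
  let w := TW sa (u ta) - Uc in
  (forall t s, ta <= t <= tb -> `|s - sa| <= `|sb - sa| ->
    `|TW s (u t) - Uc| < d /\ `|jWX (TW s (u t) - Uc) - jWX w| <= eps * `|jWX w|) ->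
  `|Q (TW sb (u tb) - Uc) - Q w| <= m * `|jWX w| /\
  `|inner y (jWX (TW sb (u tb) - Uc)) - inner y (jWX w) + (tb - ta) * Q w|
     <= (tb - ta) * (m * `|jWX w|).
Proof.
move=> C0 eps1 reg speed growth su ta0 tab tbt pa pb w near.
have h0 : 0 < tb - ta by rewrite subr_gt0.
pose a := (sb - sa) / (tb - ta); pose S t := sa + (t - ta) * a.
have Sa : S ta = sa by rewrite /S subrr mul0r addr0.
have Sb : S tb = sb by rewrite /S /a mulrCA divff ?gt_eqF// mulr1 addrC subrK.
have Snear t : ta <= t <= tb -> `|S t - sa| <= `|sb - sa|.
  move=> /andP[t1' t2]; rewrite /S (addrC sa) addrK /a mulrCA normrM ler_piMr//.
  by rewrite ger0_norm ?divr_ge0 ?subr_ge0 ?(ltW tab)// ler_pdivrMr// mul1r lerB.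
pose v t := TW (S t) (u t) - Uc.
have vnear t : ta <= t <= tb -> `|v t| < d /\ `|jWX (v t) - jWX w| <= eps * `|jWX w|.
  by move=> tt; apply: near => //; exact: Snear.
have mvt x b' : regular x b' -> exists2 t, ta <= t <= tb &
    inner x (T sb (jWX (u tb))) - inner x (T sa (jWX (u ta))) =
    - (energy_rate b' (Uc + v t) + (c + a) * momentum_rate b' (Uc + v t)) * (tb - ta).
  move=> regx.
  have df t : ta <= t <= tb ->
      is_derive t 1 (fun r => inner x (T (S r) (jWX (u r))) : R^o)
    (- (energy_rate b' (TW (S t) (u t)) + (c + a) * momentum_rate b' (TW (S t) (u t)))).
    move=> /andP[t1' t2]; apply: frame_derive su regx _.
    by rewrite (lt_le_trans ta0 t1') (le_lt_trans t2 tbt).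
  have d1 t : t \in `]ta, tb[ -> is_derive t 1 (fun r => inner x (T (S r) (jWX (u r))) : R^o)
    (- (energy_rate b' (TW (S t) (u t)) + (c + a) * momentum_rate b' (TW (S t) (u t)))).
    by rewrite in_itv/= => /andP[t1' t2]; apply: df; rewrite !ltW.
  have cf : {within `[ta, tb], continuous (fun r => inner x (T (S r) (jWX (u r))) : R^o)}.
    apply: continuous_in_subspaceT => t; rewrite inE/= in_itv/= => tt.
    exact: is_derive_continuous (df _ tt).
  have [t] := MVT_segment (ltW tab) d1 cf; rewrite in_itv/= Sa Sb => tt e.
  by exists t => //; rewrite /v (addrC Uc) subrK; exact: e.
have nw := normr_ge0 (jWX w).
have ac : `|c + a| <= 2 * C * `|jWX w|.
  have [t tt] := mvt _ _ reg; have [vd vw] := vnear t tt.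
  have -> : inner x0 (T sb (jWX (u tb))) - inner x0 (T sa (jWX (u ta))) = 0.
    by move: pa pb; rewrite /phase !innerBr => *; lra.
  move/esym/eqP; rewrite mulf_eq0 oppr_eq0 (gt_eqF h0) orbF => /eqP/(speed _ _ vd) ac.
  apply: le_trans ac _; rewrite (mulrC 2) -mulrA ler_wpM2l//.
  have := norm_le_dist (jWX (v t)) (jWX w).
  have : eps * `|jWX w| <= `|jWX w| by rewrite ler_piMl.
  lra.
split.
  have tt : ta <= tb <= tb by rewrite lexx ltW.
  have [vd vw] := vnear _ tt; have := (growth _ _ _ vd ac vw).2.
  by rewrite /v Sb.
have [t tt e] := mvt _ _ y_regular; have [vd vw] := vnear t tt.
have [{}growth _] := growth _ _ _ vd ac vw.
have -> : inner y (jWX (TW sb (u tb) - Uc)) - inner y (jWX w) =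
   inner y (T sb (jWX (u tb))) - inner y (T sa (jWX (u ta))).
  by rewrite /w !jWXB !(A4_i_W h4) !innerBr; ring.
rewrite e; set q := energy_rate _ _ + _ in growth *.
have -> : - q * (tb - ta) + (tb - ta) * Q w = - ((tb - ta) * (q - Q w)) by ring.
by rewrite normrN normrM (gtr0_norm h0) ler_wpM2l// ltW.
Qed.

(** On a fine mesh of a long time interval, frames orthogonal to [x0] are chosen
    one after the other; [Q] keeps its sign and stays away from [0] by the energy
    bound, so that the bounded quantity [(y, v)] grows linearly. *)
Lemma escape : exists2 nu0 : R, 0 < nu0 & forall E0 : R, E0 < augE (jW Uc) ->
  exists2 N : R, 0 < N & forall t1 u, N + 1 < t1 -> solution_on M `[0, t1[ u ->
    augE (jW (u 0)) <= E0 -> exists2 t, t \in `[0, t1[ & ~ tube M c nu0 (u t).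
Proof.
have [_ _ _ [b0 reg] x0n] := bound_state hc.
have p0 : 0 < `|x0| by rewrite normr_gt0; exact/eqP.
have [k k0 kP] := jWX_bound.
have [d1 [c1 [d10 c10 cone]]] := negative_cone.
have [d2 d20 gap] := energy_gap.
have [d3 [C [d30 C0 speed]]] := speed_bound reg.
have C20 : 0 < 2 * C by rewrite mulr_gt0.
pose m := c1 / 2; have m0 : 0 < m by rewrite divr_gt0.
have [d4 [eps [d40 eps0 eps1 growth]]] :=
  growth_rate C20 m0.
pose d := Num.min (Num.min d1 d2) (Num.min d3 d4).
have d0 : 0 < d by rewrite !lt_min d10 d20 d30.
have dd r : r < d -> [/\ r < d1, r < d2, r < d3 & r < d4].
  by rewrite !lt_min => /andP[/andP[-> ->] /andP[-> ->]].
have [nu1 [nu10 slc]] := slice.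
pose nu2 := Num.min (nu1 / 2) (d / 2).
have nu20 : 0 < nu2 by rewrite lt_min !divr_gt0.
have nu21 : 0 < nu2 < nu1.
  rewrite nu20 /=; apply: (@le_lt_trans _ _ (nu1 / 2)); first by rewrite ge_min lexx.
  by rewrite ltr_pdivrMr// ltr_pMr// ltr1n.
have nu2d : 2 * nu2 <= d.
  by rewrite mulrC -ler_pdivlMr// ge_min lexx orbT.
have nu2d1 : nu2 <= d by lra.
have sum2 (r r' : R) : r < nu2 -> r' < nu2 -> r + r' < 2 * nu2.
  by move=> r1 r2; rewrite mulr_natl mulr2n ltrD.
have [nu3 nu30 {}slc] := slc nu2 nu21.
exists (Num.min nu3 nu2); first by rewrite lt_min nu30.
move=> E0 E0U; have [rho rho0 {}gap] := gap E0 E0U.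
(* [mu] bounds the growth rate of the pairing with [y] from below, and [L] its total
   variation: [N] is a time at which the growth exceeds [L]. *)
pose mu := m * rho; have mu0 : 0 < mu by rewrite mulr_gt0.
pose L := 2 * `|y| * k * nu2.
have L0 : 0 <= L by rewrite !mulr_ge0// ltW.
exists ((L + 1) / mu); first by rewrite divr_gt0// ltr_wpDl.
set N := (L + 1) / mu => t1 u Nt su E0u.
have N0 : 0 < N by rewrite divr_gt0// ltr_wpDl.
apply: contrapT => stay.
have trapped t : 0 <= t < t1 -> tube M c nu3 (u t) /\ tube M c nu2 (u t).
  move=> tt; have : tube M c (Num.min nu3 nu2) (u t).
    apply: contrapT => out; apply: stay; exists t => //.
  by move=> [Ou]; rewrite lt_min => /andP[n3 n2].
(* The mesh lies in [[1, N + 1]], in the interior of the time interval, where the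
   equation holds in differential form. *)
have cu t : 1 <= t <= N + 1 -> {for t, continuous u}.
  move=> /andP[ta tb]; apply: (solution_continuous su).
  by rewrite interior_itv /= in_itv/= (lt_le_trans ltr01 ta) (le_lt_trans tb Nt).
have inD t : 1 <= t <= N + 1 -> 0 <= t < t1.
  by move=> /andP[ta tb]; rewrite (le_trans ler01 ta) (le_lt_trans tb Nt).
pose eta := Num.min nu2 (eps * rho / k).
have eta0 : 0 < eta by rewrite lt_min nu20 divr_gt0// mulr_gt0.
have [de de0 deP] := uniform_translation cu eta0.
(* The slice lemma moves the frame by at most [ks] times the increment of [u]. *)
pose ks := 2 / `|x0| ^+ 2 * (`|x0| * k).
have ks0 : 0 < ks by rewrite mulr_gt0 ?divr_gt0 ?exprn_gt0// mulr_gt0.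
have dks : 0 < de / ks by rewrite divr_gt0.
have [df df0 dfP] := uniform_translation cu dks.
pose h0 := Num.min de df; have h00 : 0 < h0 by rewrite lt_min de0.
pose n := (Num.truncn (N / h0)).+1.
pose h := N / n%:R.
have n0 : 0 < n%:R :> R by rewrite ltr0n.
have hp : 0 < h by rewrite divr_gt0.
have hh0 : h < h0.
  by rewrite /h ltr_pdivrMr// mulrC -ltr_pdivrMr//; exact: truncnS_gt.
have nh : n%:R * h = N by rewrite /h mulrC divfK// gt_eqF.
pose t (j : nat) : R := 1 + j%:R * h.
have tn j : (j <= n)%N -> 1 <= t j <= N + 1.
  move=> jn; rewrite /t lerDl mulr_ge0 ?(ltW hp)//= addrC lerD2r -nh.
  by rewrite ler_wpM2r ?(ltW hp)// ler_nat.
have energy s r : 0 <= r < t1 -> augE (jW (TW s (u r))) <= E0.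
  by move=> rr; rewrite (augE_frame s su rr).
have transversal s r : 0 <= r < t1 -> phase (u r) s = 0 -> `|TW s (u r) - Uc| < nu2 ->
    rho <= `|jWX (TW s (u r) - Uc)| /\ c1 * `|jWX (TW s (u r) - Uc)| <= `|Q (TW s (u r) - Uc)|.
  move=> rr ph near; have /dd[l1 l2 _ _] : `|TW s (u r) - Uc| < d by exact: lt_le_trans near nu2d1.
  have UE : Uc + (TW s (u r) - Uc) = TW s (u r) by rewrite (addrC Uc) subrK.
  split; first by apply: gap l2 _; rewrite UE energy.
  apply: cone l1 _ _; last by rewrite UE; apply: le_lt_trans E0U; exact: energy.
  by move: ph; rewrite /phase -(A4_i_W h4) -jWXB.
have tj0 : t 0%N = 1 by rewrite /t mul0r addr0.
have t0D : 1 <= t 0%N <= N + 1 by exact: tn.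
have [s0 [ph0 w0 _]] : exists s1, [/\ phase (u (t 0%N)) s1 = 0,
    `|TW s1 (u (t 0%N)) - Uc| < nu2 & True].
  have [tu3 tu2] := trapped _ (inD _ t0D).
  have [s sn] := tube_translate tu2.
  have s2 : `|TW s (u (t 0%N)) - Uc| < 2 * nu2 by rewrite -[ltLHS]addr0 sum2.
  by have [s1 [p1 n1 _]] := slc _ tu3 s s2; exists s1.
pose g s j := inner y (jWX (TW s (u (t j)) - Uc)).
have [sg sg1 sgQ] : exists2 sg : R, sg = 1 \/ sg = -1 &
    0 < sg * Q (TW s0 (u (t 0%N)) - Uc).
  have [r1 r2] := transversal _ _ (inD _ t0D) ph0 w0.
  have q : 0 < `|Q (TW s0 (u (t 0%N)) - Uc)|.
    by apply: lt_le_trans r2; rewrite mulr_gt0// (lt_le_trans rho0).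
  rewrite normr_gt0 in q.
  have [qp|qn] := ltP 0 (Q (TW s0 (u (t 0%N)) - Uc)).
    by exists 1; [left|rewrite mul1r].
  by exists (-1); [right|rewrite mulN1r oppr_gt0 lt_neqAle q].
have steps j : (j <= n)%N -> exists s, [/\ phase (u (t j)) s = 0,
    `|TW s (u (t j)) - Uc| < nu2, 0 < sg * Q (TW s (u (t j)) - Uc) &
    j%:R * (h * mu) <= - (sg * (g s j - g s0 0%N))].
  elim: j => [_|j IH jn].
    by exists s0; split => //; rewrite mul0r subrr mulr0 oppr0.
  have {}IH := IH (ltnW jn); have [s [ph ws sQ gj]] := IH.
  have tjD := tn _ (ltnW jn); have tj1D := tn _ jn.
  have tjj : t j.+1 - t j = h by rewrite /t -natr1; ring.
  have tjlt : t j < t j.+1 by rewrite -subr_gt0 tjj.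
  have [tu3 _] := trapped _ (inD _ tj1D).
  have hde : h < de by apply: lt_le_trans hh0 _; rewrite ge_min lexx.
  have hdf : h < df by apply: lt_le_trans hh0 _; rewrite ge_min lexx orbT.
  have uu : `|u (t j.+1) - u (t j)| < de / ks.
    have := dfP (t j) (t j.+1) 0 tjD; rewrite tjj (gtr0_norm hp) normr0 TW_0.
    by apply.
  have near2 : `|TW s (u (t j.+1)) - Uc| < 2 * nu2.
    have : `|u (t j.+1) - u (t j)| < nu2.
      have := deP (t j) (t j.+1) 0 tjD; rewrite tjj (gtr0_norm hp) normr0 TW_0.
      by move=> /(_ hde de0); rewrite lt_min => /andP[].
    move=> uj; rewrite -(subrK (TW s (u (t j))) (TW s (u (t j.+1)))) -addrA.
    by apply: le_lt_trans (ler_normD _ _) _; rewrite TW_isometry sum2.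
  have [s' [ph' ws' ss']] := slc _ tu3 s near2.
  have {}ss' : `|s' - s| < de.
    apply: le_lt_trans ss' _.
    have -> : phase (u (t j.+1)) s =
        inner x0 (jWX (TW s (u (t j.+1)) - TW s (u (t j)))).
      by rewrite -[LHS]subr0 -{1}ph /phase !jWXB !(A4_i_W h4) !innerBr; ring.
    have i1 := cauchy_schwarz x0 (jWX (TW s (u (t j.+1)) - TW s (u (t j)))).
    have := kP (TW s (u (t j.+1)) - TW s (u (t j))); rewrite TW_isometry => i2.
    apply: (@le_lt_trans _ _ (ks * `|u (t j.+1) - u (t j)|)); last first.
      by rewrite mulrC -ltr_pdivlMr.
    rewrite /ks -(mulrA (2 / _)) ler_wpM2l ?divr_ge0 ?exprn_ge0//.
    by apply: le_trans i1 _; rewrite -mulrA ler_wpM2l.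
  have [rw qw] := transversal _ _ (inD _ tjD) ph ws.
  set w := TW s (u (t j)) - Uc in ws sQ rw qw.
  have near r s'' : t j <= r <= t j.+1 -> `|s'' - s| <= `|s' - s| ->
      `|TW s'' (u r) - Uc| < d /\ `|jWX (TW s'' (u r) - Uc) - jWX w| <= eps * `|jWX w|.
    move=> /andP[r1 r2] rs; have rsd := le_lt_trans rs ss'.
    have rj : `|r - t j| < de.
      by rewrite ger0_norm ?subr_ge0// (le_lt_trans _ hde)// -tjj lerD2r.
    have := deP _ _ _ tjD rj rsd.
    have <- : `|TW s'' (u r) - Uc - w| = `|TW (s'' - s) (u r) - u (t j)|.
      rewrite -[RHS](TW_isometry s) -TWD (addrC s) subrK.
      by rewrite /w opprB addrA subrK.
    rewrite lt_min => /andP[e1 e2]; split.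
      apply: le_lt_trans (norm_le_dist _ w) _; apply: lt_le_trans nu2d; exact: sum2.
    rewrite -jWXB; apply: le_trans (kP _) _.
    rewrite ltr_pdivlMr// mulrC in e2; apply: le_trans (ltW e2) _.
    by rewrite ler_wpM2l// ltW.
  have [Qs gs] := growth_step (ltW C0) eps1 reg
    (fun v a vd => let: And4 _ _ v3 _ := dd _ vd in speed v a v3)
    (fun v w a vd => let: And4 _ _ _ v4 := dd _ vd in growth v w a v4)
    su (lt_le_trans ltr01 (proj1 (andP tjD))) tjlt (proj2 (andP (inD _ tj1D))) ph ph' near.
  rewrite -/w in Qs gs.
  rewrite tjj in gs; set nw := `|jWX w| in rw qw Qs gs.
  have c1m : c1 = 2 * m by rewrite /m mulrC divfK.
  have mnw : mu <= m * nw by rewrite ler_wpM2l// ltW.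
  have hm : h * mu <= h * (m * nw) by rewrite ler_wpM2l// ltW.
  rewrite c1m -mulrA in qw; set Q' := Q (TW s' (u (t j.+1)) - Uc).
  have {}Qs : `|Q' - Q w| <= m * nw by exact: Qs.
  have {}gs : `|g s' j.+1 - g s j + h * Q w| <= h * (m * nw) by exact: gs.
  have sq : 2 * (m * nw) <= sg * Q w.
    apply: le_trans qw _; move: sQ; case: sg1 => ->.
      by rewrite mul1r => q; rewrite gtr0_norm.
    by rewrite mulN1r oppr_gt0 => q; rewrite ltr0_norm.
  have hsq : h * (2 * (m * nw)) <= h * (sg * Q w) by rewrite ler_wpM2l// ltW.
  have sQ' : m * nw <= sg * Q'.
    apply: le_trans (signed_lower_bound sg1 Qs).
    by rewrite lerBrDr -mulr2n -mulr_natl.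
  exists s'; split => //; first by apply: lt_le_trans sQ'; exact: lt_le_trans mnw.
  have gg : h * mu <= - (sg * (g s' j.+1 - g s j)).
    have gs' : `|- (g s' j.+1 - g s j) - h * Q w| <= h * (m * nw).
      by rewrite -opprD normrN.
    have := signed_lower_bound sg1 gs'; rewrite mulrN; apply: le_trans.
    rewrite (mulrCA sg) lerBrDr; apply: le_trans hsq.
    by rewrite [leRHS]mulrCA mulr_natl mulr2n lerD2r.
  have -> : - (sg * (g s' j.+1 - g s0 0%N)) =
     - (sg * (g s' j.+1 - g s j)) - sg * (g s j - g s0 0%N) by ring.
  by rewrite -natr1 mulrDl mul1r addrC lerD.
have [s [_ ws _ gn]] := steps n (leqnn n).
have sgn : `|sg| = 1 by case: sg1 => ->; rewrite ?normrN normr1.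
have : n%:R * (h * mu) <= L.
  apply: le_trans gn _; apply: le_trans (ler_norm _) _.
  rewrite normrN normrM sgn mul1r /g -innerBr -jWXB.
  apply: le_trans (cauchy_schwarz _ _) _.
  rewrite /L (mulrC 2) -2!mulrA ler_wpM2l//; apply: le_trans (kP _) _.
  rewrite mulrCA ler_wpM2l ?(ltW k0)//.
  by apply: le_trans (ler_normB _ _) _; apply/ltW/sum2.
by rewrite mulrA nh /N divfK ?gt_eqF// leNgt ltrDl ltr01.
Qed.

End Instability.
End Setting.

(** * Orbital instability *)

Theorem theorem2p6 (R : realType) (X : hilbertType R)
    (V W : completeNormedModType R) (M : setting X V W)
    (hspaces : spaces M)
    (h1 : A1 M) (h2 : A2 M) (h3 : A3 M) (h4 : A4 M) (h5 : A5 M) (h6 : A6 M)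
    (c : R) (hc : s_speeds M c)
    (hd : derive1n 2 (moment M) c < 0)
    (hloc : local_existence M c) :
  orbitally_unstable M c.
Proof.
set Uc := s_U M c.
have [H [A [mu [chi [Sigma [[hessH _] [AH sA] specA [mu0 chiE chi1 x0E] [delta delta0 Sd]]]]]]] :=
  h6 c hc.
have hessian v w : inner (A (s_jV M v)) (s_jV M w) =
    frechet (frechet (augE M c)) (s_jW M Uc) v w.
  by rewrite -hessH -AH.
pose psi := jWX M (speed_derivative M c).
have Apsi x : inner (A psi) x = s_gradP M (s_jW M Uc) x.
  rewrite -[LHS]/(riesz (A psi) x); move: x; apply: (dual_eq_on_V h4) => w.
  rewrite -[LHS]/(inner (A (s_jV M (s_jW M (speed_derivative M c)))) (s_jV M w)) hessian.
  exact: (hessian_speed_derivative hspaces h2 h3 h4 h5 hc).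
(* This is where the concavity of the moment enters. *)
have lpsi : 0 < (s_gradP M (s_jW M Uc) psi : R).
  by rewrite -oppr_lt0 -(moment_second_derivative hspaces h2 h3 h4 h5 hc).
have chineg : inner (A chi) chi < 0.
  by have [_ -> _] := chiE; rewrite innerZl inner_norm chi1 expr1n mulr1.
have [y [b [y_reg y_tan zneg]]] :=
  negative_direction hspaces h2 h4 (OVc h5 hc) sA Apsi lpsi chineg.
have [kappa [K [kappa0 K0 coercive]]] :=
  index_one_coercive sA specA mu0 chiE chi1 x0E delta0 Sd zneg.
have [nuE nuE0 esc] := escape hspaces h1 h2 h3 h4 h5 hc hessian y_reg y_tan kappa0 K0 coercive.
have [nuL [t0 [nuL0 t00 local]]] := hloc.
have tube_sub nu nu' u : nu <= nu' -> tube M c nu u -> tube M c nu' u.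
  by move=> nn [Ou lt]; split => //; exact: lt_le_trans lt nn.
exists (Num.min nuE nuL); first by rewrite lt_min nuE0.
move=> nu /andP[nu0]; rewrite lt_min => /andP[nuE' nuL'].
have [u0 tu0 E0] := unstable_data hspaces h1 h2 h3 h4 h5 hc hessian zneg nu0.
exists u0 => //; have [N N0 {}esc] := esc _ E0.
have solP t1 u : 0 < t1 -> solution M t1 u0 u <-> strict_solution M t1 u /\ u 0 = u0.
  move=> t10; split=> -[su u0E]; split => //.
    exact: (strict_solutionP h2 h3 u t10).1.
  exact: (strict_solutionP h2 h3 u t10).2.
have T0 : 0 < N + 2 by rewrite addr_gt0.
(* If some solution lives long enough, its escape time is the one to take. *)
have [[u su]|long] := pselect (exists u, solution M (N + 2) u0 u).
  exists (N + 2); split => //; first by exists u.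
  move=> w [sw w0]; have [||t tt out] := esc (N + 2) w _ sw; first by lra.
    by rewrite w0.
  by exists t => // /(tube_sub _ nuE); rewrite ge_min lexx => /(_ isT).
(* No solution reaches the time of escape: take a maximal number of steps of half
   the local existence time.  A solution staying in the tube could be continued by
   one more step, restarting it one step before its end. *)
pose h := t0 / 2; have hp : 0 < h by rewrite divr_gt0.
pose S (j : nat) := exists u, solution M (j.+1%:R * h) u0 u.
have jh j : 0 < j.+1%:R * h by rewrite mulr_gt0.
have S0 : S 0%N.
  have [u [su u0E] _] := local u0 (tube_sub _ _ _ (ltW nuL') tu0).
  exists u; apply/solP => //; split => //.
  apply: (@strict_solution_restrict _ _ _ _ _ t0); first by rewrite mul1r /h; lra.
  exact: (strict_solutionP h2 h3 u t00).1.
have [j [Sj Sj1]] : exists j, S j /\ ~ S j.+1.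
  apply: contrapT => none.
  have all j : S j.
    elim: j => // j IH; apply: contrapT => nS; apply: none; by exists j.
  apply: long; have [u /solP su] := all (Num.truncn ((N + 2) / h)).
  exists u; apply/solP => //; have [{}su u0E] := su (jh _); split => //.
  apply: strict_solution_restrict su; rewrite -ler_pdivrMr//; apply: ltW; exact: truncnS_gt.
exists (j.+1%:R * h); split => // u sol; apply: contrapT => stay.
have [su u0E] := (solP _ u (jh j)).1 sol.
have sI : 0 <= j%:R * h < j.+1%:R * h.
  by rewrite mulr_ge0 ?(ltW hp)//= ltr_pM2r// ltr_nat.
have tube_s : tube M c nuL (u (j%:R * h)).
  apply: contrapT => out; apply: stay; exists (j%:R * h); first by rewrite in_itv.
  by move=> /(tube_sub _ nuL); rewrite ge_min lexx orbT => /(_ isT).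
have [v [sv v0] _] := local _ tube_s.
have [w w0 sw] := strict_solution_glue h2 h3 sI v0 su ((strict_solutionP h2 h3 v t00).1 sv).
apply: Sj1; exists w; apply/solP => //; split; last by rewrite w0.
suff -> : j.+2%:R * h = j%:R * h + t0 by [].
by rewrite -2!natr1 /h; field.
Qed.
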